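(* Let $(M^4,g,I)$ be an almost Hermitian $4$-manifold whose canonical Hermitian connection $\widetilde\nabla$ has vanishing curvature, $\widetilde R=0$. Then: (i) the metric $g$ is flat; (ii) if $(\sigma_1,\sigma_2,\sigma_3)$ is a (local) $\nabla$-parallel orthonormal basis of selfdual $2$-forms, then $$\omega_I=\sigma_1\cos\varphi\cos\psi+\sigma_2\cos\varphi\sin\psi+\sigma_3\sin\varphi,$$ where $\varphi$ and $\psi$ are locally defined functions on $M$ subject to $d\psi\wedge d\varphi=0$.
   Context: $(M^4,g,I)$ almost Hermitian: $g$ is a Riemannian metric and $I$ an almost complex structure with $g(I\cdot,I\cdot)=g$. The K\''ahler form is $\omega_I=g(I\cdot,\cdot)$, and $M$ is oriented so that $\omega_I$ is selfdual. $\nabla$ is the Levi-Civita connection of $g$, $\eta=\frac12(\nabla I)I$ is the intrinsic torsion, and the canonical Hermitian connection is $\widetilde\nabla=\nabla+\eta$, i.e. $\widetilde\nabla_XY=\nabla_XY+\frac12(\nabla_XI)IY$; it satisfies $\widetilde\nabla g=0$, $\widetilde\nabla I=0$. Its curvature is $\widetilde R(X,Y)=-[\widetilde\nabla_X,\widetilde\nabla_Y]+\widetilde\nabla_{[X,Y]}$. In (ii) orthonormality of $2$-forms is normalised so that K\''ahler forms $g(J\cdot,\cdot)$ of orthogonal almost complex structures $J$ have unit length.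
   Formalization: Smooth φ, ψ are claimed near points not on the boundary of the set where ω_I = ±σ_3, since at such boundary points continuous angles may fail to exist; dψ∧dφ=0 is proved for all smooth φ, ψ satisfying the formula on any open set, poles included. *)

(* Defs.v *)
(* Smooth 4-manifolds are given by an atlas, and tensor fields by their
   components in every chart together with the transformation law.  Tangent
   vectors are row vectors, so an endomorphism acts by [v *m A], a bilinear
   form by [u *m B *m v^T], and a Jacobian matrix pushes [v] to [v *m J]. *)
From HB Require Import structures.
From mathcomp Require Import all_boot all_order all_algebra all_fingroup.
From mathcomp Require Import all_classical all_reals all_analysis.

Set Implicit Arguments.
Unset Strict Implicit.
Unset Printing Implicit Defensive.

Import Order.TTheory GRing.Theory Num.Theory.
Import numFieldNormedType.Exports.

Local Open Scope classical_set_scope.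
Local Open Scope ring_scope.

Definition ebase (R : realType) (i : 'I_4) : 'rV[R]_4 := delta_mx 0 i.
Arguments ebase {R} i.

(* Only meaningful for open [U]. *)
Fixpoint Ck (R : realType) (V : normedModType R) (k : nat)
    (U : set 'rV[R]_4) (f : 'rV[R]_4 -> V) {struct k} : Prop :=
  if k is k'.+1 then
    (forall x, U x -> differentiable f x) /\
    (forall i : 'I_4, Ck k' U (fun x => 'D_(ebase i) f x))
  else forall x, U x -> {for x, continuous f}.

Definition smooth_on (R : realType) (V : normedModType R)
    (U : set 'rV[R]_4) (f : 'rV[R]_4 -> V) : Prop :=
  forall k, Ck k U f.

Record manifold4 (R : realType) := Manifold4 {
  pt :> topologicalType ;
  pt_hausdorff : hausdorff_space pt ;
  pt_second_countable : @second_countable pt ;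
  chart : Type ;
  cdom : chart -> set pt ;
  cmap : chart -> pt -> 'rV[R]_4 ;
  cinv : chart -> 'rV[R]_4 -> pt ;
  cdom_open : forall a, open (cdom a) ;
  cdom_cover : forall p, exists a, cdom a p ;
  cmapK : forall a p, cdom a p -> cinv a (cmap a p) = p ;
  cmap_continuous : forall a p, cdom a p -> {for p, continuous (cmap a)} ;
  cimg_open : forall a, open (cmap a @` cdom a) ;
  cinv_continuous : forall a x, (cmap a @` cdom a) x ->
    {for x, continuous (cinv a)} ;
  transition_smooth : forall a b,
    smooth_on (cmap a @` (cdom a `&` cdom b)) (fun x => cmap b (cinv a x))
}.

Section Manifold.
Context {R : realType} {M : manifold4 R}.

Definition cimage (a : chart M) (W : set M) : set 'rV[R]_4 :=
  cmap a @` (cdom a `&` W).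

Definition transition (a b : chart M) (x : 'rV[R]_4) : 'rV[R]_4 :=
  cmap b (cinv a x).

Definition smooth_fun (V : set M) (f : M -> R) : Prop :=
  forall a, smooth_on (cimage a V) (fun x => f (cinv a x)).

(* Components of a tensor field with two indices. *)
Definition field2 : Type := chart M -> 'rV[R]_4 -> 'M[R]_4.

Definition bilinear_field (W : set M) (T : field2) : Prop :=
  (forall a, smooth_on (cimage a W) (T a)) /\
  (forall a b x, cimage a (W `&` cdom b) x ->
     T a x = jacobian (transition a b) x *m T b (transition a b x)
               *m (jacobian (transition a b) x)^T).

Definition endo_field (W : set M) (T : field2) : Prop :=
  (forall a, smooth_on (cimage a W) (T a)) /\
  (forall a b x, cimage a (W `&` cdom b) x ->
     T a x *m jacobian (transition a b) x
     = jacobian (transition a b) x *m T b (transition a b x)).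

Definition two_form (W : set M) (s : field2) : Prop :=
  bilinear_field W s /\ (forall a x, cimage a W x -> (s a x)^T = - s a x).

End Manifold.
Arguments field2 {R} M.

Definition bil (R : realType) (B : 'M[R]_4) (u v : 'rV[R]_4) : R :=
  (u *m B *m v^T) 0 0.

Definition riemannian_metric (R : realType) (M : manifold4 R)
    (g : field2 M) : Prop :=
  bilinear_field setT g /\
  (forall a x, cimage a setT x ->
     (g a x)^T = g a x /\ (forall v, v != 0 -> 0 < bil (g a x) v v)).

Definition almost_complex (R : realType) (M : manifold4 R)
    (I : field2 M) : Prop :=
  endo_field setT I /\
  (forall a x, cimage a setT x -> I a x *m I a x = - 1%:M).

Definition almost_hermitian (R : realType) (M : manifold4 R)
    (g I : field2 M) : Prop :=
  [/\ riemannian_metric g, almost_complex I &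
      forall a x, cimage a setT x -> forall u v,
        bil (g a x) (u *m I a x) (v *m I a x) = bil (g a x) u v].

(* The matrix of (u, v) |-> g(I u, v). *)
Definition kaehler_form (R : realType) (M : manifold4 R) (g I : field2 M) :
  field2 M := fun a x => I a x *m g a x.

Section Connections.
Context {R : realType}.
Notation E := 'rV[R]_4.
Implicit Types (G J : E -> 'M[R]_4) (X Y Z : E -> E).

(* A connection in a chart: [D X Y] is the derivative of [Y] along [X]. *)
Definition connection : Type := (E -> E) -> (E -> E) -> E -> E.

(* christoffel G i j k x is Gamma^k_{ij}. *)
Definition christoffel G (i j k : 'I_4) (x : E) : R :=
  2^-1 * \sum_(l < 4) invmx (G x) k l *
    ('D_(ebase i) (fun y => G y j l) x + 'D_(ebase j) (fun y => G y i l) x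
     - 'D_(ebase l) (fun y => G y i j) x).

Definition levi_civita G : connection := fun X Y x =>
  'D_(X x) Y x +
  \row_k (\sum_(i < 4) \sum_(j < 4) X x 0 i * Y x 0 j * christoffel G i j k x).

(* (nabla_X J) Y = nabla_X (J Y) - J (nabla_X Y) *)
Definition nabla_endo G J X Y : E -> E := fun x =>
  levi_civita G X (fun y => Y y *m J y) x - levi_civita G X Y x *m J x.

Definition canonical_hermitian G J : connection := fun X Y x =>
  levi_civita G X Y x + 2^-1 *: nabla_endo G J X (fun y => Y y *m J y) x.

Definition lie_bracket X Y : E -> E := fun x =>
  'D_(X x) Y x - 'D_(Y x) X x.

Definition curvature (D : connection) X Y Z : E -> E := fun x =>
  - (D X (D Y Z) x - D Y (D X Z) x) + D (lie_bracket X Y) Z x.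

Definition flat_on (U : set E) (D : connection) : Prop :=
  forall X Y Z, smooth_on U X -> smooth_on U Y -> smooth_on U Z ->
  forall x, U x -> curvature D X Y Z x = 0.

Definition parallel_on (U : set E) G (s : E -> 'M[R]_4) : Prop :=
  forall X Y Z, smooth_on U X -> smooth_on U Y -> smooth_on U Z ->
  forall x, U x ->
    'D_(X x) (fun y => bil (s y) (Y y) (Z y)) x
    - bil (s x) (levi_civita G X Y x) (Z x)
    - bil (s x) (Y x) (levi_civita G X Z x) = 0.

End Connections.

(* [o a x] is 1 or -1 according to whether the coordinate frame of the chart
   [a] at [x] is positively or negatively oriented. *)
Definition orientation (R : realType) (M : manifold4 R)
    (o : chart M -> 'rV[R]_4 -> R) : Prop :=
  [/\ forall a x, cimage a setT x -> o a x = 1 \/ o a x = - 1,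
      forall a x, cimage a setT x -> {for x, continuous (o a)} &
      forall a b x, cimage a (cdom b) x ->
        o a x = Num.sg (\det (jacobian (@transition R M a b) x))
                * o b (transition a b x)].

(* ( *s )_{ij} = 1/2 o sqrt(det g) sum_{kl} eps_{ijkl} s^{kl}, where
   s^{kl} are the entries of g^-1 s g^-1. *)
Definition hodge_star (R : realType) (o : R) (G s : 'M[R]_4) : 'M[R]_4 :=
  \matrix_(i, j) (2^-1 * o * Num.sqrt (\det G) *
    \sum_(p : 'S_4 | (p (inord 0) == i) && (p (inord 1) == j))
      (-1) ^+ (odd_perm p) *
      (invmx G *m s *m invmx G) (p (inord 2)) (p (inord 3))).

Definition selfdual (R : realType) (M : manifold4 R) (g : field2 M)
    (o : chart M -> 'rV[R]_4 -> R) (W : set M) (s : field2 M) : Prop :=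
  forall a x, cimage a W x -> hodge_star (o a x) (g a x) (s a x) = s a x.

(* 1/4 sum s_{ij} t_{kl} g^{ik} g^{jl}; the factor 1/4 gives unit length to
   the forms g(J., .) with J an orthogonal almost complex structure. *)
Definition form_dot (R : realType) (G s t : 'M[R]_4) : R :=
  4^-1 * \tr (s *m invmx G *m t^T *m invmx G).

(* Three orthonormal selfdual forms are pointwise a basis, the bundle of
   selfdual 2-forms having rank 3. *)
Definition parallel_selfdual_frame (R : realType) (M : manifold4 R)
    (g : field2 M) (o : chart M -> 'rV[R]_4 -> R) (W : set M)
    (s : 'I_3 -> field2 M) : Prop :=
  [/\ forall i, two_form W (s i),
      forall i, selfdual g o W (s i),
      forall i a, parallel_on (cimage a W) (g a) (s i a) &
      forall i j a x, cimage a W x ->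
        form_dot (g a x) (s i a x) (s j a x) = (i == j)%:R].

Definition spherical_form (R : realType) (M : manifold4 R) (V : set M)
    (w : field2 M) (s : 'I_3 -> field2 M) (phi psi : M -> R) : Prop :=
  forall a x, cimage a V x ->
    let p := cinv a x in
    w a x = (cos (phi p) * cos (psi p)) *: s (inord 0) a x
          + (cos (phi p) * sin (psi p)) *: s (inord 1) a x
          + sin (phi p) *: s (inord 2) a x.

Definition wedge_d_eq0 (R : realType) (M : manifold4 R) (V : set M)
    (f1 f2 : M -> R) : Prop :=
  forall a x, cimage a V x -> forall u v : 'rV[R]_4,
    let d (f : M -> R) e := 'D_e (fun y => f (cinv a y)) x in
    d f1 u * d f2 v - d f1 v * d f2 u = 0.

(* The points of W mapped by w to the poles of the spherical coordinates,
   where the longitude psi is undetermined.  On the frontier of this set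
   continuous angles need not exist: in flat R^4, let w depend only on x_1 and
   reach the pole at x_1 = 0 along psi = pi/2 and leave it along psi = 0. *)
Definition pole_locus (R : realType) (M : manifold4 R) (W : set M)
    (w : field2 M) (s : 'I_3 -> field2 M) : set M :=
  [set p | W p /\ exists2 a, cdom a p &
     (w a (cmap a p) = s (inord 2) a (cmap a p) \/
      w a (cmap a p) = - s (inord 2) a (cmap a p))].

(* Main.v *)
Require Import Defs.
From HB Require Import structures.
From mathcomp Require Import all_boot all_order all_algebra all_fingroup.
From mathcomp Require Import all_classical all_reals all_analysis.
From mathcomp Require Import ring lra.
Import Order.TTheory GRing.Theory Num.Theory.
Import numFieldNormedType.Exports.
Local Open Scope classical_set_scope.
Local Open Scope ring_scope.
Set Implicit Arguments.
Unset Strict Implicit.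
Unset Printing Implicit Defensive.

(* Write N = (nabla I), H = (1/2) I N and nabla~ = nabla + H.  Since H
   anticommutes with I, the part of the Riemann curvature Rm commuting with I
   is, when nabla~ is flat, the commutator [H, H], and the other part is the
   exterior covariant derivative of H.  In dimension 4 the skew endomorphisms
   anticommuting with I form a plane inside the selfdual ones, so [H, H] is a
   decomposable 2-form times I and Rm takes selfdual values.  By pair symmetry
   its components are selfdual 2-forms; a selfdual decomposable 2-form
   vanishes, hence [H, H] = 0.  At a point where some B = H_q is nonzero, all
   H_i are multiples of B, and differentiating tr(H_j I H_q) = 0 shows that
   the component of Rm along I B is again decomposable, hence 0.  What remains
   is a multiple of B (x) B, killed by the first Bianchi identity.  Where H
   vanishes on an open set Rm = 0 trivially, and density does the rest.

   For (ii), selfdual forms satisfy the Clifford relations, so the Kaehler form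
   is c_0 s_0 + c_1 s_1 + c_2 s_2 with c on the sphere and N_i = sum_k (d_i c_k) S_k.
   Then [N_i, N_j] = 0 says that dc_k /\ dc_l = 0, which in spherical
   coordinates is cos^2(phi) dpsi /\ dphi = 0; the points where cos(phi) = 0
   are again dealt with by density. *)

(** * Smooth functions on open subsets of the coordinate space *)

(** The trace of H_j I H_q vanishes because I anticommutes with H_j and H_q while these commute with
    each other. Differentiating it moves the derivative from H_j to H_q. As every H_j is a multiple
    of B, the component of Rm along I B becomes the wedge product of the coefficients of H with a
    1-form built from the derivative of H_q, hence decomposable. This differentiation needs [H, H] =
    0 on an open set, so the pointwise algebra is run twice: at every point to get commuting
    torsions, then again to get Rm = 0 where H is nonzero. The points that are left may form a set
    without interior on which no adapted basis exists; only the continuity of Rm reaches them. Since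
    endomorphisms act on row vectors from the right, products read from left to right and
    (1/2)(nabla I) I becomes the matrix (1/2) I N. *)

Section Calculus.
Context {R : realType}.
Notation E := 'rV[R]_4.
Implicit Types (U : set E) (x : E).

Lemma near_eq_differentiable (V W : normedModType R) (f g : V -> W) (a : V) :
  {near a, f =1 g} -> differentiable f a -> differentiable g a.
Proof.
move=> fg df.
have fga : f a = g a by exact: nbhs_singleton fg.
have gE : g \o shift a = cst (g a) + 'd f a +o_ 0 id.
  apply/eqaddoP => e e0.
  have := diff_locally df => /eqaddoP /(_ e e0).
  have fg0 : \forall h \near (0 : V), f (h + a) = g (h + a).
    have := fg; rewrite (near_shift 0 a) /=; apply: filterS => h /=.
    by rewrite subr0.
  move=> H; apply: filterS2 fg0 H => h fgh.
  by rewrite !fctE /= fga fgh.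
have dfg : 'd g a = 'd f a :> (V -> W).
  by apply: diff_unique => //; exact: diff_continuous.
by apply/diff_locallyP; rewrite dfg; split=> //; exact: diff_continuous.
Qed.

Lemma open_near U (P : E -> Prop) x :
  open U -> U x -> (forall y, U y -> P y) -> \forall y \near x, P y.
Proof.
by move=> oU Ux UP; apply: filterS (open_nbhs_nbhs _); [exact: UP | split].
Qed.

Lemma derive_partial (W : normedModType R) (f : E -> W) x v :
  differentiable f x -> 'D_v f x = \sum_(i < 4) v 0 i *: 'D_(ebase i) f x.
Proof.
move=> df; rewrite deriveE // {1}(row_sum_delta v) linear_sum /=.
by apply: eq_bigr => i _; rewrite linearZ /= deriveE.
Qed.

(** Derivatives depend on germs only, and [U] is open. The closure lemmas below know the derivative
    of a combination on [U] only, so each of their induction steps passes through this lemma. *)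
Lemma Ck_ext (V : normedModType R) k U (f g : E -> V) :
  open U -> (forall x, U x -> f x = g x) -> Ck k U f -> Ck k U g.
Proof.
move=> oU; elim: k f g => [|k IH] f g fg;
  have nfg x (Ux : U x) : {near x, f =1 g} by exact: (open_near oU Ux fg).
  move=> cf x Ux; rewrite /prop_for /continuous_at -(fg x Ux).
  exact: cvg_trans (near_eq_cvg (nfg x Ux)) (cf x Ux).
move=> [df dk]; split=> [x Ux|i].
  exact: near_eq_differentiable (nfg x Ux) (df x Ux).
by apply: IH (dk i) => x Ux; apply: near_eq_derive; exact: nfg.
Qed.

Lemma Ck_sub (V : normedModType R) k U U' (f : E -> V) :
  U `<=` U' -> Ck k U' f -> Ck k U f.
Proof.
move=> UU'; elim: k f => [|k IH] f /=; first by move=> cf x /UU' /cf.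
by move=> [df dk]; split=> [x /UU' /df|i] //; apply: IH.
Qed.

Lemma Ck_pred (V : normedModType R) k U (f : E -> V) : Ck k.+1 U f -> Ck k U f.
Proof.
elim: k f => [|k IH] f [df dk]; last by split=> // i; apply: IH; apply: dk.
by move=> x Ux; exact/differentiable_continuous/df.
Qed.

Lemma Ck_cst (V : normedModType R) k U (c : V) : Ck k U (fun=> c).
Proof.
elim: k c => [|k IH] c /=; first by move=> x _; exact: cst_continuous.
split=> [x _|i]; first exact: differentiable_cst.
suff -> : (fun x : E => 'D_(ebase i) (fun=> c : V) x) = (fun=> 0) by exact: IH.
by apply/funext => x; exact: derive_cst.
Qed.

Lemma CkD (V : normedModType R) k U (f g : E -> V) :
  open U -> Ck k U f -> Ck k U g -> Ck k U (fun x => f x + g x).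
Proof.
move=> oU; elim: k f g => [|k IH] f g.
  by move=> cf cg x Ux; exact: (continuousD (cf x Ux) (cg x Ux)).
move=> [df dkf] [dg dkg]; split=> [x Ux|i].
  by apply: differentiableD; [exact: df | exact: dg].
apply: (Ck_ext oU _ (IH _ _ (dkf i) (dkg i))) => x Ux.
by rewrite -deriveD //; apply: diff_derivable; [exact: df | exact: dg].
Qed.

Lemma CkZ (V : normedModType R) k U (c : R) (f : E -> V) :
  open U -> Ck k U f -> Ck k U (fun x => c *: f x).
Proof.
move=> oU; elim: k f => [|k IH] f.
  by move=> cf x Ux; exact: (continuousZl_tmp (cf x Ux)).
move=> [df dkf]; split=> [x Ux|i]; first exact/differentiableZ/df.
apply: (Ck_ext oU _ (IH _ (dkf i))) => x Ux.
by rewrite -deriveZ //; apply: diff_derivable; exact: df.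
Qed.

Lemma CkM k U (f g : E -> R) :
  open U -> Ck k U f -> Ck k U g -> Ck k U (fun x => f x * g x).
Proof.
move=> oU; elim: k f g => [|k IH] f g.
  by move=> cf cg x Ux; exact: (continuousM (cf x Ux) (cg x Ux)).
move=> kf kg; have [df dkf] := kf; have [dg dkg] := kg; split=> [x Ux|i].
  by apply: differentiableM; [exact: df | exact: dg].
have := CkD oU (IH _ _ (Ck_pred kf) (dkg i)) (IH _ _ (Ck_pred kg) (dkf i)).
apply: Ck_ext => // x Ux; rewrite -[in RHS]/(f * g) deriveM //.
  by apply: diff_derivable; exact: df.
by apply: diff_derivable; exact: dg.
Qed.

Lemma Ck_sum (V : normedModType R) k U (I : Type) (r : seq I) (P : pred I)
    (f : I -> E -> V) :
  open U -> (forall i, Ck k U (f i)) ->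
  Ck k U (fun x => \sum_(i <- r | P i) f i x).
Proof.
move=> oU cf; elim: r => [|i r IH].
  apply: (Ck_ext oU (f := fun=> 0 : V)) => [x _|]; first by rewrite big_nil.
  exact: Ck_cst.
apply: (Ck_ext oU (f := fun x => (if P i then f i x else 0)
    + \sum_(j <- r | P j) f j x)) => [x _|].
  by rewrite big_cons; case: ifP => //; rewrite add0r.
apply: CkD => //; case: (P i); [exact: cf | exact: Ck_cst].
Qed.

Lemma Ck_prod k U (I : Type) (r : seq I) (P : pred I) (f : I -> E -> R) :
  open U -> (forall i, Ck k U (f i)) ->
  Ck k U (fun x => \prod_(i <- r | P i) f i x).
Proof.
move=> oU cf; elim: r => [|i r IH].
  apply: (Ck_ext oU (f := fun=> 1 : R)) => [x _|]; first by rewrite big_nil.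
  exact: Ck_cst.
apply: (Ck_ext oU (f := fun x => (if P i then f i x else 1)
    * \prod_(j <- r | P j) f j x)) => [x _|].
  by rewrite big_cons; case: ifP => //; rewrite mul1r.
apply: CkM => //; case: (P i); [exact: cf | exact: Ck_cst].
Qed.

Lemma CkV k U (f : E -> R) : open U -> (forall x, U x -> f x != 0) ->
  Ck k U f -> Ck k U (fun x => (f x)^-1).
Proof.
move=> oU f0; elim: k => [|k IH].
  by move=> cf x Ux; exact: (continuousV (f0 x Ux) (cf x Ux)).
move=> kf; have [df dkf] := kf; split=> [x Ux|i].
  by apply: differentiableV; [exact: df | exact: f0].
have kV := IH (Ck_pred kf).
have := CkZ (-1) oU (CkM oU (CkM oU kV kV) (dkf i)).
apply: Ck_ext => // x Ux; rewrite deriveV ?f0 //; last first.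
  by apply: diff_derivable; exact: df.
by rewrite scaleN1r scaleNr expr2 invfM.
Qed.

Lemma derive_compR (f : E -> R) (h : R -> R) x v (dh : R) :
  differentiable f x -> is_derive (f x) 1 h dh ->
  'D_v (fun y => h (f y)) x = dh * 'D_v f x.
Proof.
move=> df [dhx <-]; have dhf := (derivable1_diffP _ _).1 dhx.
rewrite -[fun y => _]/(h \o f) deriveE; last exact: differentiable_comp.
by rewrite diff_comp // /comp /= diff1E // derive1E (deriveE _ df) mulrC.
Qed.

(** The regularity of [dh] after [f] is left as a hypothesis, one order lower, so that an induction
    on the order can supply it. *)
Lemma Ck_compR k U (f : E -> R) (h dh : R -> R) : open U ->
  (forall y : R, is_derive y 1 h (dh y)) ->
  Ck k.+1 U f -> Ck k U (fun x => dh (f x)) -> Ck k.+1 U (fun x => h (f x)).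
Proof.
move=> oU dhP kf kdh; have [df dkf] := kf; split=> [x Ux|i].
  by apply: differentiable_comp; [exact: df |
    apply/derivable1_diffP; case: (dhP (f x))].
have := CkM oU kdh (dkf i); apply: Ck_ext => // x Ux.
by rewrite (derive_compR _ (df x Ux) (dhP _)).
Qed.

Lemma Ck_atan k U (f : E -> R) :
  open U -> Ck k U f -> Ck k U (fun x => atan (f x)).
Proof.
move=> oU; case: k => [|k].
  by move=> cf x Ux; apply: continuous_comp; [exact: cf | exact: continuous_atan].
move=> kf; apply: (Ck_compR oU _ kf) => //.
apply: CkV => // [x _|].
  by rewrite gt_eqF // ltr_wpDr // sqr_ge0.
apply: CkD => //; first exact: Ck_cst.
have kf' := Ck_pred kf.
by apply: (Ck_ext oU _ (CkM oU kf' kf')) => x _; rewrite expr2.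
Qed.

(** Both at once, because each is the derivative of the other up to sign. *)
Lemma Ck_cos_sin k U (f : E -> R) : open U -> Ck k U f ->
  Ck k U (fun x => cos (f x)) /\ Ck k U (fun x => sin (f x)).
Proof.
move=> oU; elim: k => [|k IH].
  by move=> cf; split=> x Ux; apply: continuous_comp; (try exact: cf);
    [exact: continuous_cos | exact: continuous_sin].
move=> kf; have [kc ks] := IH (Ck_pred kf); split.
  apply: (Ck_compR (dh := fun y => - sin y) oU _ kf) => //.
  by apply: (Ck_ext oU _ (CkZ (-1) oU ks)) => x _; rewrite scaleN1r.
exact: (Ck_compR (dh := cos) oU _ kf).
Qed.

Lemma differentiable_mxP m n (F : E -> 'M[R]_(m, n)) x :
  differentiable F x <-> forall i j, differentiable (fun y => F y i j) x.
Proof.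
split=> [dF i j|dF].
  exact: (differentiable_comp dF (differentiable_coord _ i j)).
rewrite (_ : F = \sum_(i < m) \sum_(j < n) (fun y => F y i j *: delta_mx i j)).
  apply: differentiable_sum => i; apply: differentiable_sum => j.
  exact/differentiableZl.
apply/funext => y; rewrite fct_sumE {1}(matrix_sum_delta (F y)).
by apply: eq_bigr => i _; rewrite fct_sumE.
Qed.

Lemma derive_mxE m n (F : E -> 'M[R]_(m, n)) x v i j : derivable F x v ->
  'D_v F x i j = 'D_v (fun y => F y i j) x.
Proof. by move=> dF; rewrite derive_mx // mxE. Qed.

Lemma Ck_mxP m n k U (F : E -> 'M[R]_(m, n)) : open U ->
  Ck k U F <-> forall i j, Ck k U (fun y => F y i j).
Proof.
move=> oU; elim: k F => [|k IH] F.
  split=> [cF i j x Ux|cF].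
    exact: (continuous_comp (cF x Ux) (@coord_continuous _ _ _ i j _)).
  apply: (Ck_ext oU (f := fun y => \sum_i \sum_j F y i j *: delta_mx i j)) => [x _|].
    by rewrite -matrix_sum_delta.
  apply: Ck_sum => // i; apply: Ck_sum => // j x Ux.
  exact: (continuousZr_tmp (cF i j x Ux)).
split=> [[dF dkF] i j|cF].
  split=> [x Ux|l]; first by have /differentiable_mxP := dF x Ux; apply.
  have /IH /(_ i j) := dkF l; apply: Ck_ext => // x Ux.
  by rewrite derive_mxE //; apply: diff_derivable; exact: dF.
have dF x : U x -> differentiable F x.
  by move=> Ux; apply/differentiable_mxP => i j; have [df _] := cF i j; exact: df.
split=> // l; apply/IH => i j; have [_ /(_ l)] := cF i j.
apply: Ck_ext => // x Ux.
by rewrite derive_mxE //; apply: diff_derivable; exact: dF.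
Qed.

End Calculus.

(** * Closure properties of smooth maps and the symmetry of second derivatives *)

Section SmoothFunctions.
Context {R : realType}.
Notation E := 'rV[R]_4.
Implicit Types (U : set E) (x : E).

Lemma smooth_mxP m n U (F : E -> 'M[R]_(m, n)) : open U ->
  smooth_on U F <-> forall i j, smooth_on U (fun y => F y i j).
Proof.
move=> oU; split=> [sF i j k|sF k]; last by apply/Ck_mxP => // i j; exact: sF.
by have /(Ck_mxP _ _ oU) := sF k; apply.
Qed.

Lemma smooth_ext (V : normedModType R) U (f g : E -> V) :
  open U -> (forall x, U x -> f x = g x) -> smooth_on U f -> smooth_on U g.
Proof. by move=> oU fg sf k; exact: Ck_ext oU fg (sf k). Qed.

Lemma smooth_sub (V : normedModType R) U U' (f : E -> V) :
  U `<=` U' -> smooth_on U' f -> smooth_on U f.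
Proof. by move=> UU' sf k; exact: Ck_sub UU' (sf k). Qed.

Lemma smooth_differentiable (V : normedModType R) U (f : E -> V) x :
  smooth_on U f -> U x -> differentiable f x.
Proof. by move=> /(_ 1%N)[df _]; exact: df. Qed.

Lemma smooth_derivable (V : normedModType R) U (f : E -> V) x v :
  smooth_on U f -> U x -> derivable f x v.
Proof. by move=> sf Ux; exact/diff_derivable/(smooth_differentiable sf). Qed.

Lemma smooth_derive (V : normedModType R) U (f : E -> V) i :
  smooth_on U f -> smooth_on U (fun x => 'D_(ebase i) f x).
Proof. by move=> sf k; have [_] := sf k.+1; apply. Qed.

Lemma smooth_cst (V : normedModType R) U (c : V) : smooth_on U (fun=> c).
Proof. by move=> k; exact: Ck_cst. Qed.

Lemma smoothD (V : normedModType R) U (f g : E -> V) :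
  open U -> smooth_on U f -> smooth_on U g -> smooth_on U (fun x => f x + g x).
Proof. by move=> oU sf sg k; exact: CkD. Qed.

Lemma smoothZ (V : normedModType R) U c (f : E -> V) :
  open U -> smooth_on U f -> smooth_on U (fun x => c *: f x).
Proof. by move=> oU sf k; exact: CkZ. Qed.

Lemma smoothN (V : normedModType R) U (f : E -> V) :
  open U -> smooth_on U f -> smooth_on U (fun x => - f x).
Proof.
move=> oU sf; apply: (smooth_ext oU _ (smoothZ (-1) oU sf)) => x _.
exact: scaleN1r.
Qed.

Lemma smoothB (V : normedModType R) U (f g : E -> V) :
  open U -> smooth_on U f -> smooth_on U g -> smooth_on U (fun x => f x - g x).
Proof. by move=> oU sf sg; apply: smoothD => //; exact: smoothN. Qed.

Lemma smoothM U (f g : E -> R) :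
  open U -> smooth_on U f -> smooth_on U g -> smooth_on U (fun x => f x * g x).
Proof. by move=> oU sf sg k; exact: CkM. Qed.

Lemma smooth_sum (V : normedModType R) U (I : Type) (r : seq I) (P : pred I)
    (f : I -> E -> V) :
  open U -> (forall i, smooth_on U (f i)) ->
  smooth_on U (fun x => \sum_(i <- r | P i) f i x).
Proof. by move=> oU sf k; apply: Ck_sum => // i; exact: sf. Qed.

Lemma smooth_prod U (I : Type) (r : seq I) (P : pred I) (f : I -> E -> R) :
  open U -> (forall i, smooth_on U (f i)) ->
  smooth_on U (fun x => \prod_(i <- r | P i) f i x).
Proof. by move=> oU sf k; apply: Ck_prod => // i; exact: sf. Qed.

Lemma smoothV U (f : E -> R) : open U -> (forall x, U x -> f x != 0) ->
  smooth_on U f -> smooth_on U (fun x => (f x)^-1).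
Proof. by move=> oU f0 sf k; exact: CkV. Qed.

Lemma smooth_atan U (f : E -> R) :
  open U -> smooth_on U f -> smooth_on U (fun x => atan (f x)).
Proof. by move=> oU sf k; exact: Ck_atan. Qed.

Lemma smooth_cos U (f : E -> R) :
  open U -> smooth_on U f -> smooth_on U (fun x => cos (f x)).
Proof. by move=> oU sf k; have [] := Ck_cos_sin oU (sf k). Qed.

Lemma smooth_sin U (f : E -> R) :
  open U -> smooth_on U f -> smooth_on U (fun x => sin (f x)).
Proof. by move=> oU sf k; have [] := Ck_cos_sin oU (sf k). Qed.

Lemma smooth_mulmx m n p U (A : E -> 'M[R]_(m, n)) (B : E -> 'M[R]_(n, p)) :
  open U -> smooth_on U A -> smooth_on U B -> smooth_on U (fun x => A x *m B x).
Proof.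
move=> oU /(smooth_mxP _ oU) sA /(smooth_mxP _ oU) sB.
apply/smooth_mxP => // i j.
apply: (smooth_ext oU (f := fun x => \sum_k A x i k * B x k j)) => [x _|].
  by rewrite mxE.
by apply: smooth_sum => // k; apply: smoothM.
Qed.

Lemma smooth_scalemx m n U (f : E -> R) (A : E -> 'M[R]_(m, n)) :
  open U -> smooth_on U f -> smooth_on U A -> smooth_on U (fun x => f x *: A x).
Proof.
move=> oU sf /(smooth_mxP _ oU) sA; apply/smooth_mxP => // i j.
apply: (smooth_ext oU (f := fun x => f x * A x i j)) => [x _|].
  by rewrite mxE.
exact: smoothM.
Qed.

Lemma smooth_trmx m n U (A : E -> 'M[R]_(m, n)) :
  open U -> smooth_on U A -> smooth_on U (fun x => (A x)^T).
Proof.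
move=> oU /(smooth_mxP _ oU) sA; apply/smooth_mxP => // i j.
by apply: (smooth_ext oU _ (sA j i)) => x _; rewrite mxE.
Qed.

Lemma smooth_mxtrace n U (A : E -> 'M[R]_n) :
  open U -> smooth_on U A -> smooth_on U (fun x => \tr (A x)).
Proof. by move=> oU /(smooth_mxP _ oU) sA; apply: smooth_sum. Qed.

Lemma smooth_det n U (A : E -> 'M[R]_n) :
  open U -> (forall i j, smooth_on U (fun x => A x i j)) ->
  smooth_on U (fun x => \det (A x)).
Proof.
move=> oU sA; apply: smooth_sum => // s.
by apply: smoothM => //; [exact: smooth_cst | apply: smooth_prod].
Qed.

Lemma smooth_invmx n U (A : E -> 'M[R]_n) :
  open U -> (forall x, U x -> A x \in unitmx) ->
  smooth_on U A -> smooth_on U (fun x => invmx (A x)).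
Proof.
move=> oU uA /(smooth_mxP _ oU) sA.
apply: (smooth_ext oU (f := fun x => (\det (A x))^-1 *: \adj (A x))) => [x Ux|].
  by rewrite /invmx uA.
apply: smooth_scalemx => //.
  apply: smoothV => // [x Ux|]; last exact: smooth_det.
  by have := uA x Ux; rewrite unitmxE unitfE.
apply/smooth_mxP => // i j.
apply: (smooth_ext oU (f := fun x => cofactor (A x) j i)) => [x _|].
  by rewrite mxE.
apply: smoothM => //; first exact: smooth_cst.
apply: smooth_det => // k l.
by apply: (smooth_ext oU _ (sA (lift j k) (lift i l))) => x _; rewrite !mxE.
Qed.

Lemma derive_mulmx m n p (A : E -> 'M[R]_(m, n)) (B : E -> 'M[R]_(n, p)) x v :
  derivable A x v -> derivable B x v ->
  'D_v (fun y => A y *m B y) x = 'D_v A x *m B x + A x *m 'D_v B x.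
Proof.
move=> dA dB; have dAe := (derivable_mxP _ _ _).1 dA.
have dBe := (derivable_mxP _ _ _).1 dB.
have entry i j : (fun y => (A y *m B y) i j) =
    \sum_k ((fun y => A y i k) * (fun y => B y k j)).
  by apply/funext => y; rewrite mxE fct_sumE.
have dAB i j k : derivable ((fun y => A y i k) * (fun y => B y k j)) x v.
  by apply: derivableM.
rewrite derive_mx; last first.
  by apply/derivable_mxP => i j; rewrite entry; apply: derivable_sum.
apply/matrixP => i j; rewrite !mxE entry derive_sum //.
rewrite -big_split /=; apply: eq_bigr => k _.
rewrite deriveM // derive_mxE // derive_mxE // addrC.
by congr (_ + _); rewrite mulrC.
Qed.

Lemma derive_trmx m n (A : E -> 'M[R]_(m, n)) x v :
  derivable A x v -> 'D_v (fun y => (A y)^T) x = ('D_v A x)^T.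
Proof.
move=> dA; have dAe := (derivable_mxP _ _ _).1 dA.
have entry i j : (fun y => (A y)^T i j) = (fun y => A y j i).
  by apply/funext => y; rewrite mxE.
rewrite derive_mx; last by apply/derivable_mxP => i j; rewrite entry.
by apply/matrixP => i j; rewrite !mxE entry derive_mxE.
Qed.

Lemma derive_mxtrace n (A : E -> 'M[R]_n) x v :
  derivable A x v -> 'D_v (fun y => \tr (A y)) x = \tr ('D_v A x).
Proof.
move=> dA; have dAe := (derivable_mxP _ _ _).1 dA.
have -> : (fun y => \tr (A y)) = \sum_i (fun y => A y i i).
  by apply/funext => y; rewrite fct_sumE.
by rewrite derive_sum //; apply: eq_bigr => i _; rewrite derive_mxE.
Qed.

Lemma is_derive_line (f : E -> R) e y (t : R) : derivable f (t *: e + y) e ->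
  is_derive t 1 (fun s => f (s *: e + y)) ('D_e f (t *: e + y)).
Proof.
move=> df; have eqf : (fun h : R => h^-1 *: (((fun s => f (s *: e + y)) \o shift t)
      (h *: 1) - f (t *: e + y)))
    = (fun h : R => h^-1 *: ((f \o shift (t *: e + y)) (h *: e) - f (t *: e + y))).
  by apply/funext => h /=; rewrite [h *: 1]mulr1 scalerDl addrA.
by split; rewrite /derivable /derive eqf.
Qed.

Lemma line_MVT (f : E -> R) e y (t : R) : 0 < t ->
  (forall s, 0 <= s <= t -> derivable f (s *: e + y) e) ->
  exists2 c, 0 <= c <= t & f (t *: e + y) - f y = 'D_e f (c *: e + y) * t.
Proof.
move=> t0 df.
have dl s : 0 <= s <= t ->
    is_derive s 1 (fun s => f (s *: e + y)) ('D_e f (s *: e + y)).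
  by move=> /df; exact: is_derive_line.
have [||c] := MVT t0 (f := fun s => f (s *: e + y))
    (df := fun s => 'D_e f (s *: e + y)).
- by move=> s; rewrite in_itv /= => /andP[s0 st]; apply: dl; rewrite !ltW.
- apply: derivable_within_continuous => s; rewrite in_itv /= => sI.
  by have [] := dl s sI.
rewrite in_itv /= => /andP[c0 ct]; rewrite scale0r add0r subr0 => ->.
by exists c; rewrite ?ltW.
Qed.

Lemma growth_rate_shift_arg (f : E -> R) w z v :
  (fun h : R => h^-1 *: (((fun y => f (w + y)) \o shift z) (h *: v) - f (w + z)))
  = (fun h : R => h^-1 *: ((f \o shift (w + z)) (h *: v) - f (w + z))).
Proof. by apply/funext => h /=; rewrite addrCA. Qed.

Lemma derive_shift_arg (f : E -> R) w z v :
  'D_v (fun y => f (w + y)) z = 'D_v f (w + z).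
Proof. by rewrite /derive growth_rate_shift_arg. Qed.

Lemma derivable_shift_arg (f : E -> R) w z v :
  derivable f (w + z) v -> derivable (fun y => f (w + y)) z v.
Proof. by rewrite /derivable growth_rate_shift_arg. Qed.

(* The second difference of [f] over a small parallelogram is the mixed
   derivative at one of its points, by the mean value theorem used twice. *)
Lemma second_difference (f : E -> R) U x (e e' : E) (t : R) : 0 < t ->
  (forall a b, 0 <= a <= t -> 0 <= b <= t -> U (b *: e' + (a *: e + x))) ->
  (forall y, U y -> differentiable f y) ->
  (forall y, U y -> differentiable ('D_e f) y) ->
  exists a b, [/\ 0 <= a <= t, 0 <= b <= t &
    f (t *: e' + (t *: e + x)) - f (t *: e + x) - (f (t *: e' + x) - f x)
    = 'D_e' ('D_e f) (b *: e' + (a *: e + x)) * t * t].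
Proof.
move=> t0 Uab df ddf.
have tI : 0 <= t <= t by rewrite lexx ltW.
have zI : 0 <= (0 : R) <= t by rewrite lexx ltW.
have Ua a : 0 <= a <= t -> U (a *: e + x).
  by move=> aI; have := Uab a 0 aI zI; rewrite scale0r add0r.
pose F z := f (t *: e' + z) - f z.
have [|a aI] := line_MVT (f := F) (e := e) (y := x) t0.
  move=> s sI; apply: derivableB.
    apply: derivable_shift_arg; apply: diff_derivable; apply: df; exact: Uab.
  by apply: diff_derivable; apply: df; exact: Ua.
rewrite /F => ->.
have -> : 'D_e (fun z => f (t *: e' + z) - f z) (a *: e + x) =
   'D_e f (t *: e' + (a *: e + x)) - 'D_e f (a *: e + x).
  rewrite -(derive_shift_arg f (t *: e') (a *: e + x) e); apply: deriveB.
    apply: derivable_shift_arg; apply: diff_derivable; apply: df; exact: Uab.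
  by apply: diff_derivable; apply: df; exact: Ua.
have [|b bI ->] := line_MVT (f := 'D_e f) (e := e') (y := a *: e + x) t0.
  by move=> s sI; apply: diff_derivable; apply: ddf; exact: Uab.
by exists a, b.
Qed.

Lemma norm_triangle_halves (d u v w : R) :
  `|u - w| <= d / 2 -> `|v - w| <= d / 2 -> `|u - v| <= d.
Proof.
move=> uw; rewrite distrC => vw; rewrite -(subrK w u) -addrA (splitr d).
exact: le_trans (ler_normD _ _) (lerD uw vw).
Qed.

(** The second difference is symmetric in the two directions, so the two mixed derivatives agree at
    some pair of points of a small parallelogram. Both are continuous at [x], hence within any [d]
    of each other there. *)
Lemma schwarz U (f : E -> R) x i j : open U -> smooth_on U f -> U x ->
  'D_(ebase i) ('D_(ebase j) f) x = 'D_(ebase j) ('D_(ebase i) f) x.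
Proof.
move=> oU sf Ux.
have df y : U y -> differentiable f y by exact: smooth_differentiable.
have ddf k y : U y -> differentiable ('D_(ebase k) f) y.
  by apply: smooth_differentiable; exact: smooth_derive.
have cont k l : {for x, continuous ('D_(ebase k) ('D_(ebase l) f))}.
  by apply: differentiable_continuous;
     apply: (smooth_differentiable (smooth_derive k (smooth_derive l sf))).
apply/eqP; rewrite -subr_eq0 -normr_le0; apply/ler_addgt0Pr => d d0; rewrite add0r.
have d2 : 0 < d / 2 by rewrite divr_gt0.
have /cvgrPdist_le /(_ _ d2) nij := cont i j.
have /cvgrPdist_le /(_ _ d2) nji := cont j i.
have nU : \forall y \near x, U y by exact: open_nbhs_nbhs.
have [r /= r0 xr] := (nbhs_ballP _ _).1 (filterI nU (filterI nij nji)).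
pose c := `|ebase i : E| + `|ebase j : E| + 1.
have c0 : 0 < c by rewrite ltr_wpDl // addr_ge0.
(* With this side [t * c] is [r / 2], so the whole parallelogram lies in the ball; the summand 1
   keeps [c] positive. *)
pose t := r / c / 2.
have t0 : 0 < t by rewrite !divr_gt0.
have inball k l a b : (k = i /\ l = j) \/ (k = j /\ l = i) ->
    0 <= a <= t -> 0 <= b <= t -> ball x r (b *: ebase l + (a *: ebase k + x)).
  move=> kl /andP[a0 at_] /andP[b0 bt].
  rewrite -ball_normE /ball_ /= opprD opprD addrCA [x + _]addrCA subrr.
  rewrite addr0 -opprD normrN.
  apply: (@le_lt_trans _ _ (t * c)).
    apply: le_trans (ler_normD _ _) _; rewrite !normrZ !ger0_norm //.
    have tl : b * `|ebase l : E| <= t * `|ebase l : E| by rewrite ler_wpM2r.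
    have tk : a * `|ebase k : E| <= t * `|ebase k : E| by rewrite ler_wpM2r.
    apply: le_trans (lerD tl tk) _; rewrite -mulrDr ler_wpM2l ?ltW //.
    by rewrite /c; case: kl => -[-> ->]; rewrite ?(addrC `|ebase j : E|) ltrDl.
  by rewrite /t mulrAC divfK ?gt_eqF // ltr_pdivrMr // ltr_pMr // ltr1n.
have ij : (i = i /\ j = j) \/ (i = j /\ j = i) by left.
have ji : (j = i /\ i = j) \/ (j = j /\ i = i) by right.
have [a [b [aI bI D1]]] := second_difference (U := U) (f := f) (x := x)
  (e := ebase j) (e' := ebase i) t0
  (fun a b aI bI => (xr _ (inball j i a b ji aI bI)).1) df (ddf j).
have [a' [b' [aI' bI' D2]]] := second_difference (U := U) (f := f) (x := x)
  (e := ebase i) (e' := ebase j) t0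
  (fun a b aI bI => (xr _ (inball i j a b ij aI bI)).1) df (ddf i).
have [_ [+ _]] := xr _ (inball j i a b ji aI bI).
have [_ [_ +]] := xr _ (inball i j a' b' ij aI' bI').
rewrite /=.
move: D1 D2; rewrite [t *: ebase j + (t *: ebase i + x)]addrCA.
set p := 'D_(ebase i) _ (b *: _ + _); set q := 'D_(ebase j) _ (b' *: _ + _).
move=> D1 D2.
have pq : p = q.
  have tn0 : t != 0 by rewrite gt_eqF.
  have rearr (u v w z : R) : u - v - (w - z) = u - w - (v - z) by ring.
  have pqt : p * t * t = q * t * t.
    by apply: etrans (esym D1) _; apply: etrans _ D2; exact: rearr.
  exact: (mulIf tn0 (mulIf tn0 pqt)).
rewrite pq => H1 H2.
exact: norm_triangle_halves H2 H1.
Qed.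

Lemma schwarz_mx m n U (F : E -> 'M[R]_(m, n)) x i j :
  open U -> smooth_on U F -> U x ->
  'D_(ebase i) (fun y => 'D_(ebase j) F y) x
  = 'D_(ebase j) (fun y => 'D_(ebase i) F y) x.
Proof.
move=> oU sF Ux; apply/matrixP => k l.
have dd p q : derivable (fun y => 'D_(ebase p) F y) x (ebase q).
  exact: (smooth_derivable (smooth_derive p sF) Ux).
apply: etrans (derive_mxE k l (dd j i)) (etrans _ (esym (derive_mxE k l (dd i j)))).
have eqd q : {near x, (fun y => 'D_(ebase q) F y k l)
    =1 'D_(ebase q) (fun y => F y k l)}.
  apply: (open_near oU Ux) => y Uy; apply: derive_mxE.
  exact: (smooth_derivable sF Uy).
apply: etrans (near_eq_derive _ (eqd j)) (etrans _ (esym (near_eq_derive _ (eqd i)))).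
exact: (schwarz i j oU ((smooth_mxP F oU).1 sF k l) Ux).
Qed.

(** If [f x] were nonzero, [f] would be nonzero near [x], so [P] would fail near [x], and then the
    last hypothesis gives [f x = 0]. This replaces the remark that [P] and the interior of its
    complement together are dense. *)
Lemma eq0_by_density U (P : E -> Prop) (f : E -> R) :
  open U -> (forall x, U x -> {for x, continuous f}) ->
  (forall x, U x -> P x -> f x = 0) ->
  (forall x, U x -> (\forall y \near x, ~ P y) -> f x = 0) ->
  forall x, U x -> f x = 0.
Proof.
move=> oU cf f0 fn x Ux; apply: contrapT => /eqP fx0.
have nz : \forall y \near x, f y != 0 by exact: cvgr_neq0 (cf x Ux) fx0.
have nU : \forall y \near x, U y by exact: open_nbhs_nbhs.
move/negP: fx0; apply; apply/eqP/(fn x Ux).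
by apply: filterS2 nz nU => y /eqP fy Uy Py; apply: fy; exact: f0.
Qed.

End SmoothFunctions.

(** * Connections in a chart *)

(* The partial derivative is locked: otherwise unification unfolds the limits
   hidden in ['D_v f x] when it compares two derivatives. *)
HB.lock Definition pd (R : realType) (m n : nat) (i : 'I_4)
  (F : 'rV[R]_4 -> 'M[R]_(m, n)) (x : 'rV[R]_4) : 'M[R]_(m, n) :=
  'D_(ebase i) F x.

Section PartialDerivatives.
Context {R : realType}.
Notation E := 'rV[R]_4.
Variable (U : set E).
Hypothesis oU : open U.
Implicit Types x : E.

Lemma pdE m n i (F : E -> 'M[R]_(m, n)) x : pd i F x = 'D_(ebase i) F x.
Proof. by rewrite pd.unlock. Qed.

Lemma pd_entry m n i (F : E -> 'M[R]_(m, n)) x k l : smooth_on U F -> U x ->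
  pd i F x k l = 'D_(ebase i) (fun y => F y k l) x.
Proof.
by move=> sF Ux; rewrite pdE; exact: derive_mxE (smooth_derivable sF Ux).
Qed.

Lemma smooth_pd m n i (F : E -> 'M[R]_(m, n)) :
  smooth_on U F -> smooth_on U (pd i F).
Proof.
move=> sF; apply: (smooth_ext oU _ (smooth_derive i sF)) => x _.
by rewrite pdE.
Qed.

Lemma pd_ext m n i (F F' : E -> 'M[R]_(m, n)) x : U x ->
  (forall y, U y -> F y = F' y) -> pd i F x = pd i F' x.
Proof.
move=> Ux FF'; rewrite !pdE; apply: near_eq_derive.
exact: (open_near oU Ux FF').
Qed.

Lemma pd_cst m n i (c : 'M[R]_(m, n)) x : pd i (fun=> c) x = 0.
Proof. by rewrite pdE; exact: derive_cst. Qed.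

Lemma pdD m n i (F F' : E -> 'M[R]_(m, n)) x :
  smooth_on U F -> smooth_on U F' -> U x ->
  pd i (fun y => F y + F' y) x = pd i F x + pd i F' x.
Proof.
move=> sF sF' Ux; rewrite !pdE.
exact: deriveD (smooth_derivable sF Ux) (smooth_derivable sF' Ux).
Qed.

Lemma pdN m n i (F : E -> 'M[R]_(m, n)) x : smooth_on U F -> U x ->
  pd i (fun y => - F y) x = - pd i F x.
Proof.
by move=> sF Ux; rewrite !pdE; exact: deriveN (smooth_derivable sF Ux).
Qed.

Lemma pd_sum m n i (I : finType) (F : I -> E -> 'M[R]_(m, n)) x :
  (forall k, smooth_on U (F k)) -> U x ->
  pd i (fun y => \sum_k F k y) x = \sum_k pd i (F k) x.
Proof.
move=> sF Ux; elim: (index_enum I) => [|k r IH].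
  rewrite big_nil -[RHS](pd_cst i 0 x); apply: pd_ext => // y _.
  by rewrite big_nil.
rewrite big_cons -IH -pdD //; last exact: smooth_sum.
by apply: pd_ext => // y _; rewrite big_cons.
Qed.

Lemma pd_mulmx m n p i (A : E -> 'M[R]_(m, n)) (B : E -> 'M[R]_(n, p)) x :
  smooth_on U A -> smooth_on U B -> U x ->
  pd i (fun y => A y *m B y) x = pd i A x *m B x + A x *m pd i B x.
Proof.
move=> sA sB Ux; rewrite !pdE.
exact: derive_mulmx (smooth_derivable sA Ux) (smooth_derivable sB Ux).
Qed.

Lemma pd_trmx m n i (A : E -> 'M[R]_(m, n)) x : smooth_on U A -> U x ->
  pd i (fun y => (A y)^T) x = (pd i A x)^T.
Proof.
by move=> sA Ux; rewrite !pdE; exact: derive_trmx (smooth_derivable sA Ux).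
Qed.

Lemma pd_schwarz m n i j (F : E -> 'M[R]_(m, n)) x : smooth_on U F -> U x ->
  pd i (pd j F) x = pd j (pd i F) x.
Proof.
move=> sF Ux; rewrite (pdE i) (pdE j).
have e k : pd k F = (fun y => 'D_(ebase k) F y).
  by apply/funext => y; rewrite pdE.
by rewrite !e; exact: (schwarz_mx i j oU sF Ux).
Qed.

Lemma smooth_coord (Y : E -> E) j : smooth_on U Y ->
  smooth_on U (fun y => Y y 0 j).
Proof. by move=> /(smooth_mxP _ oU); apply. Qed.

Lemma pd_scale m n i j (Y : E -> E) (F : E -> 'M[R]_(m, n)) x :
  smooth_on U Y -> smooth_on U F -> U x ->
  pd i (fun y => Y y 0 j *: F y) x = pd i Y x 0 j *: F x + Y x 0 j *: pd i F x.
Proof.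
move=> sY sF Ux.
(* The scalar factor is turned into a scalar matrix, so that the product rule for matrices
   applies. *)
have sYj : smooth_on U (fun y => (Y y 0 j)%:M : 'M[R]_m).
  have -> : (fun y => (Y y 0 j)%:M : 'M[R]_m) = (fun y => Y y 0 j *: 1%:M).
    by apply/funext => y; rewrite scalemx1.
  by apply: smooth_scalemx => //; [exact: smooth_coord | exact: smooth_cst].
have -> : pd i (fun y => Y y 0 j *: F y) x
    = pd i (fun y => (Y y 0 j)%:M *m F y) x.
  by apply: pd_ext => // y _; rewrite mul_scalar_mx.
rewrite pd_mulmx // mul_scalar_mx; congr (_ + _).
rewrite -mul_scalar_mx; congr (_ *m _); apply/matrixP => k l.
rewrite (pd_entry _ _ _ sYj Ux) mxE (pd_entry _ _ _ sY Ux).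
have [->|kl] := eqVneq k l.
  rewrite mulr1n; congr ('D_ _ _ _); apply/funext => y.
  by rewrite !mxE eqxx.
rewrite mulr0n -(derive_cst (0 : R) x (ebase i)); congr ('D_ _ _ _).
by apply/funext => y; rewrite !mxE (negbTE kl).
Qed.

Lemma derive_pd n (F : E -> 'rV[R]_n) x v : differentiable F x ->
  'D_v F x = \sum_i v 0 i *: pd i F x.
Proof.
move=> dF; apply: etrans (derive_partial v dF) _.
by apply: eq_bigr => i _; rewrite pdE.
Qed.

End PartialDerivatives.

(** * Connections given by matrices, and their curvature *)

Section Connection.
Context {R : realType}.
Notation E := 'rV[R]_4.
Variable (U : set E).
Hypothesis oU : open U.
Implicit Types x : E.

Definition conn (A : 'I_4 -> E -> 'M[R]_4) (X W : E -> E) (x : E) : E :=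
  \sum_i X x 0 i *: (pd i W x + W x *m A i x).

(** The matrix of the commutator of the covariant derivatives along the coordinates i and j. The
    action on row vectors reverses the products, and the sign is opposite to that of [curvature]. *)
Definition curv (A : 'I_4 -> E -> 'M[R]_4) i j x : 'M[R]_4 :=
  pd i (A j) x - pd j (A i) x + (A j x *m A i x - A i x *m A j x).

Variables (D : @connection R) (A : 'I_4 -> E -> 'M[R]_4).
Hypothesis sA : forall i, smooth_on U (A i).
Hypothesis DA : forall X W x, smooth_on U W -> U x -> D X W x = conn A X W x.

Lemma smooth_conn (X W : E -> E) : smooth_on U X -> smooth_on U W ->
  smooth_on U (conn A X W).
Proof.
move=> sX sW; apply: smooth_sum => // i; apply: smooth_scalemx => //.
  exact: smooth_coord.
by apply: smoothD => //; [exact: smooth_pd | exact: smooth_mulmx].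
Qed.

(** The terms in which the coefficients of [Y] are differentiated are kept apart: antisymmetrised in
    [X] and [Y] they give the derivative along the Lie bracket, while the other sum gives the
    curvature once the second derivatives of [Z] cancel. *)
Lemma second_covariant_derivative (X Y Z : E -> E) x :
  smooth_on U Y -> smooth_on U Z -> U x ->
  D X (D Y Z) x =
    \sum_j (\sum_i X x 0 i * pd i Y x 0 j) *: (pd j Z x + Z x *m A j x)
    + \sum_i \sum_j (X x 0 i * Y x 0 j) *:
        (pd i (pd j Z) x + pd i Z x *m A j x + Z x *m pd i (A j) x
         + (pd j Z x + Z x *m A j x) *m A i x).
Proof.
move=> sY sZ Ux.
have DYZ y : U y -> conn A Y Z y = D Y Z y by move=> Uy; rewrite DA.
have sDYZ : smooth_on U (D Y Z) by apply: (smooth_ext oU DYZ); exact: smooth_conn.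
have sV j : smooth_on U (fun y => pd j Z y + Z y *m A j y).
  by apply: smoothD => //; [exact: smooth_pd | exact: smooth_mulmx].
rewrite DA // /conn.
have E1 i : pd i (D Y Z) x = \sum_j (pd i Y x 0 j *: (pd j Z x + Z x *m A j x)
    + Y x 0 j *: (pd i (pd j Z) x + (pd i Z x *m A j x + Z x *m pd i (A j) x))).
  rewrite -(pd_ext oU i Ux DYZ) /conn (pd_sum oU) //; last first.
    by move=> j; apply: smooth_scalemx => //; exact: smooth_coord.
  apply: eq_bigr => j _; rewrite (pd_scale oU) //; congr (_ + _ *: _).
  rewrite (pdD (U := U)) //; [|exact: smooth_pd|exact: smooth_mulmx].
  by rewrite (pd_mulmx (U := U)).
rewrite -(DYZ _ Ux) /conn.
have -> : \sum_j (\sum_i X x 0 i * pd i Y x 0 j) *: (pd j Z x + Z x *m A j x)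
    = \sum_i \sum_j (X x 0 i * pd i Y x 0 j) *: (pd j Z x + Z x *m A j x).
  by rewrite exchange_big /=; apply: eq_bigr => j _; rewrite scaler_suml.
rewrite -big_split /=; apply: eq_bigr => i _.
rewrite E1 mulmx_suml -!big_split /= scaler_sumr; apply: eq_bigr => j _.
rewrite -scalemxAl -addrA -scalerDr (scalerDr (X x 0 i)) !scalerA; congr (_ + _ *: _).
by rewrite !addrA.
Qed.

Lemma curvatureE (X Y Z : E -> E) x :
  smooth_on U X -> smooth_on U Y -> smooth_on U Z -> U x ->
  curvature D X Y Z x =
  - \sum_i \sum_j (X x 0 i * Y x 0 j) *: (Z x *m curv A i j x).
Proof.
move=> sX sY sZ Ux; rewrite /curvature !second_covariant_derivative // DA //.
pose V j := pd j Z x + Z x *m A j x.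
pose T i j := pd i (pd j Z) x + pd i Z x *m A j x + Z x *m pd i (A j) x
   + (pd j Z x + Z x *m A j x) *m A i x.
have -> : conn A (lie_bracket X Y) Z x
    = \sum_j (\sum_i X x 0 i * pd i Y x 0 j) *: V j
      - \sum_j (\sum_i Y x 0 i * pd i X x 0 j) *: V j.
  rewrite /conn -sumrB; apply: eq_bigr => j _; rewrite -scalerBl.
  congr (_ *: _); rewrite /lie_bracket !derive_pd; last first.
  - exact: smooth_differentiable sY Ux.
  - exact: smooth_differentiable sX Ux.
  by rewrite !(mxE, summxE); congr (_ - _); apply: eq_bigr => i _; rewrite mxE.
have -> : \sum_i \sum_j (X x 0 i * Y x 0 j) *: (Z x *m curv A i j x)
    = \sum_i \sum_j (X x 0 i * Y x 0 j) *: T i j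
      - \sum_i \sum_j (Y x 0 i * X x 0 j) *: T i j.
  rewrite [X in _ = _ - X]exchange_big -sumrB; apply: eq_bigr => i _ /=.
  rewrite -sumrB; apply: eq_bigr => j _; rewrite [X in _ = _ - X *: _]mulrC.
  rewrite -scalerBr /T (pd_schwarz oU i j sZ Ux) /curv; congr (_ *: _).
  rewrite !mulmxDr !mulmxDl !mulmxN !mulmxA -!mulmxA.
  move: (pd j (pd i Z) x) (pd i Z x *m A j x) (Z x *m pd i (A j) x)
    (pd j Z x *m A i x) (Z x *m pd j (A i) x)
    (Z x *m (A j x *m A i x)) (Z x *m (A i x *m A j x)) => a b c d e f g.
  by apply/rowP => k; rewrite !mxE; ring.
move: (\sum_j _ *: V j) (\sum_j _ *: V j) (\sum_i \sum_j _) (\sum_i \sum_j _).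
by move=> a b c d; apply/rowP => k; rewrite !mxE; ring.
Qed.

Lemma flat_onP : flat_on U D <-> forall i j x, U x -> curv A i j x = 0.
Proof.
split=> [flat i j x Ux|F0 X Y Z sX sY sZ x Ux]; last first.
  rewrite curvatureE // big1 ?oppr0 // => i _.
  by rewrite big1 // => j _; rewrite F0 // mulmx0 scaler0.
apply/row_matrixP => k; rewrite row0 rowE.
(* Constant coordinate fields single out row [k] of the component (i, j). *)
have := flat (fun=> ebase i) (fun=> ebase j) (fun=> ebase k)
  (smooth_cst _ _) (smooth_cst _ _) (smooth_cst _ _) x Ux.
rewrite curvatureE //; try exact: smooth_cst.
move/eqP; rewrite oppr_eq0 => /eqP <-; rewrite (bigD1 i) //= [X in _ + X]big1.
  rewrite addr0 (bigD1 j) //= big1 ?addr0; last first.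
    by move=> l lj; rewrite !mxE !eqxx (negbTE lj) mulr0 scale0r.
  by rewrite !mxE !eqxx mulr1 scale1r.
move=> l li; rewrite big1 // => q _.
by rewrite !mxE (negbTE li) andbF mul0r scale0r.
Qed.

End Connection.

(** * Pointwise algebra of the curvature *)

Section FourIndices.

Definition o0 : 'I_4 := @Ordinal 4 0 isT.
Definition o1 : 'I_4 := @Ordinal 4 1 isT.
Definition o2 : 'I_4 := @Ordinal 4 2 isT.
Definition o3 : 'I_4 := @Ordinal 4 3 isT.

Lemma sum4 (V : nmodType) (F : 'I_4 -> V) :
  \sum_i F i = F o0 + F o1 + F o2 + F o3.
Proof.
rewrite !big_ord_recl big_ord0 addr0 !addrA.
by congr (_ + _ + _ + _); congr F; apply: val_inj.
Qed.

Variant ord4_spec : 'I_4 -> Type :=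
  | Ord4_0 : ord4_spec o0 | Ord4_1 : ord4_spec o1
  | Ord4_2 : ord4_spec o2 | Ord4_3 : ord4_spec o3.

Lemma ord4P i : ord4_spec i.
Proof.
case: i => [[|[|[|[|k]]]] ki] //.
- by rewrite (_ : Ordinal ki = o0); [constructor | apply: val_inj].
- by rewrite (_ : Ordinal ki = o1); [constructor | apply: val_inj].
- by rewrite (_ : Ordinal ki = o2); [constructor | apply: val_inj].
- by rewrite (_ : Ordinal ki = o3); [constructor | apply: val_inj].
Qed.

End FourIndices.

(** * Curvature tensors in an orthonormal frame adapted to the complex structure *)

Section OrthonormalFrame.
Context {R : realType}.

(* The matrices of [J], and of [B] up to a factor, in the orthonormal basis
   v, vJ, w, wJ with w proportional to vB. *)
Definition J0 : 'M[R]_4 := \matrix_(i, j)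
  (((i == o0) && (j == o1))%:R - ((i == o1) && (j == o0))%:R
   + ((i == o2) && (j == o3))%:R - ((i == o3) && (j == o2))%:R).
Definition B0 : 'M[R]_4 := \matrix_(i, j)
  (((i == o0) && (j == o2))%:R - ((i == o2) && (j == o0))%:R
   - ((i == o1) && (j == o3))%:R + ((i == o3) && (j == o1))%:R).

Lemma J0l (A : 'M[R]_4) l :
  [/\ (J0 *m A) o0 l = A o1 l, (J0 *m A) o1 l = - A o0 l,
      (J0 *m A) o2 l = A o3 l & (J0 *m A) o3 l = - A o2 l].
Proof. by split; rewrite mxE sum4 !mxE /=; ring. Qed.

Lemma J0r (A : 'M[R]_4) k :
  [/\ (A *m J0) k o0 = - A k o1, (A *m J0) k o1 = A k o0,
      (A *m J0) k o2 = - A k o3 & (A *m J0) k o3 = A k o2].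
Proof. by split; rewrite mxE sum4 !mxE /=; ring. Qed.

Lemma skew_entry (A : 'M[R]_4) : A^T = - A -> forall k l, A l k = - A k l.
Proof. by move=> sk k l; have /matrixP /(_ k l) := sk; rewrite !mxE. Qed.

(** What remains is the plane spanned by the selfdual forms e02 - e13 and e03 + e12, the orthogonal
    complement of [J0] among the selfdual forms. *)
Lemma skew_anticommute_entries (A : 'M[R]_4) :
  A^T = - A -> A *m J0 = - (J0 *m A) ->
  [/\ A o0 o1 = 0, A o2 o3 = 0, A o1 o2 = A o0 o3 & A o1 o3 = - A o0 o2].
Proof.
move=> /skew_entry sk /matrixP aJ.
have := aJ o0 o0; have := aJ o2 o2; have := aJ o0 o2; have := aJ o0 o3.
have [j1 j2 j3 j4] := J0r A o0; have [k1 k2 k3 k4] := J0r A o2.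
have E k l : (- (J0 *m A)) k l = - (J0 *m A) k l by rewrite mxE.
have [l1 _ _ _] := J0l A o0; have [m1 _ m3 _] := J0l A o2.
have [n1 _ _ _] := J0l A o3.
rewrite !E j1 j3 j4 k3 l1 m1 m3 n1.
have := sk o0 o1; have := sk o2 o3.
by move=> ? ? ? ? ? ?; split; lra.
Qed.

Section CurvatureSymmetries.
Variable r : 'I_4 -> 'I_4 -> 'I_4 -> 'I_4 -> R.
Hypothesis skl : forall a b c d, r b a c d = - r a b c d.
Hypothesis skr : forall a b c d, r a b d c = - r a b c d.
Hypothesis bianchi : forall a b c d, r a b c d + r b c a d + r c a b d = 0.

(** The classical octahedron argument: a linear combination of the four cyclic identities in which
    skewness cancels everything but the two terms compared. *)
Lemma pair_symmetry a b c d : r a b c d = r c d a b.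
Proof.
have b1 := bianchi a b c d; have b2 := bianchi b c d a.
have b3 := bianchi c d a b; have b4 := bianchi d a b c.
have := skl a c b d; have := skl b d c a; have := skl c a d b.
have := skr a b c d; have := skr b c a d; have := skr c d a b.
have := skr d a b c; have := skr c a b d; have := skr b d c a.
have := skl d b a c.
move=> *; lra.
Qed.

Variables u : 'I_4 -> 'I_4 -> R.
Hypothesis r01 : forall a b, r a b o0 o1 = u a b.
Hypothesis r23 : forall a b, r a b o2 o3 = u a b.
Hypothesis r13 : forall a b, r a b o1 o3 = - r a b o0 o2.
Hypothesis r12 : forall a b, r a b o1 o2 = r a b o0 o3.

(* A 2-form y(a, b) = r(a, b, c, d) is selfdual, so it vanishes as soon as
   it is decomposable: a decomposable form squares to zero under the wedge
   product, a selfdual one to its squared norm. *)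
Lemma selfdual_decomposable c d (s t : 'I_4 -> R) :
  (forall a b, r a b c d = s a * t b - s b * t a) -> forall a b, r a b c d = 0.
Proof.
move=> dec.
have e1 : r o2 o3 c d = r o0 o1 c d by rewrite pair_symmetry r23 -r01 pair_symmetry.
have e2 : r o1 o3 c d = - r o0 o2 c d.
  by rewrite pair_symmetry r13 pair_symmetry.
have e3 : r o1 o2 c d = r o0 o3 c d by rewrite pair_symmetry r12 pair_symmetry.
have pl : r o0 o1 c d * r o2 o3 c d - r o0 o2 c d * r o1 o3 c d
   + r o0 o3 c d * r o1 o2 c d = 0 by rewrite !dec; ring.
move: pl; rewrite e1 e2 e3 mulrN opprK => pl.
have [z1 z2 z3] : [/\ r o0 o1 c d = 0, r o0 o2 c d = 0 & r o0 o3 c d = 0].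
  by split; nra.
have diag a : r a a c d = 0 by rewrite dec subrr.
move=> a b; case: (ord4P a); case: (ord4P b); rewrite ?diag //.
all: rewrite ?e1 ?e2 ?e3 ?z1 ?z2 ?z3 ?oppr0 //.
all: by rewrite skl ?e1 ?e2 ?e3 ?z1 ?z2 ?z3 !oppr0.
Qed.

(** By pair symmetry the hypotheses kill everything except the coefficient of [B0] tensor [B0], that
    is [r o0 o2 o0 o2] and its mirror images. *)
Lemma curvature_eq0 : (forall a b, u a b = 0) ->
  (forall a b, r a b o0 o3 = 0) -> forall a b c d, r a b c d = 0.
Proof.
move=> u0 y0.
have x0 a b : r a b o0 o2 = 0.
  (* In the cyclic identity for 0, 1, 2 with last index 3, the first term is a value of [u], the
     second one of the components assumed zero, and the third is this coefficient. *)
  have main : r o0 o2 o0 o2 = 0.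
    have := bianchi o0 o1 o2 o3; have := r23 o0 o1; have := u0 o0 o1.
    by have := y0 o1 o2; have := skl o0 o2 o1 o3; have := r13 o0 o2; lra.
  have diag e : r e e o0 o2 = 0 by have := skl e e o0 o2; lra.
  case: (ord4P a); case: (ord4P b); rewrite ?diag //.
  all: try by rewrite pair_symmetry ?r01 ?r23 ?r12 ?y0 ?u0.
  all: try by rewrite skl pair_symmetry ?r01 ?r23 ?r12 ?y0 ?u0 oppr0.
  all: try by rewrite pair_symmetry r13 main oppr0.
  all: try by rewrite skl ?main ?oppr0.
  by rewrite skl pair_symmetry r13 main !oppr0.
move=> a b c d.
have diag e : r a b e e = 0 by have := skr a b e e; lra.
case: (ord4P c); case: (ord4P d); rewrite ?diag //.
all: try by rewrite ?r01 ?r23 ?r12 ?r13 ?y0 ?u0 ?x0 ?oppr0.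
all: by rewrite skr ?r01 ?r23 ?r12 ?r13 ?y0 ?u0 ?x0 ?oppr0.
Qed.

End CurvatureSymmetries.

Section FlatFrame.
Variables (h : 'I_4 -> 'M[R]_4) (r : 'I_4 -> 'I_4 -> 'M[R]_4).
Hypothesis hskew : forall a, (h a)^T = - h a.
Hypothesis hJ : forall a, h a *m J0 = - (J0 *m h a).
Hypothesis rskl : forall a b, r b a = - r a b.
Hypothesis rskr : forall a b, (r a b)^T = - r a b.
Hypothesis rbianchi : forall a b c d, r a b c d + r b c a d + r c a b d = 0.
Hypothesis rJ : forall a b, r a b - J0 *m r a b *m J0
  = 2 *: (h b *m h a - h a *m h b).

Let u a b := 2 * (h a o0 o2 * h b o0 o3 - h b o0 o2 * h a o0 o3).

(** Commutators of elements of the plane anticommuting with [J0] are multiples of [J0]; the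
    coefficient [u] is a 2 by 2 minor, hence decomposable as a form in [a] and [b]. *)
Lemma frame_commutator a b :
  let C := h b *m h a - h a *m h b in
  [/\ C o0 o1 = u a b, C o2 o3 = u a b, C o0 o2 = 0 & C o0 o3 = 0].
Proof.
have [a1 a2 a3 a4] := skew_anticommute_entries (hskew a) (hJ a).
have [b1 b2 b3 b4] := skew_anticommute_entries (hskew b) (hJ b).
have sa := skew_entry (hskew a); have sb := skew_entry (hskew b).
have da k : h a k k = 0 by have := sa k k; lra.
have db k : h b k k = 0 by have := sb k k; lra.
have E k l : (h b *m h a - h a *m h b) k l = (h b *m h a) k l - (h a *m h b) k l.
  by rewrite !mxE.
rewrite /u /=; split; rewrite E !mxE !sum4 !da !db.
- rewrite (sa o1 o2) (sa o1 o3) (sb o1 o2) (sb o1 o3) a1 a3 a4 b1 b3 b4; ring.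
- rewrite (sa o0 o2) (sa o1 o2) (sb o0 o2) (sb o1 o2) a2 a3 a4 b2 b3 b4; ring.
- rewrite (sa o2 o3) (sb o2 o3) a1 a2 a3 b1 b2 b3; ring.
- rewrite a1 a2 a4 b1 b2 b4; ring.
Qed.

(** As [J0] squares to -1, the left side of [rJ] is twice the part of [r a b] commuting with [J0],
    so that part is the commutator, a multiple of [J0]. The other part is skew and anticommutes with
    [J0]. Both are selfdual. *)
Lemma frame_components a b :
  [/\ r a b o0 o1 = u a b, r a b o2 o3 = u a b,
      r a b o1 o3 = - r a b o0 o2 & r a b o1 o2 = r a b o0 o3].
Proof.
have [c1 c2 c3 c4] := frame_commutator a b.
have s := skew_entry (rskr a b).
have E k l : r a b k l - (J0 *m r a b *m J0) k l
    = 2 * (h b *m h a - h a *m h b) k l.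
  by have /matrixP /(_ k l) := rJ a b; rewrite !mxE.
have := E o0 o1; have := E o2 o3; have := E o0 o2; have := E o0 o3.
rewrite c1 c2 c3 c4.
have [_ p1 p2 p3] := J0r (J0 *m r a b) o0; have [_ _ _ q3] := J0r (J0 *m r a b) o2.
rewrite p1 p2 p3 q3.
have [-> _ _ _] := J0l (r a b) o0; have [-> _ _ _] := J0l (r a b) o3.
have [-> _ _ _] := J0l (r a b) o2; have [_ _ -> _] := J0l (r a b) o2.
have := s o0 o1; have := s o2 o3.
by move=> ? ? ? ? ? ?; split; lra.
Qed.

Let rr a b c d := r a b c d.
Let rrskl a b c d : rr b a c d = - rr a b c d.
Proof. by rewrite /rr rskl mxE. Qed.
Let rrskr a b c d : rr a b d c = - rr a b c d.
Proof. exact: skew_entry. Qed.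
Let rr01 a b : rr a b o0 o1 = u a b.
Proof. by have [] := frame_components a b. Qed.
Let rr23 a b : rr a b o2 o3 = u a b.
Proof. by have [] := frame_components a b. Qed.
Let rr13 a b : rr a b o1 o3 = - rr a b o0 o2.
Proof. by have [] := frame_components a b. Qed.
Let rr12 a b : rr a b o1 o2 = rr a b o0 o3.
Proof. by have [] := frame_components a b. Qed.

Lemma frame_u0 a b : u a b = 0.
Proof.
rewrite -rr01.
apply: (selfdual_decomposable rrskl rrskr rbianchi rr01 rr23 rr13 rr12
  (s := fun a => 2 * h a o0 o2) (t := fun a => h a o0 o3)) => e f.
by rewrite rr01 /u; ring.
Qed.

(** A skew matrix commuting with [J0] is determined by the four entries listed in
    [frame_commutator], and these are now all zero. *)
Lemma frame_commute a b : h a *m h b = h b *m h a.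
Proof.
apply/eqP; rewrite eq_sym -subr_eq0; apply/eqP.
have [c1 c2 c3 c4] := frame_commutator a b.
rewrite frame_u0 in c1 c2.
set C := _ - _ in c1 c2 c3 c4 *.
have sC : C^T = - C.
  by rewrite /C linearB /= !trmx_mul !hskew !mulNmx !mulmxN !opprK opprB.
have cJ : C *m J0 = J0 *m C.
  rewrite /C mulmxBl mulmxBr -!mulmxA !hJ !mulmxN !mulmxA !hJ !mulNmx !opprK.
  by [].
have s := skew_entry sC.
have d k : C k k = 0 by have := s k k; lra.
have c13 : C o1 o3 = 0.
  have /matrixP /(_ o0 o3) := cJ; have [_ _ _ ->] := J0r C o0.
  by have [-> _ _ _] := J0l C o3; rewrite c3.
have c12 : C o1 o2 = 0.
  have /matrixP /(_ o0 o2) := cJ; have [_ _ -> _] := J0r C o0.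
  by have [-> _ _ _] := J0l C o2; rewrite c4 oppr0.
apply/matrixP => k l; rewrite [RHS]mxE.
case: (ord4P k); case: (ord4P l); rewrite ?d ?c1 ?c2 ?c3 ?c4 ?c12 ?c13 //.
all: by rewrite s ?c1 ?c2 ?c3 ?c4 ?c12 ?c13 oppr0.
Qed.

(** Here [b *: B0] stands for a nonzero component of the torsion and [l] for its covariant
    derivative. *)
Lemma frame_flat (b : R) (l : 'I_4 -> 'M[R]_4) : b != 0 ->
  (forall a, h a *m B0 = B0 *m h a) ->
  (forall a c, \tr (r a c *m J0 *m (b *: B0))
     = \tr (h c *m J0 *m l a) - \tr (h a *m J0 *m l c)) ->
  forall a c, r a c = 0.
Proof.
move=> b0 hB trr a c; apply/matrixP => k m; rewrite [RHS]mxE.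
(* The other generator of the plane is a multiple of [J0 *m B0], which anticommutes with [B0];
   commuting with [B0] therefore removes it. *)
have beta0 e : h e o0 o3 = 0.
  have [e1 e2 e3 e4] := skew_anticommute_entries (hskew e) (hJ e).
  have /matrixP /(_ o0 o1) := hB e; rewrite !mxE !sum4 !mxE /=.
  have := skew_entry (hskew e) o1 o2; rewrite e3 => ->.
  by lra.
have hE e : h e = h e o0 o2 *: B0.
  have [e1 e2 e3 e4] := skew_anticommute_entries (hskew e) (hJ e).
  have s := skew_entry (hskew e).
  have d q : h e q q = 0 by have := s q q; lra.
  have b3 := beta0 e; rewrite b3 in e3.
  apply/matrixP => p q; rewrite !mxE.
  case: (ord4P p); case: (ord4P q) => /=; rewrite ?d ?e1 ?e2 ?e3 ?e4 ?b3;
    by [ring | rewrite s ?e1 ?e2 ?e3 ?e4 ?b3; ring].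
pose q e := \tr (B0 *m J0 *m l e).
have y0 e f : rr e f o0 o3 = 0.
  (* The trace of [r J0 B0] is 4 times the (0, 3) entry of [r], and [b] comes from [b *: B0]; this
     explains the factor [(4 * b)^-1]. *)
  apply: (selfdual_decomposable rrskl rrskr rbianchi rr01 rr23 rr13 rr12
   (s := q) (t := fun f => (4 * b)^-1 * h f o0 o2)) => e' f'.
  have tE := trr e' f'.
  rewrite (hE f') (hE e') -!scalemxAl !mxtraceZ -/(q e') -/(q f') in tE.
  rewrite -scalemxAr mxtraceZ in tE.
  have trE : \tr (r e' f' *m J0 *m B0) = 4 * rr e' f' o0 o3.
    have s := skew_entry (rskr e' f').
    have [_ _ _ s12] := frame_components e' f'.
    rewrite /mxtrace sum4 !mxE !sum4 !mxE !sum4 !mxE /= /rr.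
    have := s o0 o3; have := s o1 o2; lra.
  rewrite trE in tE; have b4 : 4 * b != 0 by rewrite mulf_neq0 // pnatr_eq0.
  apply: (mulfI b4); apply: (@etrans _ _ (b * (4 * rr e' f' o0 o3))).
    by ring.
  by rewrite tE; field.
apply: (curvature_eq0 rrskl rrskr rbianchi rr01 rr23 rr13 rr12) => // e f.
exact: frame_u0.
Qed.

End FlatFrame.
End OrthonormalFrame.

(** * Orthonormal bases adapted to two anticommuting skew endomorphisms *)

Section AdaptedBasis.
Context {R : realType}.
Variable G : 'M[R]_4.
Hypothesis Gsym : G^T = G.
Hypothesis Gpos : forall v, v != 0 -> 0 < bil G v v.
Implicit Types (u v w : 'rV[R]_4) (A : 'M[R]_4).

Lemma bilC u v : bil G u v = bil G v u.
Proof.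
rewrite /bil -[in RHS]Gsym.
have -> : v *m G^T *m u^T = (u *m G *m v^T)^T by rewrite !trmx_mul trmxK mulmxA.
by rewrite [RHS]mxE.
Qed.

Lemma bilZl c u v : bil G (c *: u) v = c * bil G u v.
Proof. by rewrite /bil -!scalemxAl mxE. Qed.

Lemma bilZr c u v : bil G u (c *: v) = c * bil G u v.
Proof. by rewrite bilC bilZl bilC. Qed.

Lemma bilNl u v : bil G (- u) v = - bil G u v.
Proof. by rewrite -scaleN1r bilZl mulN1r. Qed.

Lemma bilNr u v : bil G u (- v) = - bil G u v.
Proof. by rewrite bilC bilNl bilC. Qed.

Lemma bil_skew A u v : A *m G = - (G *m A^T) ->
  bil G (u *m A) v = - bil G u (v *m A).
Proof.
by move=> AG; rewrite /bil -(mulmxA u A G) AG trmx_mul mulmxN mulNmx !mulmxA mxE.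
Qed.

Lemma bil_skew0 A v : A *m G = - (G *m A^T) -> bil G (v *m A) v = 0.
Proof. by move=> AG; have := bil_skew v v AG; rewrite [bil G v _]bilC; lra. Qed.

Lemma bil_entry (P : 'M[R]_4) i j :
  (P *m G *m P^T) i j = bil G (row i P) (row j P).
Proof.
by rewrite /bil tr_row -!row_mul !mxE; apply: eq_bigr => k _; rewrite !mxE.
Qed.

Lemma posdef_unitmx : G \in unitmx.
Proof.
rewrite -row_free_unit -kermx_eq0; apply/eqP/row_matrixP => i; rewrite row0.
apply/eqP; apply: contraT => /Gpos.
by rewrite /bil -row_mul mulmx_ker row0 mul0mx mxE ltxx.
Qed.

Variables J B : 'M[R]_4.
Hypothesis JJ : J *m J = - 1%:M.
Hypothesis JG : J *m G = - (G *m J^T).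
Hypothesis BG : B *m G = - (G *m B^T).
Hypothesis BJ : B *m J = - (J *m B).
Hypothesis Bn0 : B != 0.

Lemma vJJ v : v *m J *m J = - v.
Proof. by rewrite -mulmxA JJ mulmxN mulmx1. Qed.

Lemma vBJ v : v *m B *m J = - (v *m J *m B).
Proof. by rewrite -!mulmxA BJ mulmxN. Qed.

Lemma bil_J_B v : bil G (v *m J) (v *m B) = 0.
Proof.
have e1 := bil_skew v (v *m B) JG.
have e2 := bil_skew v (v *m J) BG.
rewrite vBJ bilNr opprK in e1; rewrite bilC in e2; lra.
Qed.

Definition frame4 (a b c d : 'rV[R]_4) : 'M[R]_4 :=
  \matrix_(i < 4) (if i == o0 then a else if i == o1 then b
                   else if i == o2 then c else d).

Lemma row_frame4 a b c d : [/\ row o0 (frame4 a b c d) = a,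
  row o1 (frame4 a b c d) = b, row o2 (frame4 a b c d) = c &
  row o3 (frame4 a b c d) = d].
Proof. by split; rewrite rowK. Qed.

Lemma mul_row_sum A (P : 'M[R]_4) i : row i (A *m P) = \sum_j A i j *: row j P.
Proof. by rewrite row_mul mulmx_sum_row; apply: eq_bigr => j _; rewrite mxE. Qed.

Lemma adapted_basis : exists (P : 'M[R]_4) (b : R),
  [/\ P *m G *m P^T = 1%:M, P *m J = J0 *m P, P *m B = b *: (B0 *m P) & b != 0].
Proof.
have [k Bk] : exists k, row k B != 0.
  apply/existsP; apply: contraT; rewrite negb_exists => /forallP B0'.
  move/negP: Bn0; case; apply/eqP/row_matrixP => k; rewrite row0.
  by have := B0' k; rewrite negbK => /eqP.
pose v0 : 'rV[R]_4 := delta_mx 0 k.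
have v0B : v0 *m B != 0 by rewrite -rowE.
have v0n : v0 != 0 by apply: contraNneq v0B => ->; rewrite mul0mx.
pose n := Num.sqrt (bil G v0 v0).
have n0 : 0 < n by rewrite sqrtr_gt0 Gpos.
have nn : n * n = bil G v0 v0 by rewrite -expr2 sqr_sqrtr // ltW // Gpos.
pose v := n^-1 *: v0.
have vv : bil G v v = 1.
  by rewrite bilZl bilZr -nn mulrA -invfM mulVf // mulf_neq0 ?gt_eqF.
have vB : v *m B != 0.
  by rewrite -scalemxAl scaler_eq0 negb_or v0B invr_neq0 // gt_eqF.
pose b := Num.sqrt (bil G (v *m B) (v *m B)).
have b0 : 0 < b by rewrite sqrtr_gt0 Gpos.
have bb : b * b = bil G (v *m B) (v *m B).
  by rewrite -expr2 sqr_sqrtr // ltW // Gpos.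
have bn0 : b != 0 by rewrite gt_eqF.
pose w := b^-1 *: (v *m B).
have ww : bil G w w = 1.
  by rewrite bilZl bilZr -bb mulrA -invfM mulVf // mulf_neq0.
have JJd x y : bil G (x *m J) (y *m J) = bil G x y.
  by rewrite bil_skew // vJJ bilNr opprK.
have xJx x : bil G (x *m J) x = 0 by exact: bil_skew0.
have vw : bil G v w = 0 by rewrite bilZr bilC bil_skew0 // mulr0.
have vJw : bil G (v *m J) w = 0 by rewrite bilZr bil_J_B mulr0.
have wvJ : bil G w (v *m J) = 0 by rewrite bilC.
have vwJ : bil G v (w *m J) = 0.
  by apply/eqP; rewrite -oppr_eq0 -bil_skew // vJw.
pose P := frame4 v (v *m J) w (w *m J).
have [r0 r1 r2 r3] := row_frame4 v (v *m J) w (w *m J).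
have PP : P *m G *m P^T = 1%:M.
  apply/matrixP => i j; rewrite bil_entry [RHS]mxE.
  case: (ord4P i); case: (ord4P j); rewrite /P ?r0 ?r1 ?r2 ?r3 /=
    ?JJd ?vv ?ww ?vw ?xJx ?vJw ?vwJ ?wvJ //;
    by rewrite bilC ?JJd ?vv ?ww ?vw ?xJx ?vJw ?vwJ ?wvJ.
have GPP : G *m P^T *m P = 1%:M by apply: mulmx1C; rewrite mulmxA.
(* Expanding [w *m B] in the basis, skewness of [B] leaves only the coefficient along [v]. *)
have wB : w *m B = - (b *: v).
  have rowE' z : z = \sum_j bil G z (row j P) *: row j P.
    rewrite -[LHS]mulmx1 -GPP mulmxA mulmx_sum_row; apply: eq_bigr => j _.
    congr (_ *: _); rewrite /bil mulmxA [LHS]mxE [RHS]mxE.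
    by apply: eq_bigr => l _; congr (_ * _); rewrite !mxE.
  have vBw : v *m B = b *: w by rewrite scalerA divff // scale1r.
  rewrite [LHS]rowE' sum4 /P r0 r1 r2 r3.
  have -> : bil G (w *m B) v = - b.
    by rewrite bil_skew // vBw bilZr ww mulr1.
  have -> : bil G (w *m B) (v *m J) = 0.
    rewrite bil_skew // -[_ *m B]opprK -vBJ vBw -scalemxAl bilNr bilZr.
    by rewrite [bil G w _]bilC xJx mulr0 !oppr0.
  have -> : bil G (w *m B) w = 0 by exact: bil_skew0.
  have -> : bil G (w *m B) (w *m J) = 0 by rewrite bilC bil_J_B.
  by rewrite !scale0r !addr0 scaleNr.
have vBw : v *m B = b *: w by rewrite scalerA divff // scale1r.
exists P, b; split=> //.
  apply/row_matrixP => i; rewrite row_mul mul_row_sum sum4 /P r0 r1 r2 r3.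
  case: (ord4P i); rewrite ?r0 ?r1 ?r2 ?r3 !mxE /= ?vJJ;
    by rewrite ?(subr0, sub0r, addr0, add0r, oppr0, scale0r, scale1r, scaleN1r).
apply/row_matrixP => i; rewrite row_mul linearZ /= mul_row_sum sum4 /P r0 r1 r2 r3.
have vJB : v *m J *m B = - (b *: (w *m J)).
  by rewrite -[LHS]opprK -vBJ vBw -scalemxAl.
have wJB : w *m J *m B = b *: (v *m J).
  by rewrite -[LHS]opprK -vBJ wB mulNmx opprK -scalemxAl.
case: (ord4P i); rewrite ?r0 ?r1 ?r2 ?r3 !mxE /= ?vBw ?wB ?vJB ?wJB;
  by rewrite ?(subr0, sub0r, addr0, add0r, oppr0, scale0r, scale1r, scaleN1r,
    scalerN).
Qed.

End AdaptedBasis.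

(** * Contraction of an index with a vector *)

Section Combination.
Context {R : realType}.
Implicit Types (u v : 'rV[R]_4).

Definition lc (V : lmodType R) u (F : 'I_4 -> V) : V := \sum_i u 0 i *: F i.

Lemma lcD (V : lmodType R) u (F F' : 'I_4 -> V) :
  lc u F + lc u F' = lc u (fun i => F i + F' i).
Proof. by rewrite -big_split; apply: eq_bigr => i _; rewrite scalerDr. Qed.

Lemma lcN (V : lmodType R) u (F : 'I_4 -> V) : - lc u F = lc u (fun i => - F i).
Proof. by rewrite -sumrN; apply: eq_bigr => i _; rewrite scalerN. Qed.

Lemma lcZ (V : lmodType R) u c (F : 'I_4 -> V) :
  c *: lc u F = lc u (fun i => c *: F i).
Proof.
by rewrite scaler_sumr; apply: eq_bigr => i _; rewrite !scalerA mulrC.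
Qed.

Lemma lc_mulmxl m n u (A : 'M[R]_(m, n)) p (F : 'I_4 -> 'M[R]_(n, p)) :
  A *m lc u F = lc u (fun i => A *m F i).
Proof. by rewrite mulmx_sumr; apply: eq_bigr => i _; rewrite scalemxAr. Qed.

Lemma lc_mulmxr m n u p (F : 'I_4 -> 'M[R]_(m, n)) (A : 'M[R]_(n, p)) :
  lc u F *m A = lc u (fun i => F i *m A).
Proof. by rewrite mulmx_suml; apply: eq_bigr => i _; rewrite scalemxAl. Qed.

Lemma lc_trmx m n u (F : 'I_4 -> 'M[R]_(m, n)) :
  (lc u F)^T = lc u (fun i => (F i)^T).
Proof. by rewrite linear_sum; apply: eq_bigr => i _; rewrite linearZ. Qed.

Lemma lc_mxtrace n u (F : 'I_4 -> 'M[R]_n) :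
  \tr (lc u F) = lc u (fun i => \tr (F i) : R^o).
Proof. by rewrite linear_sum; apply: eq_bigr => i _; rewrite linearZ. Qed.

Lemma eq_lc (V : lmodType R) u (F F' : 'I_4 -> V) :
  (forall i, F i = F' i) -> lc u F = lc u F'.
Proof. by move=> FF'; apply: eq_bigr => i _; rewrite FF'. Qed.

Lemma lc0 (V : lmodType R) u (F : 'I_4 -> V) : (forall i, F i = 0) -> lc u F = 0.
Proof. by move=> F0; rewrite /lc big1 // => i _; rewrite F0 scaler0. Qed.

Lemma lcC (V : lmodType R) u v (F : 'I_4 -> 'I_4 -> V) :
  lc u (fun i => lc v (F i)) = lc v (fun j => lc u (F^~ j)).
Proof.
rewrite /lc; under eq_bigr => i _ do rewrite scaler_sumr.
rewrite exchange_big /=; apply: eq_bigr => j _; rewrite scaler_sumr.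
by apply: eq_bigr => i _; rewrite !scalerA mulrC.
Qed.

Lemma lc_ebase (V : lmodType R) i (F : 'I_4 -> V) : lc (ebase i) F = F i.
Proof.
rewrite /lc (bigD1 i) //= big1 ?addr0 => [|j ji]; rewrite mxE ?eqxx ?scale1r //.
by rewrite (negbTE ji) andbF scale0r.
Qed.

Lemma lc_basis (V : lmodType R) (P Q : 'M[R]_4) (F : 'I_4 -> V) :
  Q *m P = 1%:M -> (forall a, lc (row a P) F = 0) -> forall i, F i = 0.
Proof.
move=> QP F0 i.
have : \sum_a Q i a *: lc (row a P) F = 0.
  by rewrite big1 // => a _; rewrite F0 scaler0.
rewrite /lc; under eq_bigr => a _ do rewrite scaler_sumr.
rewrite exchange_big /= => <-; rewrite -[LHS](lc_ebase i F) /lc.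
apply: eq_bigr => j _; rewrite -[in LHS](_ : row i (Q *m P) = ebase i); last first.
  by rewrite QP row1.
by rewrite !mxE scaler_suml; apply: eq_bigr => a _; rewrite scalerA mxE.
Qed.

End Combination.

(** * Transfer of the frame computation to an arbitrary basis at a point *)

Section PointwiseFlatness.
Context {R : realType}.
Variables (G J : 'M[R]_4) (H : 'I_4 -> 'M[R]_4) (Rm : 'I_4 -> 'I_4 -> 'M[R]_4).
Variable q : 'I_4.
Hypothesis Gsym : G^T = G.
Hypothesis Gpos : forall v, v != 0 -> 0 < bil G v v.
Hypothesis JJ : J *m J = - 1%:M.
Hypothesis JG : J *m G = - (G *m J^T).
Hypothesis HG : forall i, H i *m G = - (G *m (H i)^T).
Hypothesis HJ : forall i, H i *m J = - (J *m H i).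
Hypothesis Hq : H q != 0.
Hypothesis Rskl : forall i j, Rm j i = - Rm i j.
Hypothesis RG : forall i j, Rm i j *m G = - (G *m (Rm i j)^T).
Hypothesis Rbianchi : forall i j k,
  row k (Rm i j) + row i (Rm j k) + row j (Rm k i) = 0.
Hypothesis RJ : forall i j,
  Rm i j - J *m Rm i j *m J = 2 *: (H j *m H i - H i *m H j).
Implicit Types u v w : 'rV[R]_4.

Let lc2 u v (F : 'I_4 -> 'I_4 -> 'M[R]_4) := lc u (fun i => lc v (F i)).

Lemma lc_skew u (F : 'I_4 -> 'M[R]_4) :
  (forall i, F i *m G = - (G *m (F i)^T)) ->
  lc u F *m G = - (G *m (lc u F)^T).
Proof.
move=> FG; rewrite lc_mulmxr lc_trmx lc_mulmxl lcN.
exact: eq_lc.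
Qed.

Lemma row_lc n u (A : 'M[R]_(4, n)) : u *m A = lc u (fun k => row k A).
Proof. by rewrite mulmx_sum_row. Qed.

Lemma lc2_bianchi u v w :
  w *m lc2 u v Rm + u *m lc2 v w Rm + v *m lc2 w u Rm = 0.
Proof.
pose T i j k := row k (Rm i j).
have T3 x y z : z *m lc2 x y Rm
    = lc x (fun i => lc y (fun j => lc z (fun k => T i j k))).
  rewrite lc_mulmxl; apply: eq_lc => i; rewrite lc_mulmxl; apply: eq_lc => j.
  exact: row_lc.
rewrite !T3.
have -> : lc v (fun i => lc w (fun j => lc u (fun k => T i j k)))
    = lc u (fun i => lc v (fun j => lc w (fun k => T j k i))).
  rewrite [RHS]lcC; apply: eq_lc => j.
  by rewrite [LHS]lcC.
have -> : lc w (fun i => lc u (fun j => lc v (fun k => T i j k)))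
    = lc u (fun i => lc v (fun j => lc w (fun k => T k i j))).
  rewrite lcC; apply: eq_lc => j.
  by rewrite [LHS]lcC.
rewrite lcD lcD; apply: lc0 => i; rewrite lcD lcD; apply: lc0 => j.
by rewrite lcD lcD; apply: lc0 => k; exact: Rbianchi.
Qed.

Lemma lc2_mul u v (F F' : 'I_4 -> 'M[R]_4) :
  lc u F *m lc v F' = lc2 u v (fun i j => F i *m F' j).
Proof. by rewrite lc_mulmxr; apply: eq_lc => i; rewrite lc_mulmxl. Qed.

Lemma lc2_RJ u v : lc2 u v Rm - J *m lc2 u v Rm *m J
  = 2 *: (lc v H *m lc u H - lc u H *m lc v H).
Proof.
rewrite !lc2_mul /lc2 [X in X - _]lcC.
rewrite lc_mulmxl lc_mulmxr [X in _ - X](_ : _ =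
    lc u (fun i => lc v (fun j => J *m Rm i j *m J))); last first.
  by apply: eq_lc => i; rewrite lc_mulmxl lc_mulmxr.
rewrite [X in _ = 2 *: (X - _)]lcC -lcC.
rewrite !lcN !lcD lcZ; apply: eq_lc => i; rewrite !lcN !lcD lcZ.
by apply: eq_lc => j; exact: RJ.
Qed.

Lemma lc2_eq0 (P Q : 'M[R]_4) (F : 'I_4 -> 'I_4 -> 'M[R]_4) : Q *m P = 1%:M ->
  (forall a b, lc2 (row a P) (row b P) F = 0) -> forall i j, F i j = 0.
Proof.
move=> QP F0 i j; apply: (lc_basis QP (F := F i)) => b.
apply: (lc_basis QP (F := fun i => lc (row b P) (F i))) => a.
exact: F0.
Qed.

Section Frame.
Variables (P Q : 'M[R]_4) (b : R).
Hypothesis QE : Q = G *m P^T.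
Hypothesis PP : P *m G *m P^T = 1%:M.
Hypothesis PJ : P *m J = J0 *m P.
Hypothesis PB : P *m H q = b *: (B0 *m P).
Hypothesis b0 : b != 0.

Let PQ : P *m Q = 1%:M. Proof. by rewrite QE mulmxA. Qed.
Let QP : Q *m P = 1%:M. Proof. exact: mulmx1C. Qed.
Let cj (X : 'M[R]_4) := P *m X *m Q.

Let cjM X Y : cj X *m cj Y = cj (X *m Y).
Proof. by rewrite /cj -!mulmxA (mulmxA Q) QP mul1mx. Qed.
Let cjJ : cj J = J0.
Proof. by rewrite /cj PJ -mulmxA PQ mulmx1. Qed.
Let cjB : cj (H q) = b *: B0.
Proof. by rewrite /cj PB -scalemxAl -mulmxA PQ mulmx1. Qed.
Let cjN X : cj (- X) = - cj X.
Proof. by rewrite /cj mulmxN mulNmx. Qed.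
Let cjDr X Y : cj (X + Y) = cj X + cj Y.
Proof. by rewrite /cj mulmxDr mulmxDl. Qed.
Let cjZ c X : cj (c *: X) = c *: cj X.
Proof. by rewrite /cj -scalemxAr -scalemxAl. Qed.
Let cj_eq0 X : cj X = 0 -> X = 0.
Proof.
move=> cX; have : Q *m cj X *m P = 0 by rewrite cX mulmx0 mul0mx.
by rewrite /cj !mulmxA QP mul1mx -mulmxA QP mulmx1.
Qed.
Let cj_tr X : \tr (cj X) = \tr X.
Proof. by rewrite /cj mxtrace_mulC mulmxA QP mul1mx. Qed.
Let cj_skew X : X *m G = - (G *m X^T) -> (cj X)^T = - cj X.
Proof.
move=> XG; rewrite /cj QE !trmx_mul trmxK Gsym !mulmxA.
by rewrite -(mulmxA P X G) XG mulmxN mulNmx opprK !mulmxA.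
Qed.

(** The form indices move to the frame by contraction with rows of [P], the endomorphism indices by
    conjugation. Both have to move together, because the Bianchi identity and pair symmetry mix the
    two kinds. *)
Let h a := cj (lc (row a P) H).
Let r a c := cj (lc2 (row a P) (row c P) Rm).

Let hskew a : (h a)^T = - h a.
Proof. by apply: cj_skew; exact: lc_skew. Qed.

Let hJ a : h a *m J0 = - (J0 *m h a).
Proof.
rewrite -cjJ !cjM -cjN; congr cj.
by rewrite lc_mulmxl lc_mulmxr lcN; exact: eq_lc.
Qed.

Let rskl a c : r c a = - r a c.
Proof.
rewrite -cjN; congr cj; rewrite /lc2 [LHS]lcC lcN; apply: eq_lc => i.
by rewrite lcN; apply: eq_lc => j.
Qed.

Let rskr a c : (r a c)^T = - r a c.
Proof. by apply: cj_skew; apply: lc_skew => i; exact: lc_skew. Qed.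

Let rbianchi a c d e : r a c d e + r c d a e + r d a c e = 0.
Proof.
have rE a' c' d' e' : r a' c' d' e'
    = (row d' P *m lc2 (row a' P) (row c' P) Rm *m Q) 0 e'.
  by rewrite -!row_mul [RHS]mxE.
have := congr1 (fun z => (z *m Q) 0 e) (lc2_bianchi (row a P) (row c P) (row d P)).
by rewrite /= !mulmxDl mul0mx !rE [RHS]mxE => <-; rewrite !mxE.
Qed.

Let rJ a c : r a c - J0 *m r a c *m J0 = 2 *: (h c *m h a - h a *m h c).
Proof.
by rewrite -cjJ !cjM -!cjN -!cjDr -cjZ lc2_RJ.
Qed.

Lemma framed_commute i j : H i *m H j = H j *m H i.
Proof.
apply/eqP; rewrite -subr_eq0; apply/eqP.
apply: (lc2_eq0 QP (F := fun i j => H i *m H j - H j *m H i)) => a c.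
apply: cj_eq0.
have := frame_commute hskew hJ rskl rskr rbianchi rJ a c.
rewrite /h !cjM => /eqP; rewrite -subr_eq0 -cjN -cjDr => /eqP <-; congr cj.
rewrite !lc2_mul /lc2 [X in _ = _ - X]lcC lcN lcD; apply: eq_lc => k.
by rewrite lcN lcD.
Qed.

Lemma framed_flat (L : 'I_4 -> 'M[R]_4) :
  (forall i j, \tr (Rm i j *m J *m H q)
     = \tr (H j *m J *m L i) - \tr (H i *m J *m L j)) ->
  forall i j, Rm i j = 0.
Proof.
move=> trR; apply: (lc2_eq0 QP) => a c; apply: cj_eq0.
pose l a := cj (lc (row a P) L).
have hB e : h e *m B0 = B0 *m h e.
  apply: (scalerI b0); rewrite scalemxAr scalemxAl -cjB !cjM; congr cj.
  rewrite lc_mulmxl lc_mulmxr; apply: eq_lc => i; exact: framed_commute.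
apply: (frame_flat hskew hJ rskl rskr rbianchi rJ (l := l) b0 hB) => e f.
rewrite -cjB -cjJ /h /l !cjM !cj_tr /lc2.
have tr2 u v : \tr (lc u H *m J *m lc v L)
    = lc u (fun i => lc v (fun j => \tr (H i *m J *m L j) : R^o)).
  rewrite !lc_mulmxr lc_mxtrace; apply: eq_lc => i.
  by rewrite lc_mulmxl lc_mxtrace.
rewrite !tr2 [X in _ = X - _]lcC lcN lcD !lc_mulmxr lc_mxtrace.
apply: eq_lc => i; rewrite !lc_mulmxr lc_mxtrace lcN lcD.
by apply: eq_lc => j; exact: trR.
Qed.

End Frame.

(** Kept separate from the vanishing of the curvature: the trace identity assumed by
    [pointwise_flat] is obtained by differentiating a consequence of this one. *)
Lemma torsion_commute i j : H i *m H j = H j *m H i.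
Proof.
have [P [b [PP PJ PB b0]]] := adapted_basis Gsym Gpos JJ JG (HG q) (HJ q) Hq.
exact: (framed_commute erefl PP PJ).
Qed.

(** [L i] will be the covariant derivative of [H q] along the coordinate i; at a single point it
    enters only through this trace identity. *)
Lemma pointwise_flat (L : 'I_4 -> 'M[R]_4) :
  (forall i j, \tr (Rm i j *m J *m H q)
     = \tr (H j *m J *m L i) - \tr (H i *m J *m L j)) ->
  forall i j, Rm i j = 0.
Proof.
have [P [b [PP PJ PB b0]]] := adapted_basis Gsym Gpos JJ JG (HG q) (HJ q) Hq.
exact: (framed_flat erefl PP PJ PB b0).
Qed.

End PointwiseFlatness.

(** * Matrix identities behind the covariant derivatives *)

Section MatrixAlgebra.
Context {R : realType} {n : nat}.
Implicit Types (A B G J P X N H K : 'M[R]_n).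

Lemma mulZmx a A B : (a *: A) *m B = a *: (A *m B).
Proof. by rewrite scalemxAl. Qed.
Lemma mulmxZ a A B : A *m (a *: B) = a *: (A *m B).
Proof. by rewrite scalemxAr. Qed.
Lemma addmxE A B i j : (A + B) i j = A i j + B i j. Proof. by rewrite mxE. Qed.
Lemma oppmxE A i j : (- A) i j = - A i j. Proof. by rewrite mxE. Qed.
Lemma scalemxE a A i j : (a *: A) i j = a * A i j. Proof. by rewrite mxE. Qed.
Lemma zeromxE i j : (0 : 'M[R]_n) i j = 0. Proof. by rewrite mxE. Qed.

Lemma trmxD A B : (A + B)^T = A^T + B^T. Proof. exact: linearD. Qed.
Lemma trmxN A : (- A)^T = - A^T. Proof. exact: linearN. Qed.
Lemma mxtraceN A : \tr (- A) = - \tr A. Proof. exact: linearN. Qed.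

(** After expanding with [mx_distr] and passing to entries with [mx_entry], the entries of
    noncommutative monomials are atoms, so that matrix identities become linear arithmetic. *)
Definition mx_distr := (@mulmxDl R, @mulmxDr R, @mulmxN R, @mulNmx R, mulZmx,
  mulmxZ, @mulmxA R).
Definition mx_entry := (addmxE, oppmxE, scalemxE, zeromxE).

Section ComplexStructure.
Variable J : 'M[R]_n.
Hypothesis JJ : J *m J = - 1%:M.

Lemma mulJJr A : A *m J *m J = - A.
Proof. by rewrite -mulmxA JJ mulmxN mulmx1. Qed.

(* [P] stands for the partial derivative of [J] and [X] for the Christoffel
   symbols, so that [P + J *m X - X *m J] is the covariant derivative of [J]. *)
Lemma nablaJ_anticommute P X : P *m J + J *m P = 0 ->
  (P + J *m X - X *m J) *m J = - (J *m (P + J *m X - X *m J)).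
Proof.
move=> /matrixP PJ; rewrite !mx_distr JJ !mx_distr mul1mx mulJJr.
by apply/matrixP => i j; have := PJ i j; rewrite !mx_entry; lra.
Qed.

(** The last hypothesis is the derivative of J G = - G J^T, with the derivative of the metric
    already replaced by X G + G X^T. *)
Lemma nablaJ_skew G P X : G^T = G -> J *m G = - (G *m J^T) ->
  P *m G + J *m (X *m G + G *m X^T)
    = - ((X *m G + G *m X^T) *m J^T + G *m P^T) ->
  (P + J *m X - X *m J) *m G = - (G *m (P + J *m X - X *m J)^T).
Proof.
move=> Gs JG; rewrite !(trmxD, trmxN, trmx_mul) !mx_distr JG.
rewrite -![X *m J *m G]mulmxA JG !mx_distr => /matrixP E.
by apply/matrixP => i j; have := E i j; rewrite !mx_entry; lra.
Qed.

Lemma halfJN_anticommute N : N *m J = - (J *m N) ->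
  (2^-1 *: (J *m N)) *m J = - (J *m (2^-1 *: (J *m N))).
Proof. by move=> NJ; rewrite !mx_distr -mulmxA NJ !mx_distr scalerN. Qed.

(** The product of two skew endomorphisms that anticommute is again skew. *)
Lemma halfJN_skew G N : J *m G = - (G *m J^T) -> N *m G = - (G *m N^T) ->
  N *m J = - (J *m N) ->
  (2^-1 *: (J *m N)) *m G = - (G *m (2^-1 *: (J *m N))^T).
Proof.
move=> JG NG NJ; rewrite linearZ /= mulZmx mulmxZ -mulmxA NG mulmxN mulmxA JG.
rewrite mulNmx opprK -mulmxA -trmx_mul NJ linearN /= mulmxN scalerN.
by [].
Qed.

(** With H = (1/2) J N one finds H J - J H = - 2 J H = N, so adding H to the Christoffel symbols
    cancels the covariant derivative of J. *)
Lemma canonicalJ_parallel P X N : N *m J = - (J *m N) ->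
  N = P + J *m X - X *m J ->
  P = (X + 2^-1 *: (J *m N)) *m J - J *m (X + 2^-1 *: (J *m N)).
Proof.
move=> NJ; rewrite !mx_distr -[J *m N *m J]mulmxA NJ !mx_distr JJ !mx_distr mul1mx.
move=> /matrixP E; apply/matrixP => i j; have := E i j; rewrite !mx_entry; lra.
Qed.

(* [Qd] is the partial derivative of [H]. *)
Lemma covariant_anticommute P A H Qd : P = A *m J - J *m A ->
  H *m J = - (J *m H) ->
  Qd *m J + H *m P + (P *m H + J *m Qd) = 0 ->
  (Qd + H *m A - A *m H) *m J = - (J *m (Qd + H *m A - A *m H)).
Proof.
move=> -> HJ; rewrite !mx_distr -[A *m J *m H]mulmxA -[A *m H *m J]mulmxA HJ.
rewrite !mx_distr => /matrixP E; apply/matrixP => i j.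
by have := E i j; rewrite !mx_entry; lra.
Qed.

(** The map X - J X J is twice the projection to the part commuting with J. It annihilates [K], and
    products of two anticommuting endomorphisms already commute with J. *)
Lemma commuting_part K H H' : K *m J = - (J *m K) ->
  H *m J = - (J *m H) -> H' *m J = - (J *m H') ->
  (K + (H' *m H - H *m H')) - J *m (K + (H' *m H - H *m H')) *m J
  = 2 *: (H' *m H - H *m H').
Proof.
move=> KJ HJ HJ'.
have c A B : A *m J = - (J *m A) -> B *m J = - (J *m B) ->
    J *m (A *m B) *m J = - (A *m B).
  by move=> aA aB; rewrite -!mulmxA aB !mulmxN !mulmxA -(mulmxA J A J) aA
    !mulmxN !mulmxA JJ !mulNmx mul1mx !opprK.
rewrite mulmxDr mulmxBr mulmxDl mulmxBl !c // -(mulmxA J K J) KJ mulmxN mulmxA.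
rewrite JJ mulNmx mul1mx opprK.
by apply/matrixP => i j; rewrite !mx_entry; ring.
Qed.

(** The hypothesis is the plain derivative of tr(H J H'). Since J is parallel, passing to covariant
    derivatives adds only commutators with A, which cancel under the trace. *)
Lemma trace_derivative P A H H' Qd Qd' : P = A *m J - J *m A ->
  \tr (Qd *m (J *m H') + H *m (P *m H' + J *m Qd')) = 0 ->
  \tr ((Qd + H *m A - A *m H) *m J *m H')
  + \tr (H *m J *m (Qd' + H' *m A - A *m H')) = 0.
Proof.
move=> ->; rewrite -mxtraceD !mx_distr !(mxtraceD, mxtraceN).
have := mxtrace_mulC A (H *m J *m H'); rewrite !mulmxA => ->; lra.
Qed.

(** Bringing J to the front by anticommutation changes the sign; doing it by cyclicity of the trace
    and H H' = H' H does not. *)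
Lemma commute_trace H H' : H *m J = - (J *m H) -> H' *m J = - (J *m H') ->
  H *m H' = H' *m H -> \tr (H *m (J *m H')) = 0.
Proof.
move=> HJ HJ' HH'.
have e1 : \tr (H *m (J *m H')) = - \tr (J *m (H *m H')).
  by rewrite mulmxA HJ mulNmx linearN /= mulmxA.
have e2 : \tr (H *m (J *m H')) = \tr (J *m (H *m H')).
  by rewrite mxtrace_mulC -mulmxA -HH'.
lra.
Qed.

Lemma halfJN_commute N N' : N *m J = - (J *m N) -> N' *m J = - (J *m N') ->
  (2^-1 *: (J *m N)) *m (2^-1 *: (J *m N'))
    = (2^-1 *: (J *m N')) *m (2^-1 *: (J *m N)) ->
  N *m N' = N' *m N.
Proof.
have JNJ A B : A *m J = - (J *m A) -> J *m A *m (J *m B) = A *m B.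
  move=> AJ; rewrite -mulmxA (mulmxA A) AJ mulNmx mulmxN !mulmxA JJ.
  by rewrite !mulNmx mul1mx opprK.
move=> NJ NJ'; rewrite !(mulZmx, mulmxZ) !scalerA !JNJ // => /scalerI; apply.
by rewrite mulf_neq0 // invr_eq0 pnatr_eq0.
Qed.

End ComplexStructure.

(** The hypothesis is the equality of the mixed second derivatives of G, with its first derivatives
    expressed by the metric connections X and Y. *)
Lemma curvature_skew G X Y dX dY : G^T = G ->
  dX *m G + X *m (Y *m G + G *m Y^T) + ((Y *m G + G *m Y^T) *m X^T + G *m dX^T)
  = dY *m G + Y *m (X *m G + G *m X^T) + ((X *m G + G *m X^T) *m Y^T + G *m dY^T) ->
  (dY - dX + (Y *m X - X *m Y)) *m G = - (G *m (dY - dX + (Y *m X - X *m Y))^T).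
Proof.
move=> Gs; rewrite !(trmxD, trmxN, trmx_mul) !mx_distr.
move=> /matrixP E; apply/matrixP => i j.
by have := E i j; rewrite !mx_entry; lra.
Qed.

End MatrixAlgebra.

(** * Flatness of the metric in a chart *)

Section LeviCivita.
Context {R : realType}.
Notation E := 'rV[R]_4.
Variables (U : set E) (G : E -> 'M[R]_4).
Hypothesis oU : open U.
Hypothesis sG : smooth_on U G.
Hypothesis Gsym : forall x, U x -> (G x)^T = G x.
Hypothesis Gunit : forall x, U x -> G x \in unitmx.

Definition gam (i : 'I_4) (x : E) : 'M[R]_4 :=
  \matrix_(j, k) christoffel G i j k x.

Lemma smooth_gam i : smooth_on U (gam i).
Proof.
have sGe j k : smooth_on U (fun y => G y j k) by exact: (smooth_mxP G oU).1 sG j k.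
have sI : smooth_on U (fun y => invmx (G y)) by exact: smooth_invmx.
apply/smooth_mxP => // j k.
apply: (smooth_ext oU (f := fun x => christoffel G i j k x)) => [x _|].
  by rewrite mxE.
apply: smoothM => //; first exact: smooth_cst.
apply: smooth_sum => // l; apply: smoothM => //.
  exact: (smooth_mxP _ oU).1 sI k l.
apply: smoothB => //; last exact: smooth_derive.
by apply: smoothD => //; exact: smooth_derive.
Qed.

Lemma pd_G_sym i x j k : U x -> pd i G x j k = pd i G x k j.
Proof.
move=> Ux; suff /matrixP /(_ j k) -> : pd i G x = (pd i G x)^T by rewrite mxE.
rewrite -(pd_trmx i sG Ux); apply: (pd_ext oU) => // y Uy.
by rewrite Gsym.
Qed.

Lemma gamE i x j k : U x -> gam i x j k = 2^-1 * \sum_l invmx (G x) k l *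
  (pd i G x j l + pd j G x i l - pd l G x i j).
Proof.
move=> Ux; rewrite mxE /christoffel; congr (_ * _); apply: eq_bigr => l _.
by rewrite !(pd_entry _ _ _ sG Ux).
Qed.

Lemma gam_torsion_free i j x : U x -> row j (gam i x) = row i (gam j x).
Proof.
move=> Ux; apply/rowP => k; rewrite [LHS]mxE [RHS]mxE !gamE //.
congr (_ * _); apply: eq_bigr => l _; congr (_ * _).
by rewrite (pd_G_sym l i j Ux) [X in X - _]addrC.
Qed.

(** Christoffel symbols of the first kind; here the inverse of the metric disappears, and
    symmetrising in j and k leaves the derivative of the metric. *)
Lemma gam_G i x j k : U x -> (gam i x *m G x) j k
  = 2^-1 * (pd i G x j k + pd j G x i k - pd k G x i j).
Proof.
move=> Ux; rewrite mxE.
under eq_bigr => l _ do rewrite gamE // -mulrA mulr_suml.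
rewrite -mulr_sumr exchange_big /=; congr (_ * _).
pose T p := pd i G x j p + pd j G x i p - pd p G x i j.
have GI p : \sum_l G x k l * invmx (G x) l p = (k == p)%:R.
  have /matrixP /(_ k p) := mulmxV (Gunit Ux).
  by rewrite [in LHS]mxE => ->; rewrite mxE.
rewrite (eq_bigr (fun p => (k == p)%:R * T p)); last first.
  move=> p _; rewrite -GI mulr_suml; apply: eq_bigr => l _; rewrite -/(T p).
  by have /matrixP /(_ l k) := Gsym Ux; rewrite mxE => ->; ring.
rewrite (bigD1 k) //= big1 ?addr0 ?eqxx ?mul1r // => p pk.
by rewrite eq_sym (negbTE pk) mul0r.
Qed.

Lemma metric_parallel i x : U x ->
  pd i G x = gam i x *m G x + G x *m (gam i x)^T.
Proof.
move=> Ux; apply/matrixP => j k.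
have -> : G x *m (gam i x)^T = (gam i x *m G x)^T by rewrite trmx_mul Gsym.
rewrite [RHS]mxE [X in _ = _ + X]mxE !gam_G //.
by have := pd_G_sym i k j Ux; lra.
Qed.

Lemma levi_civitaE X W x : smooth_on U W -> U x ->
  levi_civita G X W x = conn gam X W x.
Proof.
move=> sW Ux; rewrite /levi_civita /conn.
rewrite (derive_pd (X x) (smooth_differentiable sW Ux)).
under [RHS]eq_bigr => i _ do rewrite scalerDr.
rewrite big_split /=; congr (_ + _); apply/rowP => k; rewrite mxE summxE.
apply: eq_bigr => i _; rewrite !mxE mulr_sumr; apply: eq_bigr => j _.
by rewrite mxE mulrA.
Qed.

Lemma levi_civita_curvature_skew i j x : U x ->
  curv gam i j x *m G x = - (G x *m (curv gam i j x)^T).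
Proof.
move=> Ux; apply: curvature_skew; first exact: Gsym.
have pp k l : pd k (pd l G) x = pd k (gam l) x *m G x
    + gam l x *m (gam k x *m G x + G x *m (gam k x)^T)
    + ((gam k x *m G x + G x *m (gam k x)^T) *m (gam l x)^T
       + G x *m (pd k (gam l) x)^T).
  have sT : smooth_on U (fun y => (gam l y)^T).
    by apply: smooth_trmx => //; exact: smooth_gam.
  rewrite (pd_ext oU k Ux (metric_parallel l)).
  rewrite (pdD (U := U)) //; last 2 first.
  - by apply: smooth_mulmx => //; exact: smooth_gam.
  - by apply: smooth_mulmx.
  rewrite !(pd_mulmx (U := U)) //; last exact: smooth_gam.
  by rewrite (pd_trmx (U := U)) -?metric_parallel //; exact: smooth_gam.
apply: etrans (esym (pp j i)) (etrans _ (pp i j)).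
exact: (pd_schwarz oU).
Qed.

(** Torsion-freeness exchanges the row index of [gam] with its form index, also after
    differentiation; the terms of the cyclic sum then cancel in pairs. *)
Lemma levi_civita_bianchi i j k x : U x ->
  row k (curv gam i j x) + row i (curv gam j k x) + row j (curv gam k i x) = 0.
Proof.
move=> Ux.
have pds l m p : row p (pd l (gam m) x) = row m (pd l (gam p) x).
  apply/rowP => q; rewrite [LHS]mxE [RHS]mxE !(pd_entry (U := U)) //;
    try exact: smooth_gam.
  apply: near_eq_derive; apply: (open_near oU Ux) => y Uy.
  by have /rowP /(_ q) := gam_torsion_free m p Uy; rewrite !mxE.
have prs l m p : row p (gam m x *m gam l x) = row m (gam p x *m gam l x).
  by rewrite !row_mul (gam_torsion_free _ _ Ux).
rewrite /curv !linearD !linearN /=.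
rewrite (pds i j k) (pds j i k) (pds k j i) (prs i j k) (prs j i k) (prs k j i).
move: (row j (pd i _ x)) (row i (pd j _ x)) (row j (pd k _ x))
  (row j (gam k x *m gam i x)) (row i (gam k x *m gam j x))
  (row j (gam i x *m gam k x)) => a b c d e f.
by apply/rowP => q; rewrite !mxE; ring.
Qed.

Section Hermitian.
Variable J : E -> 'M[R]_4.
Hypothesis sJ : smooth_on U J.
Hypothesis JJ : forall x, U x -> J x *m J x = - 1%:M.
Hypothesis JG : forall x, U x -> J x *m G x = - (G x *m (J x)^T).
Hypothesis Gpos : forall x, U x -> forall v, v != 0 -> 0 < bil (G x) v v.

Definition nablaJ i x : 'M[R]_4 := pd i J x + J x *m gam i x - gam i x *m J x.
Definition torsion i x : 'M[R]_4 := 2^-1 *: (J x *m nablaJ i x).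
Definition canon i x : 'M[R]_4 := gam i x + torsion i x.

Lemma smooth_nablaJ i : smooth_on U (nablaJ i).
Proof.
apply: smoothB => //; last by apply: smooth_mulmx => //; exact: smooth_gam.
apply: smoothD => //; first exact: smooth_pd.
by apply: smooth_mulmx => //; exact: smooth_gam.
Qed.

Lemma smooth_torsion i : smooth_on U (torsion i).
Proof.
apply: smoothZ => //; apply: smooth_mulmx => //; exact: smooth_nablaJ.
Qed.

Lemma smooth_canon i : smooth_on U (canon i).
Proof. by apply: smoothD => //; [exact: smooth_gam | exact: smooth_torsion]. Qed.

Lemma canonical_hermitianE X W x : smooth_on U W -> U x ->
  canonical_hermitian G J X W x = conn canon X W x.
Proof.
move=> sW Ux; have sWJ : smooth_on U (fun y => W y *m J y) by exact: smooth_mulmx.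
have sWJJ : smooth_on U (fun y => W y *m J y *m J y) by exact: smooth_mulmx.
rewrite /canonical_hermitian /nabla_endo !levi_civitaE // /conn mulmx_suml.
rewrite -sumrB scaler_sumr -big_split /=; apply: eq_bigr => i _.
rewrite -scalemxAl -scalerBr scalerA mulrC -scalerA -scalerDr; congr (_ *: _).
rewrite (pd_mulmx i sWJ sJ Ux) /canon /torsion /nablaJ.
rewrite !(mulmxDr, mulmxDl, mulmxBr, mulmxN) -!scalemxAr !(mulmxDr, mulmxN) !mulmxA.
rewrite -addrA; congr (_ + (_ + _ *: _)).
by apply/rowP => k; rewrite !(mxE, mulmxDr); ring.
Qed.

Lemma nablaJJ i x : U x -> nablaJ i x *m J x = - (J x *m nablaJ i x).
Proof.
move=> Ux; apply: nablaJ_anticommute; first exact: JJ.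
rewrite -(pd_mulmx i sJ sJ Ux) (pd_ext oU i Ux JJ); exact: pd_cst.
Qed.

Lemma nablaJ_G i x : U x -> nablaJ i x *m G x = - (G x *m (nablaJ i x)^T).
Proof.
move=> Ux; apply: nablaJ_skew; [exact: Gsym | exact: JG |].
have sJT : smooth_on U (fun y => (J y)^T) by exact: smooth_trmx.
rewrite -metric_parallel // -(pd_mulmx i sJ sG Ux) (pd_ext oU i Ux JG).
rewrite (pdN (U := U)) //; last exact: smooth_mulmx.
by rewrite (pd_mulmx i sG sJT Ux) (pd_trmx i sJ Ux).
Qed.

Lemma torsionJ i x : U x -> torsion i x *m J x = - (J x *m torsion i x).
Proof. by move=> Ux; exact: halfJN_anticommute (nablaJJ i Ux). Qed.

Lemma torsion_G i x : U x -> torsion i x *m G x = - (G x *m (torsion i x)^T).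
Proof.
by move=> Ux; exact: halfJN_skew (JG Ux) (nablaJ_G i Ux) (nablaJJ i Ux).
Qed.

Lemma canon_J i x : U x -> pd i J x = canon i x *m J x - J x *m canon i x.
Proof.
by move=> Ux; apply: canonicalJ_parallel (nablaJJ i Ux) _; first exact: JJ.
Qed.

(** The covariant derivative of the torsion along i, with its form index j treated as a label. Using
    [canon] instead of [gam] is what keeps the result anticommuting with J. *)
Definition dtorsion i j x : 'M[R]_4 :=
  pd i (torsion j) x + torsion j x *m canon i x - canon i x *m torsion j x.

Lemma dtorsionJ i j x : U x -> dtorsion i j x *m J x = - (J x *m dtorsion i j x).
Proof.
move=> Ux; have sT := smooth_torsion j.
apply: (covariant_anticommute (canon_J i Ux) (torsionJ j Ux)).
rewrite -(pd_mulmx i sT sJ Ux) -(pd_mulmx i sJ sT Ux) -(pdD (U := U)) //;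
  try exact: smooth_mulmx.
rewrite -[RHS](pd_cst i 0 x); apply: (pd_ext oU) => // y Uy.
by rewrite torsionJ // addNr.
Qed.

Hypothesis flat : flat_on U (canonical_hermitian G J).

(** Expand the curvature of [canon] minus [torsion] around the flat connection [canon]. *)
Lemma levi_civita_curvature i j x : U x ->
  curv gam i j x = - (dtorsion i j x - dtorsion j i x)
    + (torsion j x *m torsion i x - torsion i x *m torsion j x).
Proof.
move=> Ux.
have F0 := (flat_onP oU smooth_canon canonical_hermitianE).1 flat i j x Ux.
have e k l : pd k (canon l) x = pd k (gam l) x + pd k (torsion l) x.
  by rewrite -(pdD (U := U)) //; [exact: smooth_gam | exact: smooth_torsion].
rewrite /curv (e i j) (e j i) /canon in F0; rewrite /curv /dtorsion /canon.
move: F0; move: (pd i (gam j) x) (pd j (gam i) x) (pd i (torsion j) x)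
  (pd j (torsion i) x) (gam i x) (gam j x) (torsion i x) (torsion j x).
move=> a b c d A B C D; rewrite !(mulmxDl, mulmxDr) => /matrixP F0.
by apply/matrixP => k l; have := F0 k l; rewrite !mx_entry; lra.
Qed.

Lemma curvature_J i j x : U x ->
  curv gam i j x - J x *m curv gam i j x *m J x
  = 2 *: (torsion j x *m torsion i x - torsion i x *m torsion j x).
Proof.
move=> Ux; rewrite levi_civita_curvature //.
apply: commuting_part; [exact: JJ | | exact: torsionJ | exact: torsionJ].
move: (dtorsionJ i j Ux) (dtorsionJ j i Ux).
move: (dtorsion i j x) (dtorsion j i x) => A B AJ BJ.
by rewrite mulNmx mulmxN mulmxBl mulmxBr AJ BJ !opprK opprD opprK.
Qed.

Lemma torsions_commute i j x : U x ->
  torsion i x *m torsion j x = torsion j x *m torsion i x.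
Proof.
move=> Ux; have [q Hq|H0] := pickP (fun q => torsion q x != 0); last first.
  have T0 k : torsion k x = 0 by have := H0 k; move=> /negbFE /eqP.
  by rewrite !T0.
apply: (torsion_commute (J := J x) (Gsym Ux) (Gpos Ux) (JJ Ux) (JG Ux)
  (H := torsion^~ x) (fun i => torsion_G i Ux) (fun i => torsionJ i Ux) Hq
  (Rm := fun i j => curv gam i j x)).
- by move=> k l; rewrite /curv; apply/matrixP => p r; rewrite !mx_entry; ring.
- by move=> k l; exact: levi_civita_curvature_skew.
- by move=> k l m; exact: levi_civita_bianchi.
- by move=> k l; exact: curvature_J.
Qed.

Lemma curvature_trace i j q x : U x ->
  \tr (curv gam i j x *m J x *m torsion q x)
  = \tr (torsion j x *m J x *m dtorsion i q x)
    - \tr (torsion i x *m J x *m dtorsion j q x).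
Proof.
move=> Ux.
(* The derivative along k of the trace of H_l J H_q, which vanishes on all of [U] because the
   torsions commute there. *)
have key k l : \tr (dtorsion k l x *m J x *m torsion q x)
    + \tr (torsion l x *m J x *m dtorsion k q x) = 0.
  apply: (trace_derivative (canon_J k Ux)).
  have sl := smooth_torsion l; have sq := smooth_torsion q.
  have sJq : smooth_on U (fun y => J y *m torsion q y) by exact: smooth_mulmx.
  rewrite -(pd_mulmx k sJ sq Ux) -(pd_mulmx k sl sJq Ux) pdE.
  have slq : smooth_on U (fun y => torsion l y *m (J y *m torsion q y)).
    exact: smooth_mulmx.
  rewrite -(derive_mxtrace (smooth_derivable slq Ux)).
  rewrite -[RHS](derive_cst (0 : R) x (ebase k)); apply: near_eq_derive.
  apply: (open_near oU Ux) => y Uy.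
  apply: commute_trace; [exact: torsionJ | exact: torsionJ |].
  exact: torsions_commute.
have Rc : curv gam i j x = - (dtorsion i j x - dtorsion j i x).
  apply: etrans (levi_civita_curvature i j Ux) _; move: (torsions_commute j i Ux).
  move: (dtorsion i j x) (dtorsion j i x) (torsion i x) (torsion j x).
  by move=> A B C D ->; rewrite subrr addr0.
move: Rc (key i j) (key j i); move: (curv gam i j x) (dtorsion i j x)
  (dtorsion j i x) (dtorsion i q x) (dtorsion j q x) (torsion i x) (torsion j x)
  (torsion q x) => F A B C D X Y Z ->.
rewrite !mulNmx !mulmxBl mxtraceN mxtraceD mxtraceN; lra.
Qed.

Lemma curvature0_torsion q i j x : U x -> torsion q x != 0 ->
  curv gam i j x = 0.
Proof.
move=> Ux Hq.
pose Rm k l := curv gam k l x.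
have Rskl k l : Rm l k = - Rm k l.
  by rewrite /Rm /curv; apply/matrixP => p r; rewrite !mx_entry; ring.
apply: (pointwise_flat (Gsym Ux) (Gpos Ux) (JJ Ux) (JG Ux) (H := torsion^~ x)
  (fun k => torsion_G k Ux) (fun k => torsionJ k Ux) Hq Rskl
  (fun k l => levi_civita_curvature_skew k l Ux)
  (fun k l m => levi_civita_bianchi k l m Ux) (fun k l => curvature_J k l Ux)
  (L := fun k => dtorsion k q x)) => k l.
exact: curvature_trace.
Qed.

Lemma levi_civita_flat : flat_on U (levi_civita G).
Proof.
apply/(flat_onP oU smooth_gam levi_civitaE) => i j x Ux.
have sC : smooth_on U (curv gam i j).
  apply: smoothD => //.
    by apply: smoothB => //; apply: smooth_pd => //; exact: smooth_gam.
  by apply: smoothB => //; apply: smooth_mulmx => //; exact: smooth_gam.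
apply/matrixP => k l; rewrite [RHS]mxE.
apply: (eq0_by_density (P := fun y => exists q, torsion q y != 0)
  (f := fun y => curv gam i j y k l) oU _ _ _ Ux).
- by move=> y Uy; exact: ((smooth_mxP _ oU).1 sC k l 0%N y Uy).
- by move=> y Uy [q Hq]; rewrite (curvature0_torsion _ _ Uy Hq) mxE.
move=> y Uy nP.
have T0 p z : (~ exists q, torsion q z != 0) -> torsion p z = 0.
  by move=> nq; apply/eqP; apply: contrapT => /negP tz; apply: nq; exists p.
(* The torsion vanishes near [y] and not only at [y], so its derivatives in the curvature formula
   vanish too. *)
have dT p r : pd p (torsion r) y = 0.
  rewrite pdE -(derive_cst (0 : 'M[R]_4) y (ebase p)); apply: near_eq_derive.
  by apply: filterS nP => z; exact: T0.
have Ty p : torsion p y = 0 by apply: T0; exact: nbhs_singleton nP.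
rewrite levi_civita_curvature // /dtorsion !dT !Ty.
move: (canon i y) (canon j y) => A B.
by rewrite !(mul0mx, mulmx0, addr0, subr0, oppr0) mxE.
Qed.

Lemma nablaJ_commute i j x : U x ->
  nablaJ i x *m nablaJ j x = nablaJ j x *m nablaJ i x.
Proof.
move=> Ux; exact: (halfJN_commute (JJ Ux) (nablaJJ i Ux) (nablaJJ j Ux)
  (torsions_commute i j Ux)).
Qed.

End Hermitian.
End LeviCivita.

(** * Selfdual forms *)

Section Pfaffian.
Context {R : realType}.

(** Two prescribed values leave two permutations, which differ by an exchange of the arguments 2 and
    3. *)
Lemma eq_perm4 (p q : 'S_4) : p o0 = q o0 -> p o1 = q o1 ->
  p = q \/ p = (tperm o2 o3 * q)%g.
Proof.
move=> p0 p1.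
have img k : k != o0 -> k != o1 -> p k = q o2 \/ p k = q o3.
  move=> k0 k1; have -> : p k = q ((q^-1)%g (p k)) by rewrite permKV.
  case E : _ / (ord4P ((q^-1)%g (p k))); first last.
  - by right.
  - by left.
  - have : p k = p o1 by rewrite p1 -E permKV.
    by move/perm_inj => kE; rewrite kE eqxx in k1.
  - have : p k = p o0 by rewrite p0 -E permKV.
    by move/perm_inj => kE; rewrite kE eqxx in k0.
have p23 : p o2 != p o3 by rewrite (inj_eq perm_inj).
have [||e2|e2] := img o2 => //; have [||e3|e3] := img o3 => //.
- by rewrite e2 e3 eqxx in p23.
- by left; apply/permP => k; case: (ord4P k).
- by right; apply/permP => k; rewrite permM; case: (ord4P k); rewrite permE /=.
- by rewrite e2 e3 eqxx in p23.
Qed.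

(** The two permutations contribute equally because [a] is skew; the factor 2 cancels the one half
    in [hodge_star]. *)
Lemma sum_perm4 (a : 'M[R]_4) (q : 'S_4) : a^T = - a ->
  \sum_(p : 'S_4 | (p o0 == q o0) && (p o1 == q o1))
    (-1) ^+ (odd_perm p) * a (p o2) (p o3)
  = 2 * ((-1) ^+ (odd_perm q) * a (q o2) (q o3)).
Proof.
move=> /skew_entry ska; set t := (tperm o2 o3 * q)%g.
have tE : [/\ t o0 = q o0, t o1 = q o1, t o2 = q o3 & t o3 = q o2].
  by split; rewrite permM permE.
have [t0 t1 t2 t3] := tE.
have tq : t != q.
  apply/eqP => /permP /(_ o2); rewrite t2 => /perm_inj /eqP.
  by [].
rewrite (bigD1 q) ?eqxx //= (bigD1 t) /=; last by rewrite t0 t1 !eqxx.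
rewrite big1 => [|p /andP[/andP[/andP[/eqP p0 /eqP p1] pq] pt]]; last first.
  by have [pE|pE] := eq_perm4 p0 p1; [rewrite pE eqxx in pq |
    move: pt; rewrite pE /t eqxx].
rewrite t2 t3 odd_permM odd_tperm /= (ska (q o2)) addr0.
by case: (odd_perm q); rewrite /= ?expr1 ?expr0; ring.
Qed.

(* A skew matrix proportional to the dual of another one is, up to a factor,
   its inverse; the factor is the Pfaffian. *)
Lemma pfaffian_mul (a s : 'M[R]_4) (k : R) : a^T = - a -> s^T = - s ->
  [/\ s o0 o1 = k * a o2 o3, s o0 o2 = - (k * a o1 o3), s o0 o3 = k * a o1 o2 &
   [/\ s o1 o2 = k * a o0 o3, s o1 o3 = - (k * a o0 o2) & s o2 o3 = k * a o0 o1]] ->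
  exists c, a *m s = c%:M.
Proof.
move=> /skew_entry ska /skew_entry sks [s01 s02 s03 [s12 s13 s23]].
have da i : a i i = 0 by have := ska i i; lra.
have ds i : s i i = 0 by have := sks i i; lra.
exists (- (k * (a o0 o1 * a o2 o3 - a o0 o2 * a o1 o3 + a o0 o3 * a o1 o2))).
have a10 := ska o0 o1; have a20 := ska o0 o2; have a30 := ska o0 o3.
have a21 := ska o1 o2; have a31 := ska o1 o3; have a32 := ska o2 o3.
have s10 := sks o0 o1; have s20 := sks o0 o2; have s30 := sks o0 o3.
have s21 := sks o1 o2; have s31 := sks o1 o3; have s32 := sks o2 o3.
apply/matrixP => i j; rewrite mxE [RHS]mxE sum4.
by case: (ord4P i); case: (ord4P j) => /=; rewrite ?da ?ds
  ?s10 ?s20 ?s30 ?s21 ?s31 ?s32 ?a10 ?a20 ?a30 ?a21 ?a31 ?a32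
  ?s01 ?s02 ?s03 ?s12 ?s13 ?s23; ring.
Qed.

Lemma inord4 : [/\ inord 0 = o0, inord 1 = o1, inord 2 = o2 & inord 3 = o3 :> 'I_4].
Proof. by split; apply: val_inj; rewrite /= inordK. Qed.

Lemma hodge_starE (o : R) (G s : 'M[R]_4) (q : 'S_4) :
  (invmx G *m s *m invmx G)^T = - (invmx G *m s *m invmx G) ->
  hodge_star o G s (q o0) (q o1) = o * Num.sqrt (\det G) *
    ((-1) ^+ (odd_perm q) * (invmx G *m s *m invmx G) (q o2) (q o3)).
Proof.
move=> ska; rewrite mxE; have [-> -> -> ->] := inord4.
rewrite (sum_perm4 q ska); move: (Num.sqrt _) (_ ^+ _ * _) => k y.
by field.
Qed.

(** Selfduality makes [s] a multiple of the dual of a = g^-1 s g^-1, so a s is scalar by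
    [pfaffian_mul]; conjugating by g turns a s into the square of the endomorphism of [s]. *)
Lemma selfdual_square (o : R) (G s : 'M[R]_4) : G^T = G -> G \in unitmx ->
  s^T = - s -> hodge_star o G s = s ->
  exists c, s *m invmx G *m (s *m invmx G) = c%:M.
Proof.
move=> Gs Gu sks sd; set a := invmx G *m s *m invmx G.
have ska : a^T = - a.
  by rewrite /a !trmx_mul trmx_inv Gs sks mulNmx mulmxN mulmxA.
have hE q := hodge_starE o q ska; rewrite sd -/a in hE.
have [|c cE] := pfaffian_mul (a := a) (k := o * Num.sqrt (\det G)) ska sks.
  (* Six permutations whose values at 0 and 1 run through the pairs i < j; their values at 2 and 3
     give the complementary entry with its sign. *)
  have e01 := hE 1%g.
  have e02 := hE (tperm o1 o2).
  have e03 := hE (tperm o1 o2 * tperm o2 o3)%g.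
  have e12 := hE (tperm o0 o2 * tperm o1 o2)%g.
  have e13 := hE (tperm o0 o3 * tperm o1 o3)%g.
  have e23 := hE (tperm o0 o2 * tperm o1 o3)%g.
  rewrite !perm1 odd_perm1 in e01.
  rewrite odd_tperm !permE /= in e02.
  rewrite odd_permM !odd_tperm !permM !permE /= in e03.
  rewrite odd_permM !odd_tperm !permM !permE /= in e12.
  rewrite odd_permM !odd_tperm !permM !permE /= in e13.
  rewrite odd_permM !odd_tperm !permM !permE /= in e23.
  rewrite (skew_entry ska o0 o2) in e13.
  rewrite !(expr0, expr1) in e01 e02 e03 e12 e13 e23.
  by split; [rewrite e01 | rewrite e02 | rewrite e03 | split;
    [rewrite e12 | rewrite e13 | rewrite e23]]; ring.
exists c; have := congr1 (fun X => G *m X *m invmx G) cE; rewrite /= /a.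
by rewrite mul_mx_scalar -scalemxAl mulmxV // scalemx1 !mulmxA mulmxV // mul1mx.
Qed.

End Pfaffian.

(** * Clifford relations and expansion in a selfdual frame *)

Section SelfdualForms.
Context {R : realType}.
Variables (o : R) (G : 'M[R]_4).
Hypothesis Gsym : G^T = G.
Hypothesis Gpos : forall v, v != 0 -> 0 < bil G v v.
Implicit Types s t : 'M[R]_4.

Let Gu : G \in unitmx := posdef_unitmx Gpos.

Lemma bilDr u v w : bil G u (v + w) = bil G u v + bil G u w.
Proof. by rewrite /bil linearD /= mulmxDr mxE. Qed.

Definition sd s := s^T = - s /\ hodge_star o G s = s.
(** The endomorphism J with s = g(J., .), thus inverse to forming the Kaehler form. *)
Definition endo s : 'M[R]_4 := s *m invmx G.

Lemma hodge_starD s t : hodge_star o G (s + t) = hodge_star o G s + hodge_star o G t.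
Proof.
apply/matrixP => i j; rewrite [RHS]mxE [LHS]mxE [X in _ = X + _]mxE.
rewrite [X in _ = _ + X]mxE -mulrDr -big_split; congr (_ * _).
by apply: eq_bigr => p _; rewrite mulmxDr mulmxDl mxE mulrDr.
Qed.

Lemma hodge_starZ c s : hodge_star o G (c *: s) = c *: hodge_star o G s.
Proof.
apply/matrixP => i j; rewrite [RHS]mxE [LHS]mxE [X in _ = _ * X]mxE mulrCA.
congr (_ * _); rewrite mulr_sumr; apply: eq_bigr => p _.
by rewrite -scalemxAr -scalemxAl mxE mulrCA.
Qed.

Lemma sdD s t : sd s -> sd t -> sd (s + t).
Proof.
by move=> [s1 s2] [t1 t2]; split; rewrite ?hodge_starD ?s2 ?t2 // trmxD s1 t1 opprD.
Qed.

Lemma sdZ c s : sd s -> sd (c *: s).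
Proof.
by move=> [s1 s2]; split; rewrite ?hodge_starZ ?s2 // linearZ /= s1 scalerN.
Qed.

Lemma endoD s t : endo (s + t) = endo s + endo t.
Proof. exact: mulmxDl. Qed.

Lemma endo_skew s : sd s -> endo s *m G = - (G *m (endo s)^T).
Proof.
by move=> [s1 _]; rewrite /endo mulmxKV // trmx_mul trmx_inv Gsym s1 mulKVmx // opprK.
Qed.

Lemma form_dotE s t : sd t -> form_dot G s t = - (4^-1 * \tr (endo s *m endo t)).
Proof.
move=> [t1 _]; rewrite /form_dot /endo t1 mulmxN mulNmx mxtraceN mulrN.
by rewrite !mulmxA.
Qed.

(** Polarisation of [selfdual_square] shows that the anticommutator is scalar, and its trace
    identifies the scalar. *)
Lemma endo_clifford s t : sd s -> sd t ->
  endo s *m endo t + endo t *m endo s = (- (2 * form_dot G s t))%:M.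
Proof.
move=> ss st.
have [c cE] := selfdual_square Gsym Gu (proj1 (sdD ss st)) (proj2 (sdD ss st)).
have [d dE] := selfdual_square Gsym Gu (proj1 ss) (proj2 ss).
have [e eE] := selfdual_square Gsym Gu (proj1 st) (proj2 st).
rewrite -/(endo _) in cE; rewrite -/(endo _) in dE; rewrite -/(endo _) in eE.
have : endo s *m endo t + endo t *m endo s = (c - d - e)%:M.
  rewrite endoD mulmxDl !mulmxDr dE eE in cE.
  rewrite !raddfB /= -cE.
  by move: (endo s *m endo t) (endo t *m endo s) => A B;
     apply/matrixP => i j; rewrite !mxE; ring.
move=> stE; rewrite stE; congr (_%:M); rewrite form_dotE //.
have := congr1 mxtrace stE; rewrite mxtraceD [\tr (endo t *m _)]mxtrace_mulC.
rewrite mxtrace_scalar => trE; rewrite -mulr_natr in trE.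
by move: trE {cE dE eE stE}; move: (\tr _) => k; lra.
Qed.

Lemma endo_square s : sd s -> endo s *m endo s = (- form_dot G s s)%:M.
Proof.
move=> ss; have := endo_clifford ss ss => /matrixP E; apply/matrixP => i j.
have := E i j; rewrite !addmxE ![_%:M _ _]mxE.
by case: (i == j); rewrite ?mulr1n ?mulr0n; lra.
Qed.

Lemma form_dotDl s s' t : form_dot G (s + s') t = form_dot G s t + form_dot G s' t.
Proof. by rewrite /form_dot !mulmxDl mxtraceD mulrDr. Qed.

Lemma form_dotZl c s t : form_dot G (c *: s) t = c * form_dot G s t.
Proof. by rewrite /form_dot -!scalemxAl mxtraceZ mulrCA. Qed.

Section Frame.
Variables s0 s1 s2 : 'M[R]_4.
Hypotheses (h0 : sd s0) (h1 : sd s1) (h2 : sd s2).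
Hypotheses (n0 : form_dot G s0 s0 = 1) (n1 : form_dot G s1 s1 = 1)
  (n2 : form_dot G s2 s2 = 1).
Hypotheses (d01 : form_dot G s0 s1 = 0) (d02 : form_dot G s0 s2 = 0)
  (d12 : form_dot G s1 s2 = 0).

Lemma orthogonal_bil s t v : sd s -> sd t -> form_dot G s t = 0 ->
  bil G (v *m endo s) (v *m endo t) = 0.
Proof.
move=> ss st st0; have E := endo_clifford ss st.
rewrite st0 mulr0 oppr0 raddf0 in E.
have e1 := bil_skew v (v *m endo t) (endo_skew ss).
have e2 := bil_skew v (v *m endo s) (endo_skew st).
rewrite (bilC Gsym) in e2.
have : bil G v (v *m endo t *m endo s) + bil G v (v *m endo s *m endo t) = 0.
  rewrite addrC in E; rewrite -bilDr -(mulmxA v (endo t)) -(mulmxA v (endo s)).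
  by rewrite -mulmxDr E mulmx0 /bil trmx0 mulmx0 mxE.
lra.
Qed.

Lemma unit_bil s v : sd s -> form_dot G s s = 1 ->
  bil G (v *m endo s) (v *m endo s) = bil G v v.
Proof.
move=> ss ns; rewrite (bil_skew _ _ (endo_skew ss)) -(mulmxA v) endo_square // ns.
by rewrite mul_mx_scalar scaleN1r (bilNr Gsym) opprK.
Qed.

(** By the Clifford relations a nonzero v and its images under the three frame endomorphisms are
    orthogonal of equal length, hence a basis. The image of v under t is orthogonal to all four,
    which bounds the rank of the selfdual forms by 3. *)
Lemma orthogonal_to_frame t : sd t -> form_dot G t s0 = 0 ->
  form_dot G t s1 = 0 -> form_dot G t s2 = 0 -> t = 0.
Proof.
move=> st t0 t1 t2.
suff T0 : endo t = 0 by rewrite -(mulmxKV Gu t) -/(endo t) T0 mul0mx.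
apply/row_matrixP => i; rewrite row0 rowE; set v := delta_mx 0 i.
have vn0 : v != 0.
  apply/eqP => /rowP /(_ i); rewrite !mxE !eqxx => /eqP.
  by rewrite oner_eq0.
have vv : bil G v v != 0 by rewrite gt_eqF ?Gpos.
have sk s : sd s -> bil G (v *m endo s) v = 0.
  by move=> ss; exact: (bil_skew0 Gsym v (endo_skew ss)).
pose P := frame4 v (v *m endo s0) (v *m endo s1) (v *m endo s2).
have [r0 r1 r2 r3] := row_frame4 v (v *m endo s0) (v *m endo s1) (v *m endo s2).
have b01 := orthogonal_bil v h0 h1 d01; have b02 := orthogonal_bil v h0 h2 d02.
have b12 := orthogonal_bil v h1 h2 d12.
have u0 := unit_bil v h0 n0; have u1 := unit_bil v h1 n1.
have u2 := unit_bil v h2 n2.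
have k0 := sk _ h0; have k1 := sk _ h1; have k2 := sk _ h2.
have PP : P *m G *m P^T = (bil G v v)%:M.
  apply/matrixP => a b; rewrite bil_entry [RHS]mxE.
  case: (ord4P a); case: (ord4P b); rewrite /P ?r0 ?r1 ?r2 ?r3 /=
    ?b01 ?b02 ?b12 ?u0 ?u1 ?u2 ?k0 ?k1 ?k2 //;
    by rewrite (bilC Gsym) ?b01 ?b02 ?b12 ?u0 ?u1 ?u2 ?k0 ?k1 ?k2.
have Pu : P *m G \in unitmx.
  have : ((bil G v v)%:M : 'M[R]_4) \in unitmx.
    by rewrite unitmxE det_scalar unitrX // unitfE.
  by rewrite -PP unitmx_mul => /andP[].
suff : P *m G *m (v *m endo t)^T = 0.
  move=> PT; have : (v *m endo t)^T = 0 by rewrite -(mulKmx Pu (_^T)) PT mulmx0.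
  by move/(congr1 trmx); rewrite trmxK trmx0.
apply/matrixP => a b; rewrite (ord1 b) [RHS]mxE.
have -> : (P *m G *m (v *m endo t)^T) a 0 = bil G (row a P) (v *m endo t).
  by rewrite /bil -!row_mul [RHS]mxE.
rewrite (bilC Gsym); case: (ord4P a); rewrite /P ?r0 ?r1 ?r2 ?r3.
- exact: sk.
- exact: (orthogonal_bil v st h0 t0).
- exact: (orthogonal_bil v st h1 t1).
- exact: (orthogonal_bil v st h2 t2).
Qed.

Lemma form_dotC s t : sd s -> sd t -> form_dot G s t = form_dot G t s.
Proof. by move=> ss st; rewrite !form_dotE // mxtrace_mulC. Qed.

Lemma frame_expand w : sd w ->
  w = form_dot G w s0 *: s0 + form_dot G w s1 *: s1 + form_dot G w s2 *: s2.
Proof.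
move=> sw; apply/eqP; rewrite -subr_eq0; apply/eqP.
set c0 := form_dot G w s0; set c1 := form_dot G w s1; set c2 := form_dot G w s2.
have -> : w - (c0 *: s0 + c1 *: s1 + c2 *: s2)
    = w + (- c0) *: s0 + (- c1) *: s1 + (- c2) *: s2.
  by rewrite !scaleNr !opprD !addrA.
have d10 : form_dot G s1 s0 = 0 by rewrite form_dotC.
have d20 : form_dot G s2 s0 = 0 by rewrite form_dotC.
have d21 : form_dot G s2 s1 = 0 by rewrite form_dotC.
apply: orthogonal_to_frame; first by do 3?[apply: sdD]; try exact: sdZ.
- by rewrite !form_dotDl !form_dotZl n0 d10 d20 -/c0; ring.
- by rewrite !form_dotDl !form_dotZl n1 d01 d21 -/c1; ring.
- by rewrite !form_dotDl !form_dotZl n2 d02 d12 -/c2; ring.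
Qed.

Lemma frame_coefficients w c0 c1 c2 : w = c0 *: s0 + c1 *: s1 + c2 *: s2 ->
  [/\ form_dot G w s0 = c0, form_dot G w s1 = c1 & form_dot G w s2 = c2].
Proof.
move=> ->.
have d10 : form_dot G s1 s0 = 0 by rewrite form_dotC.
have d20 : form_dot G s2 s0 = 0 by rewrite form_dotC.
have d21 : form_dot G s2 s1 = 0 by rewrite form_dotC.
by split; rewrite !form_dotDl !form_dotZl ?n0 ?n1 ?n2 ?d01 ?d02 ?d12
  ?d10 ?d20 ?d21; ring.
Qed.

Lemma frame_square c0 c1 c2 :
  endo (c0 *: s0 + c1 *: s1 + c2 *: s2) *m endo (c0 *: s0 + c1 *: s1 + c2 *: s2)
  = - 1%:M -> c0 ^+ 2 + c1 ^+ 2 + c2 ^+ 2 = 1.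
Proof.
set w := _ + _; have sw : sd w by do 2?[apply: sdD]; exact: sdZ.
have d10 : form_dot G s1 s0 = 0 by rewrite form_dotC.
have d20 : form_dot G s2 s0 = 0 by rewrite form_dotC.
have d21 : form_dot G s2 s1 = 0 by rewrite form_dotC.
have [w0 w1 w2] := frame_coefficients (erefl w).
have ww : form_dot G w w = c0 ^+ 2 + c1 ^+ 2 + c2 ^+ 2.
  rewrite {1}/w !form_dotDl !form_dotZl.
  by rewrite (form_dotC h0) // (form_dotC h1) // (form_dotC h2) // w0 w1 w2; ring.
rewrite endo_square // ww => /matrixP /(_ 0 0); rewrite !mxE eqxx /=; lra.
Qed.

(** The commutator of A and B is twice the sum of the minors times the products of pairs of frame
    endomorphisms, so it suffices that these three products are linearly independent. *)
Lemma frame_wedge a0 a1 a2 b0 b1 b2 :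
  let A := a0 *: endo s0 + a1 *: endo s1 + a2 *: endo s2 in
  let B := b0 *: endo s0 + b1 *: endo s1 + b2 *: endo s2 in
  A *m B = B *m A ->
  [/\ a0 * b1 - a1 * b0 = 0, a0 * b2 - a2 * b0 = 0 & a1 * b2 - a2 * b1 = 0].
Proof.
have := endo_clifford h0 h1; have := endo_clifford h0 h2.
have := endo_clifford h1 h2; rewrite d01 d02 d12 mulr0 oppr0 !raddf0.
have := endo_square h0; have := endo_square h1; have := endo_square h2.
rewrite n0 n1 n2.
move: (endo s0) (endo s1) (endo s2) => X Y Z ZZ YY XX.
move=> /eqP; rewrite addrC addr_eq0 => /eqP ZY.
move=> /eqP; rewrite addrC addr_eq0 => /eqP ZX.
move=> /eqP; rewrite addrC addr_eq0 => /eqP YX /=.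
have N1 : (-1)%:M = - 1%:M :> 'M[R]_4 by rewrite raddfN.
rewrite N1 in XX YY ZZ.
have trs (e f g : R) : e *: (X *m Y) + f *: (X *m Z) + g *: (Y *m Z) = 0 ->
    [/\ e = 0, f = 0 & g = 0].
  move=> E.
  have tXY : \tr (X *m Y) = 0.
    by have := mxtrace_mulC X Y; rewrite YX mxtraceN; lra.
  have tXZ : \tr (X *m Z) = 0.
    by have := mxtrace_mulC X Z; rewrite ZX mxtraceN; lra.
  have tYZ : \tr (Y *m Z) = 0.
    by have := mxtrace_mulC Y Z; rewrite ZY mxtraceN; lra.
  have t1 : \tr (1%:M : 'M[R]_4) = 4 by rewrite mxtrace1.
  have sql (A B : 'M[R]_4) : A *m A = - 1%:M -> A *m (A *m B) = - B.
    by move=> AA; rewrite mulmxA AA mulNmx mul1mx.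
  have sqr (A B : 'M[R]_4) : B *m B = - 1%:M -> A *m B *m B = - A.
    by move=> BB; rewrite -mulmxA BB mulmxN mulmx1.
  (* Sandwiched between the two factors of one product, that product becomes the identity, of trace
     4, and the other two become traceless; each sandwich isolates one coefficient. *)
  have mY := congr1 (fun M => \tr (X *m M *m Y)) E.
  have mZ := congr1 (fun M => \tr (X *m M *m Z)) E.
  have mX := congr1 (fun M => \tr (Y *m M *m Z)) E.
  have e1 : X *m (Y *m Z) *m Y = X *m Z.
    by rewrite -mulmxA -(mulmxA Y Z) ZY mulmxN sql // opprK.
  have e2 : Y *m (X *m Y) *m Z = X *m Z.
    by rewrite mulmxA YX mulNmx sqr // opprK.
  have e3 : X *m (X *m Y) *m Y = 1%:M by rewrite sql // mulNmx YY opprK.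
  have e4 : X *m (X *m Z) *m Y = Y *m Z by rewrite sql // mulNmx ZY opprK.
  have e5 : X *m (X *m Y) *m Z = - (Y *m Z) by rewrite sql // mulNmx.
  have e6 : X *m (X *m Z) *m Z = 1%:M by rewrite sql // mulNmx ZZ opprK.
  have e7 : X *m (Y *m Z) *m Z = - (X *m Y).
    by rewrite -mulmxA (sqr Y) // mulmxN.
  have e8 : Y *m (X *m Z) *m Z = X *m Y.
    by rewrite -mulmxA (sqr X) // mulmxN YX opprK.
  have e9 : Y *m (Y *m Z) *m Z = 1%:M by rewrite sql // mulNmx ZZ opprK.
  move: mX mY mZ; rewrite /= !(mulmx0, mul0mx) !mxtrace0.
  rewrite !(mulmxDr, mulmxDl, mulZmx, mulmxZ) e1 e2 e3 e4 e5 e6 e7 e8 e9.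
  rewrite !(mxtraceD, mxtraceN, mxtraceZ) tXY tXZ tYZ t1.
  by move=> H1 H2 H3; split; lra.
move=> AB; apply: trs.
have two : (2 : R) != 0 by rewrite pnatr_eq0.
apply: (scalerI two); rewrite scaler0; move/eqP: AB; rewrite -subr_eq0 => /eqP <-.
rewrite !(mulmxDr, mulmxDl, mulZmx, mulmxZ) YX ZX ZY XX YY ZZ.
move: (X *m Y) (X *m Z) (Y *m Z) => M1 M2 M3.
by apply/matrixP => i j; rewrite !mxE; ring.
Qed.

End Frame.
End SelfdualForms.

Lemma bilinear_wedge (R : realType) (A B u v : 'I_4 -> R) :
  (forall i j, A i * B j - A j * B i = 0) ->
  (\sum_i u i * A i) * (\sum_i v i * B i)
  - (\sum_i v i * A i) * (\sum_i u i * B i) = 0.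
Proof.
move=> AB; rewrite !big_distrlr /= [X in _ - X]exchange_big /= -sumrB.
apply: big1 => i _; rewrite -sumrB; apply: big1 => j _.
apply: (@etrans _ _ (u i * v j * (A i * B j - A j * B i))); first by ring.
by rewrite AB mulr0.
Qed.

(** * The differentials of the angles in a chart *)

Section Wedge.
Context {R : realType}.
Notation E := 'rV[R]_4.
Variables (U U' : set E) (G J : E -> 'M[R]_4) (o : E -> R).
Hypothesis oU : open U.
Hypothesis oU' : open U'.
Hypothesis UU' : U' `<=` U.
Hypothesis sG : smooth_on U G.
Hypothesis Gsym : forall x, U x -> (G x)^T = G x.
Hypothesis Gpos : forall x, U x -> forall v, v != 0 -> 0 < bil (G x) v v.
Hypothesis sJ : smooth_on U J.
Hypothesis JJ : forall x, U x -> J x *m J x = - 1%:M.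
Hypothesis JG : forall x, U x -> J x *m G x = - (G x *m (J x)^T).
Hypothesis flat : flat_on U (canonical_hermitian G J).

Let Gunit x (Ux : U x) : G x \in unitmx := posdef_unitmx (Gpos Ux).

Lemma bil_ebase (A : 'M[R]_4) i j : bil A (ebase i) (ebase j) = A i j.
Proof. by rewrite /bil -rowE trmx_delta -colE !mxE. Qed.

Lemma bil_mull (A B : 'M[R]_4) i j : bil A (ebase i *m B) (ebase j) = (B *m A) i j.
Proof. by rewrite -bil_ebase /bil !mulmxA. Qed.

Lemma bil_mulr (A B : 'M[R]_4) i j :
  bil A (ebase i) (ebase j *m B) = (A *m B^T) i j.
Proof. by rewrite -bil_ebase /bil trmx_mul !mulmxA. Qed.

Lemma parallel_pd (s : E -> 'M[R]_4) i x : smooth_on U' s ->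
  parallel_on U' G s -> U' x ->
  pd i s x = gam G i x *m s x + s x *m (gam G i x)^T.
Proof.
move=> ss par Ux; apply/matrixP => j k.
have lcE l : levi_civita G (fun=> ebase i) (fun=> ebase l) x = ebase l *m gam G i x.
  rewrite (levi_civitaE (U := U')) //; last exact: smooth_cst.
  rewrite /conn; under eq_bigr => m _ do rewrite pd_cst add0r.
  exact: (lc_ebase i (fun m => ebase l *m gam G m x)).
have := par (fun=> ebase i) (fun=> ebase j) (fun=> ebase k)
  (smooth_cst _ _) (smooth_cst _ _) (smooth_cst _ _) x Ux.
rewrite !lcE bil_mull bil_mulr (pd_entry i j k ss Ux) addmxE.
have -> : (fun y => bil (s y) (ebase j) (ebase k)) = (fun y => s y j k).
  by apply/funext => y; rewrite bil_ebase.
by move: ('D_ _ _ _) => d; lra.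
Qed.

(** The last bracket is the action of the Christoffel symbols on a 2-form, the same as in
    [parallel_pd], so it cancels when the Kaehler form is expanded in parallel forms. *)
Lemma kaehler_pd i x : U x ->
  pd i (fun y => J y *m G y) x =
  nablaJ G J i x *m G x + (gam G i x *m (J x *m G x) + J x *m G x *m (gam G i x)^T).
Proof.
move=> Ux; rewrite (pd_mulmx i sJ sG Ux) (metric_parallel oU sG Gsym Gunit i Ux).
rewrite /nablaJ; move: (pd i J x) (J x) (gam G i x) (G x) => A B C D.
by rewrite !mx_distr; apply/matrixP => j k; rewrite !mx_entry; ring.
Qed.

Section Angles.
Variables (s : 'I_3 -> E -> 'M[R]_4) (k0 k1 k2 : 'I_3) (phi psi : E -> R).
Hypothesis ss : forall k, smooth_on U' (s k).
Hypothesis par : forall k i x, U' x ->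
  pd i (s k) x = gam G i x *m s k x + s k x *m (gam G i x)^T.
Hypothesis sds : forall k x, U' x -> sd (o x) (G x) (s k x).
Hypothesis orth : forall k l x, U' x ->
  form_dot (G x) (s k x) (s l x) = (k == l)%:R.
Hypotheses (k01 : k0 != k1) (k02 : k0 != k2) (k12 : k1 != k2).
Hypotheses (sphi : smooth_on U' phi) (spsi : smooth_on U' psi).
Hypothesis sph : forall x, U' x -> J x *m G x =
  (cos (phi x) * cos (psi x)) *: s k0 x + (cos (phi x) * sin (psi x)) *: s k1 x
  + sin (phi x) *: s k2 x.

(** The coefficients of the Kaehler form as coordinates of a row vector, filled up with 0, so that
    [pd_scale] differentiates them. *)
Let Y (y : E) : E := \row_k (if k == o0 then cos (phi y) * cos (psi y)
  else if k == o1 then cos (phi y) * sin (psi y)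
  else if k == o2 then sin (phi y) else 0).

Let Y0 y : Y y 0 o0 = cos (phi y) * cos (psi y). Proof. by rewrite mxE. Qed.
Let Y1 y : Y y 0 o1 = cos (phi y) * sin (psi y). Proof. by rewrite mxE. Qed.
Let Y2 y : Y y 0 o2 = sin (phi y). Proof. by rewrite mxE. Qed.

Let sY : smooth_on U' Y.
Proof.
have ccos f : smooth_on U' f -> smooth_on U' (fun y => cos (f y)).
  exact: smooth_cos.
have ssin f : smooth_on U' f -> smooth_on U' (fun y => sin (f y)).
  exact: smooth_sin.
apply/smooth_mxP => // i j; rewrite (ord1 i).
case: (ord4P j).
- apply: (smooth_ext oU' (f := fun y => cos (phi y) * cos (psi y))) => [y _|].
    by rewrite Y0.
  by apply: smoothM => //; apply: ccos.
- apply: (smooth_ext oU' (f := fun y => cos (phi y) * sin (psi y))) => [y _|].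
    by rewrite Y1.
  by apply: smoothM => //; [apply: ccos | apply: ssin].
- apply: (smooth_ext oU' (f := fun y => sin (phi y))) => [y _|].
    by rewrite Y2.
  exact: ssin.
- apply: (smooth_ext oU' (f := fun=> 0 : R)) => [y _|]; first by rewrite mxE.
  exact: smooth_cst.
Qed.

Lemma nablaJ_frame i x : U' x -> nablaJ G J i x =
  pd i Y x 0 o0 *: endo (G x) (s k0 x) + pd i Y x 0 o1 *: endo (G x) (s k1 x)
  + pd i Y x 0 o2 *: endo (G x) (s k2 x).
Proof.
move=> Ux; have Ux' := UU' Ux.
have sYs j k : smooth_on U' (fun y => Y y 0 j *: s k y).
  by apply: smooth_scalemx => //; exact: smooth_coord.
have jgE y : U' y -> J y *m G y
    = Y y 0 o0 *: s k0 y + Y y 0 o1 *: s k1 y + Y y 0 o2 *: s k2 y.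
  by move=> Uy; rewrite sph // Y0 Y1 Y2.
have e1 := kaehler_pd i Ux'.
have e2 : pd i (fun y => J y *m G y) x =
    (pd i Y x 0 o0 *: s k0 x + Y x 0 o0 *: pd i (s k0) x)
    + (pd i Y x 0 o1 *: s k1 x + Y x 0 o1 *: pd i (s k1) x)
    + (pd i Y x 0 o2 *: s k2 x + Y x 0 o2 *: pd i (s k2) x).
  rewrite (pd_ext oU' i Ux jgE).
  rewrite (pdD i (smoothD oU' (sYs o0 k0) (sYs o1 k1)) (sYs o2 k2) Ux).
  rewrite (pdD i (sYs o0 k0) (sYs o1 k1) Ux).
  by rewrite !(pd_scale oU' _ _ sY (ss _) Ux).
rewrite e2 !(par _ i Ux) (jgE x Ux) in e1.
have : nablaJ G J i x *m G x = pd i Y x 0 o0 *: s k0 x + pd i Y x 0 o1 *: s k1 x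
    + pd i Y x 0 o2 *: s k2 x.
  move: e1; move: (nablaJ G J i x *m G x) (gam G i x) (pd i Y x) (Y x) (s k0 x)
    (s k1 x) (s k2 x) => N A P Q S0 S1 S2.
  rewrite !mx_distr => /matrixP e; apply/matrixP => j k; have := e j k.
  by rewrite !mx_entry; lra.
move=> NG; rewrite -(mulmxK (Gunit Ux') (nablaJ G J i x)) NG.
by rewrite !mulmxDl -!scalemxAl.
Qed.

Lemma derive_cos_angle (f : E -> R) i x : smooth_on U' f -> U' x ->
  'D_(ebase i) (fun y => cos (f y)) x = - sin (f x) * 'D_(ebase i) f x.
Proof.
move=> sf Ux.
exact: (derive_compR _ (smooth_differentiable sf Ux) (is_derive_cos _)).
Qed.

Lemma derive_sin_angle (f : E -> R) i x : smooth_on U' f -> U' x ->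
  'D_(ebase i) (fun y => sin (f y)) x = cos (f x) * 'D_(ebase i) f x.
Proof.
move=> sf Ux.
exact: (derive_compR _ (smooth_differentiable sf Ux) (is_derive_sin _)).
Qed.

Lemma derive_prod (f h : E -> R) i x : smooth_on U' f -> smooth_on U' h -> U' x ->
  'D_(ebase i) (fun y => f y * h y) x
  = f x * 'D_(ebase i) h x + h x * 'D_(ebase i) f x.
Proof.
move=> sf sh Ux.
exact: (deriveM (smooth_derivable sf Ux) (smooth_derivable sh Ux)).
Qed.

Let wedge i j y : R := 'D_(ebase i) psi y * 'D_(ebase j) phi y
  - 'D_(ebase j) psi y * 'D_(ebase i) phi y.

Lemma cos2_wedge i j x : U' x -> cos (phi x) ^+ 2 * wedge i j x = 0.
Proof.
move=> Ux; have Ux' := UU' Ux.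
have com := nablaJ_commute oU sG Gsym Gunit sJ JJ JG Gpos flat i j Ux'.
rewrite !nablaJ_frame // in com.
have nd k : form_dot (G x) (s k x) (s k x) = 1 by rewrite orth // eqxx.
have dd k l : k != l -> form_dot (G x) (s k x) (s l x) = 0.
  by move=> /negbTE kl; rewrite orth // kl.
have [_ e2 e3] := frame_wedge (Gsym Ux') (Gpos Ux') (sds k0 Ux) (sds k1 Ux)
  (sds k2 Ux) (nd k0) (nd k1) (nd k2) (dd _ _ k01) (dd _ _ k02) (dd _ _ k12) com.
have scp := smooth_cos oU' sphi; have scs := smooth_cos oU' spsi.
have sss := smooth_sin oU' spsi.
have p0 l : pd l Y x 0 o0 = cos (phi x) * (- sin (psi x) * 'D_(ebase l) psi x)
    + cos (psi x) * (- sin (phi x) * 'D_(ebase l) phi x).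
  rewrite (pd_entry l 0 o0 sY Ux).
  have -> : (fun y => Y y 0 o0) = (fun y => cos (phi y) * cos (psi y)).
    by apply/funext => y; rewrite Y0.
  apply: etrans (derive_prod l scp scs Ux) _.
  by congr (_ * _ + _ * _); exact: derive_cos_angle.
have p1 l : pd l Y x 0 o1 = cos (phi x) * (cos (psi x) * 'D_(ebase l) psi x)
    + sin (psi x) * (- sin (phi x) * 'D_(ebase l) phi x).
  rewrite (pd_entry l 0 o1 sY Ux).
  have -> : (fun y => Y y 0 o1) = (fun y => cos (phi y) * sin (psi y)).
    by apply/funext => y; rewrite Y1.
  apply: etrans (derive_prod l scp sss Ux) _.
  by congr (_ * _ + _ * _); [exact: derive_sin_angle | exact: derive_cos_angle].
have p2 l : pd l Y x 0 o2 = cos (phi x) * 'D_(ebase l) phi x.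
  rewrite (pd_entry l 0 o2 sY Ux).
  have -> : (fun y => Y y 0 o2) = (fun y => sin (phi y)).
    by apply/funext => y; rewrite Y2.
  exact: derive_sin_angle.
move: e2 e3; rewrite !p0 !p1 !p2 /wedge; have := cos2Dsin2 (psi x).
move: (cos (psi x)) (sin (psi x)) (cos (phi x)) (sin (phi x)) => c d e f.
move: ('D_(ebase i) psi x) ('D_(ebase j) psi x) ('D_(ebase i) phi x)
  ('D_(ebase j) phi x) => a b a' b' cd e2 e3.
have -> : e ^+ 2 * (a * b' - b * a')
    = (c ^+ 2 + d ^+ 2) * (e ^+ 2 * (a * b' - b * a')).
  by rewrite cd mul1r.
(* For the coefficients c_0, c_1, c_2 one has cos psi dc_1 - sin psi dc_0 = cos phi dpsi and dc_2 =
   cos phi dphi; the expression is the wedge product of these two. *)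
transitivity (c * ((e * (c * a) + d * (- f * a')) * (e * b')
   - e * a' * (e * (c * b) + d * (- f * b')))
   - d * ((e * (- d * a) + c * (- f * a')) * (e * b')
   - e * a' * (e * (- d * b) + c * (- f * b')))); first by ring.
by rewrite e2 e3 !mulr0 subrr.
Qed.

Lemma wedge_basis i j x : U' x -> wedge i j x = 0.
Proof.
move=> Ux.
have sw : smooth_on U' (wedge i j).
  by apply: smoothB => //; apply: smoothM => //; exact: smooth_derive.
apply: (eq0_by_density (P := fun y => cos (phi y) != 0) (f := wedge i j)
  oU' _ _ _ Ux).
- by move=> y Uy; exact: (sw 0%N y Uy).
- move=> y Uy cy; have /eqP := cos2_wedge i j Uy.
  by rewrite mulf_eq0 expf_eq0 /= (negbTE cy) => /eqP.
move=> y Uy nc.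
have c0 : cos (phi y) = 0.
  by apply/eqP; have := nbhs_singleton nc; move/negP; rewrite negbK.
(* Where cos phi vanishes on an open set, 0 = d cos phi = - sin phi dphi with sin phi equal to 1 or
   -1, so phi is locally constant. *)
have dphi l : 'D_(ebase l) phi y = 0.
  have d0 : 'D_(ebase l) (fun z => cos (phi z)) y = 0.
    apply: etrans (derive_cst (0 : R) y (ebase l)); apply: near_eq_derive.
    by apply: filterS nc => z /negP; rewrite negbK => /eqP.
  have := etrans (esym (derive_cos_angle l sphi Uy)) d0.
  have := cos2Dsin2 (phi y); rewrite c0 expr0n /= add0r.
  move: (sin (phi y)) ('D_(ebase l) phi y) => c d c1 cd.
  have cd0 : c * d = 0 by move: cd; rewrite mulNr => /eqP; rewrite oppr_eq0 => /eqP.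
  by rewrite -[d]mul1r -c1 expr2 -mulrA cd0 mulr0.
by rewrite /wedge !dphi !mulr0 subrr.
Qed.

Lemma wedge_angles x u v : U' x ->
  'D_u psi x * 'D_v phi x - 'D_v psi x * 'D_u phi x = 0.
Proof.
move=> Ux; have dp w := derive_partial w (smooth_differentiable sphi Ux).
have ds w := derive_partial w (smooth_differentiable spsi Ux).
rewrite (dp u) (dp v) (ds u) (ds v); apply: bilinear_wedge => i j.
exact: wedge_basis.
Qed.

End Angles.
End Wedge.

(** * The manifold *)

Section PolarCoordinates.
Context {R : realType}.
Implicit Types x y : R.

(** The radius is written with the cosine and sine of the angle instead of a square root, so its
    smoothness follows from theirs. *)
Lemma polar_atan x y : 0 < x -> let t := atan (y / x) in
  let r := x * cos t + y * sin t in
  [/\ 0 < r, x = r * cos t & y = r * sin t].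
Proof.
move=> x0 t r.
have ct : 0 < cos t.
  by apply: cos_gt0_pihalf; rewrite atan_gtNpi2 atan_ltpi2.
have tt : y * cos t = x * sin t.
  have := atanK (y / x); rewrite -/t /tan => /(congr1 (fun z => z * cos t * x)).
  by rewrite divfK ?gt_eqF // mulrAC divfK ?gt_eqF // mulrC => ->.
have cs := cos2Dsin2 t.
have xE : x = r * cos t.
  apply: (@etrans _ _ (x * (cos t ^+ 2 + sin t ^+ 2))); first by rewrite cs mulr1.
  apply: (@etrans _ _ (x * cos t ^+ 2 + (x * sin t) * sin t)); first by ring.
  by rewrite -tt /r; ring.
split=> //.
  by have := x0; rewrite xE pmulr_lgt0.
apply: (@etrans _ _ (y * (cos t ^+ 2 + sin t ^+ 2))); first by rewrite cs mulr1.
apply: (@etrans _ _ (y * sin t ^+ 2 + (y * cos t) * cos t)); first by ring.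
by rewrite tt /r; ring.
Qed.

(** A multiple of a quarter turn brings the point into the open right half-plane, where the
    arctangent gives the angle. *)
Lemma quarter_turn (c0 c1 : R) : c0 != 0 \/ c1 != 0 ->
  exists a : R, 0 < cos a * c0 + sin a * c1.
Proof.
move=> h.
have [c0n|c0p|c00] := ltgtP c0 0.
- by exists pi; rewrite cospi sinpi; lra.
- by exists 0; rewrite cos0 sin0; lra.
have [c1n|c1p|c10] := ltgtP c1 0.
- by exists (- (pi / 2)); rewrite cosN sinN cos_pihalf sin_pihalf; lra.
- by exists (pi / 2); rewrite cos_pihalf sin_pihalf; lra.
by case: h; rewrite ?c00 ?c10 eqxx.
Qed.

Lemma spherical_angles (c0 c1 c2 a : R) :
  c0 ^+ 2 + c1 ^+ 2 + c2 ^+ 2 = 1 -> 0 < cos a * c0 + sin a * c1 ->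
  let psi := a + atan ((cos a * c1 - sin a * c0) / (cos a * c0 + sin a * c1)) in
  let rho := c0 * cos psi + c1 * sin psi in
  let phi := atan (c2 / rho) in
  [/\ 0 < rho, c0 = cos phi * cos psi, c1 = cos phi * sin psi & c2 = sin phi].
Proof.
move=> cc; set d1 := _ + _; set d2 := cos a * c1 - _ => d10.
have [r0 d1E d2E] := polar_atan d2 d10.
set t := atan (d2 / d1) in r0 d1E d2E *; set r := _ + _ in r0 d1E d2E.
move=> psi; have cs := cos2Dsin2 a.
have c0E : c0 = cos a * d1 - sin a * d2.
  apply: (@etrans _ _ (c0 * (cos a ^+ 2 + sin a ^+ 2))); first by rewrite cs mulr1.
  by rewrite /d1 /d2; ring.
have c1E : c1 = sin a * d1 + cos a * d2.
  apply: (@etrans _ _ (c1 * (cos a ^+ 2 + sin a ^+ 2))); first by rewrite cs mulr1.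
  by rewrite /d1 /d2; ring.
have c0r : c0 = r * cos psi by rewrite c0E d1E d2E /psi cosD; ring.
have c1r : c1 = r * sin psi by rewrite c1E d1E d2E /psi sinD; ring.
have rhoE : c0 * cos psi + c1 * sin psi = r.
  apply: (@etrans _ _ (r * (cos psi ^+ 2 + sin psi ^+ 2))).
    by rewrite c0r c1r; ring.
  by rewrite cos2Dsin2 mulr1.
rewrite rhoE /=; have [q0 rE c2E] := polar_atan c2 r0.
set phi := atan (c2 / r) in q0 rE c2E *; set q := _ + _ in q0 rE c2E.
(* The last radius is positive, and its square is the squared length of (c0, c1, c2). *)
have q1 : q = 1.
  have : q ^+ 2 = 1.
    rewrite -cc c0r c1r.
    apply: (@etrans _ _ (q ^+ 2 * (cos phi ^+ 2 + sin phi ^+ 2))).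
      by rewrite cos2Dsin2 mulr1.
    apply: (@etrans _ _ ((q * cos phi) ^+ 2 + (q * sin phi) ^+ 2)); first by ring.
    rewrite -rE -c2E.
    apply: (@etrans _ _ (r ^+ 2 * (cos psi ^+ 2 + sin psi ^+ 2) + c2 ^+ 2)).
      by rewrite cos2Dsin2 mulr1.
    by ring.
  by move/eqP; rewrite sqrf_eq1 => /orP[/eqP //|/eqP qN]; rewrite qN in q0; lra.
rewrite q1 !mul1r in rE c2E.
by split=> //; rewrite -rE.
Qed.

End PolarCoordinates.

(** * From the charts to the manifold *)

Section Manifold.
Context {R : realType} {M : manifold4 R}.

Lemma cimage_open (a : chart M) (W : set M) : open W -> open (cimage a W).
Proof.
move=> oW; rewrite openE => x [p [ap Wp] <-].
have xU : (cmap a @` cdom a) (cmap a p) by exists p.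
have nU : nbhs (cmap a p) (cmap a @` cdom a).
  by apply: open_nbhs_nbhs; split=> //; exact: cimg_open.
have nW : nbhs (cmap a p) (cinv a @^-1` W).
  apply: (cinv_continuous xU); rewrite (cmapK ap).
  exact: open_nbhs_nbhs.
apply: filterS (filterI nU nW) => y [[q aq <-]] /=.
by rewrite (cmapK aq) => Wq; exists q.
Qed.

Lemma cimage_sub (a : chart M) (W W' : set M) :
  W `<=` W' -> cimage a W `<=` cimage a W'.
Proof. by move=> WW' x [p [ap /WW' Wp] <-]; exists p. Qed.

Lemma cimage_cinv (a : chart M) (W : set M) x : cimage a W x -> W (cinv a x).
Proof. by move=> [p [ap Wp] <-]; rewrite cmapK. Qed.

Lemma cimage_cmap (a : chart M) (W : set M) p :
  cdom a p -> W p -> cimage a W (cmap a p).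
Proof. by move=> ap Wp; exists p. Qed.

Lemma smooth_fun_continuous (W : set M) (f : M -> R) p :
  open W -> smooth_fun W f -> W p -> {for p, continuous f}.
Proof.
move=> oW sf Wp; have [a ap] := cdom_cover p.
have cf : {for cmap a p, continuous (fun x => f (cinv a x))}.
  by apply: (sf a 0%N); exact: cimage_cmap.
have cfm := continuous_comp (cmap_continuous ap) cf.
have nfg : {near p, (fun x => f (cinv a x)) \o cmap a =1 f}.
  have na : nbhs p (cdom a) by apply: open_nbhs_nbhs; split=> //; exact: cdom_open.
  by apply: filterS na => q aq /=; rewrite cmapK.
rewrite /prop_for /continuous_at -(nbhs_singleton nfg).
exact: cvg_trans (near_eq_cvg nfg) cfm.
Qed.

Lemma bil_ext (A B : 'M[R]_4) : (forall u v, bil A u v = bil B u v) -> A = B.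
Proof. by move=> AB; apply/matrixP => i j; rewrite -!bil_ebase. Qed.

Lemma form_dot_congr (P A B C : 'M[R]_4) : P \in unitmx -> A \in unitmx ->
  form_dot (P *m A *m P^T) (P *m B *m P^T) (P *m C *m P^T) = form_dot A B C.
Proof.
move=> Pu Au; have PTu : P^T \in unitmx by rewrite unitmx_tr.
have invE : invmx (P *m A *m P^T) = invmx P^T *m invmx A *m invmx P.
  set Y := RHS; suff XY : P *m A *m P^T *m Y = 1%:M.
    have Xu : P *m A *m P^T \in unitmx by rewrite !unitmx_mul Pu Au PTu.
    by rewrite -[RHS](mulKmx Xu) XY mulmx1.
  by rewrite /Y !mulmxA mulmxK // mulmxK // mulmxV.
rewrite /form_dot invE !trmx_mul trmxK !mulmxA; congr (_ * _).
rewrite !(mulmxK PTu) !(mulmxKV Pu) mxtrace_mulC !mulmxA mulVmx // mul1mx.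
by [].
Qed.

Section Hermitian.
Variables (g I : field2 M) (o : chart M -> 'rV[R]_4 -> R).
Hypothesis hgI : almost_hermitian g I.
Hypothesis hsd : selfdual g o setT (kaehler_form g I).
Hypothesis hflat : forall a : chart M,
  flat_on (cimage a setT) (canonical_hermitian (g a) (I a)).

Let oT a : open (cimage a (@setT M)) := @cimage_open a _ openT.
Let sg a : smooth_on (cimage a setT) (g a).
Proof. by case: hgI => -[[sg _] _] _ _; exact: sg. Qed.
Let sI a : smooth_on (cimage a setT) (I a).
Proof. by case: hgI => _ [[sI _] _] _; exact: sI. Qed.
Let gsym a x : cimage a setT x -> (g a x)^T = g a x.
Proof. by case: hgI => -[_ gs] _ _ /gs[]. Qed.
Let gpos a x : cimage a setT x -> forall v, v != 0 -> 0 < bil (g a x) v v.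
Proof. by case: hgI => -[_ gs] _ _ /gs[]. Qed.
Let II a x : cimage a setT x -> I a x *m I a x = - 1%:M.
Proof. by case: hgI => _ [_ II] _; exact: II. Qed.
Let Ig a x : cimage a setT x -> I a x *m g a x = - (g a x *m (I a x)^T).
Proof.
case: hgI => _ _ herm Ux.
have e : I a x *m g a x *m (I a x)^T = g a x.
  by apply: bil_ext => u v; rewrite -herm // /bil trmx_mul !mulmxA.
by rewrite -[in LHS]e !mulmxA II // !mulNmx mul1mx.
Qed.
Let gunit a x (Ux : cimage a setT x) : g a x \in unitmx := posdef_unitmx (gpos Ux).

Lemma hermitian_flat a : flat_on (cimage a setT) (levi_civita (g a)).
Proof.
exact: (levi_civita_flat (@oT a) (@sg a) (@gsym a) (@gunit a) (@sI a) (@II a) (@Ig a)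
  (@gpos a) (@hflat a)).
Qed.

Section ParallelFrame.
Variables (W : set M) (s : 'I_3 -> field2 M).
Hypothesis oW : open W.
Hypothesis hs : parallel_selfdual_frame g o W s.

Let WT a x : cimage a W x -> cimage a setT x.
Proof. exact: cimage_sub. Qed.

Let ss k a : smooth_on (cimage a W) (s k a).
Proof. by case: hs => tf _ _ _; have [[sm _] _] := tf k; exact: sm. Qed.

Let sds k a x : cimage a W x -> sd (o a x) (g a x) (s k a x).
Proof.
case: hs => tf sdu _ _ Wx; split; last exact: sdu.
by have [_ sk] := tf k; exact: sk.
Qed.

Let orth k l a x : cimage a W x ->
  form_dot (g a x) (s k a x) (s l a x) = (k == l)%:R.
Proof. by case: hs => _ _ _; exact. Qed.

Let sdw a x : cimage a setT x -> sd (o a x) (g a x) (kaehler_form g I a x).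
Proof.
move=> Ux; split; last exact: hsd.
by rewrite /kaehler_form trmx_mul (gsym Ux) (Ig Ux) opprK.
Qed.

Let k0 : 'I_3 := inord 0.
Let k1 : 'I_3 := inord 1.
Let k2 : 'I_3 := inord 2.
Let k01 : k0 != k1. Proof. by rewrite -val_eqE /= !inordK. Qed.
Let k02 : k0 != k2. Proof. by rewrite -val_eqE /= !inordK. Qed.
Let k12 : k1 != k2. Proof. by rewrite -val_eqE /= !inordK. Qed.

Lemma spherical_wedge (V : set M) (phi psi : M -> R) :
  open V -> V `<=` W -> smooth_fun V phi -> smooth_fun V psi ->
  spherical_form V (kaehler_form g I) s phi psi -> wedge_d_eq0 V psi phi.
Proof.
move=> oV VW sphi spsi sph a x Vx u v /=.
have VWa := @cimage_sub a _ _ VW.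
have VTa : cimage a V `<=` cimage a setT by exact: cimage_sub.
have ssV k : smooth_on (cimage a V) (s k a) by exact: smooth_sub VWa (@ss k a).
have parV k i y : cimage a V y -> pd i (s k a) y
    = gam (g a) i y *m s k a y + s k a y *m (gam (g a) i y)^T.
  move=> Vy; have parW : parallel_on (cimage a W) (g a) (s k a) by case: hs.
  exact: (parallel_pd i (@ss k a) parW (VWa _ Vy)).
apply: (wedge_angles (o := o a) (@oT a) (@cimage_open a _ oV) VTa (@sg a)
  (@gsym a) (@gpos a)
  (@sI a) (@II a) (@Ig a) (@hflat a) ssV parV _ _ k01 k02 k12
  (sphi a) (spsi a) _ u v Vx).
- by move=> k y Vy; apply: sds; exact: VWa.
- by move=> k l y Vy; apply: orth; exact: VWa.
- by move=> y Vy; exact: sph.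
Qed.

Let ch (p : M) : chart M := projT1 (cid (cdom_cover p)).
Let chP p : cdom (ch p) p. Proof. exact: projT2 (cid (cdom_cover p)). Qed.

(** A function on the manifold cannot take a chart as argument, so one is chosen at each point;
    [coef_chart] shows that any other chart gives the same value. *)
Definition coef k (p : M) : R :=
  let x := cmap (ch p) p in
  form_dot (g (ch p) x) (kaehler_form g I (ch p) x) (s k (ch p) x).

Lemma coef_chart k a x : cimage a W x ->
  coef k (cinv a x) = form_dot (g a x) (kaehler_form g I a x) (s k a x).
Proof.
move=> Wx; have Tx := WT Wx; case: (Wx) => p [ap Wp] px.
have pE : cinv a x = p by rewrite -px cmapK.
rewrite pE /coef; set b := ch p.
have tE : cmap b p = transition a b x by rewrite /transition pE.
have xWb : cimage a (W `&` cdom b) x.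
  by exists p => //; split=> //; split=> //; exact: chP.
have xTb : cimage a (setT `&` cdom b) x by apply: cimage_sub xWb => q [_ bq].
rewrite tE; set P := jacobian (transition a b) x; set y := transition a b x.
have gE : g a x = P *m g b y *m P^T by case: hgI => -[[_ gt] _] _ _; exact: gt.
have sE : s k a x = P *m s k b y *m P^T.
  by case: hs => tf _ _ _; have [[_ st] _] := tf k; exact: st.
have IE : I a x *m P = P *m I b y by case: hgI => _ [[_ It] _] _; exact: It.
(* The Jacobian is invertible because it is a factor of the invertible matrix of the metric. *)
have := gunit Tx; rewrite gE unitmx_mul => /andP[].
rewrite unitmx_mul => /andP[Pu gu _].
have wE : I a x *m g a x = P *m (I b y *m g b y) *m P^T by rewrite gE !mulmxA IE.
by rewrite /kaehler_form wE sE form_dot_congr.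
Qed.

Let smooth_w a : smooth_on (cimage a W) (kaehler_form g I a).
Proof.
apply: smooth_sub (@WT a) _.
exact: (smooth_mulmx (@oT a) (@sI a) (@sg a)).
Qed.

Lemma smooth_coef k : smooth_fun W (coef k).
Proof.
move=> a; have oa := @cimage_open a _ oW.
have sga : smooth_on (cimage a W) (g a) by exact: smooth_sub (@WT a) (@sg a).
have siv : smooth_on (cimage a W) (fun x => invmx (g a x)).
  by apply: smooth_invmx => // x Wx; apply: gunit; exact: WT.
apply: (smooth_ext oa (f := fun x =>
    form_dot (g a x) (kaehler_form g I a x) (s k a x))) => [x Wx|].
  by rewrite coef_chart.
apply: smoothM => //; first exact: smooth_cst.
apply: smooth_mxtrace => //; apply: smooth_mulmx => //; apply: smooth_mulmx => //.
  by apply: smooth_mulmx => //; exact: smooth_w.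
by apply: smooth_trmx => //; exact: ss.
Qed.

Let nd a x k : cimage a W x -> form_dot (g a x) (s k a x) (s k a x) = 1.
Proof. by move=> Wx; rewrite orth // eqxx. Qed.

Let dd a x k l : cimage a W x -> k != l -> form_dot (g a x) (s k a x) (s l a x) = 0.
Proof. by move=> Wx /negbTE kl; rewrite orth // kl. Qed.

Lemma coef_expand a x : cimage a W x -> kaehler_form g I a x
  = coef k0 (cinv a x) *: s k0 a x + coef k1 (cinv a x) *: s k1 a x
    + coef k2 (cinv a x) *: s k2 a x.
Proof.
move=> Wx; have Tx := WT Wx; rewrite !coef_chart //.
exact: (frame_expand (gsym Tx) (gpos Tx) (sds k0 Wx) (sds k1 Wx) (sds k2 Wx)
  (nd k0 Wx) (nd k1 Wx) (nd k2 Wx) (dd Wx k01) (dd Wx k02) (dd Wx k12) (sdw Tx)).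
Qed.

Lemma coef_unique a x c0 c1 c2 : cimage a W x ->
  kaehler_form g I a x = c0 *: s k0 a x + c1 *: s k1 a x + c2 *: s k2 a x ->
  [/\ coef k0 (cinv a x) = c0, coef k1 (cinv a x) = c1 & coef k2 (cinv a x) = c2].
Proof.
move=> Wx; have Tx := WT Wx; rewrite !coef_chart //.
exact: (frame_coefficients (sds k0 Wx) (sds k1 Wx) (sds k2 Wx)
  (nd k0 Wx) (nd k1 Wx) (nd k2 Wx) (dd Wx k01) (dd Wx k02) (dd Wx k12)).
Qed.

Lemma coef_sphere p : W p -> coef k0 p ^+ 2 + coef k1 p ^+ 2 + coef k2 p ^+ 2 = 1.
Proof.
move=> Wp; have Wx := cimage_cmap (chP p) Wp; have Tx := WT Wx.
apply: (frame_square (gsym Tx) (gpos Tx) (sds k0 Wx) (sds k1 Wx) (sds k2 Wx)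
  (nd k0 Wx) (nd k1 Wx) (nd k2 Wx) (dd Wx k01) (dd Wx k02) (dd Wx k12)).
have := coef_expand Wx; rewrite cmapK; last exact: chP.
by move=> <-; rewrite /endo /kaehler_form mulmxK ?gunit // II.
Qed.

Lemma coef_pole p : pole_locus W (kaehler_form g I) s p ->
  [/\ coef k0 p = 0, coef k1 p = 0 & coef k2 p = 1 \/ coef k2 p = -1].
Proof.
move=> [Wp [a ap wE]]; have Wx := cimage_cmap ap Wp.
have pole c : kaehler_form g I a (cmap a p) = c *: s k2 a (cmap a p) ->
    [/\ coef k0 p = 0, coef k1 p = 0 & coef k2 p = c].
  move=> wc; have [] := @coef_unique a (cmap a p) 0 0 c Wx.
    by rewrite wc !scale0r !add0r.
  by rewrite cmapK.
case: wE => wE.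
  by have [|-> -> ->] := pole 1; [rewrite scale1r | split=> //; left].
by have [|-> -> ->] := pole (-1); [rewrite scaleN1r | split=> //; right].
Qed.

Lemma pole_coef p : W p -> coef k0 p = 0 -> coef k1 p = 0 ->
  pole_locus W (kaehler_form g I) s p.
Proof.
move=> Wp c0 c1; split=> //; exists (ch p); first exact: chP.
have Wx := cimage_cmap (chP p) Wp.
have := coef_expand Wx; rewrite cmapK; last exact: chP.
have := coef_sphere Wp; rewrite c0 c1 !scale0r !add0r expr0n /= !add0r.
move/eqP; rewrite sqrf_eq1 => /orP[] /eqP -> ->; [left | right].
  by rewrite scale1r.
by rewrite scaleN1r.
Qed.

Lemma spherical_coef (V : set M) (phi psi : M -> R) : V `<=` W ->
  (forall q, V q -> [/\ coef k0 q = cos (phi q) * cos (psi q),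
    coef k1 q = cos (phi q) * sin (psi q) & coef k2 q = sin (phi q)]) ->
  spherical_form V (kaehler_form g I) s phi psi.
Proof.
move=> VW cE a x Vx /=; have [c0 c1 c2] := cE _ (cimage_cinv Vx).
by rewrite -c0 -c1 -c2; apply: coef_expand; exact: cimage_sub Vx.
Qed.

Lemma open_coef (f : M -> R) (V : set M) : open V ->
  (forall q, V q -> {for q, continuous f}) -> open [set q | V q /\ 0 < f q].
Proof.
move=> oV cf; rewrite openE => q [Vq fq].
have nV : nbhs q V by exact: open_nbhs_nbhs.
have nf : \forall z \near q, 0 < f z by exact: cvgr_gt (cf q Vq) _ fq.
by apply: filterS2 nV nf.
Qed.

(** The rotation chosen at [p] serves on the whole open set where [d1] is positive, so the formulas
    of [spherical_angles] define smooth angles there. *)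
Lemma spherical_off_pole p : W p -> coef k0 p != 0 \/ coef k1 p != 0 ->
  exists (V : set M) (phi psi : M -> R),
    [/\ open V /\ V p, V `<=` W, smooth_fun V phi /\ smooth_fun V psi &
        spherical_form V (kaehler_form g I) s phi psi].
Proof.
move=> Wp /quarter_turn[t tp].
pose d1 q := cos t * coef k0 q + sin t * coef k1 q.
pose d2 q := cos t * coef k1 q - sin t * coef k0 q.
pose psi q := t + atan (d2 q / d1 q).
pose rho q := coef k0 q * cos (psi q) + coef k1 q * sin (psi q).
pose phi q := atan (coef k2 q / rho q).
pose V := [set q | W q /\ 0 < d1 q].
have VW : V `<=` W by move=> q [].
have ang q : V q -> [/\ 0 < rho q, coef k0 q = cos (phi q) * cos (psi q),
    coef k1 q = cos (phi q) * sin (psi q) & coef k2 q = sin (phi q)].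
  by move=> [Wq dq]; exact: spherical_angles (coef_sphere Wq) dq.
have smW k c : smooth_fun W (fun q => c * coef k q).
  move=> a; apply: smoothM; first exact: cimage_open.
    exact: smooth_cst.
  exact: smooth_coef.
have sd1 : smooth_fun W d1.
  by move=> a; apply: smoothD; [exact: cimage_open | exact: smW | exact: smW].
have sd2 : smooth_fun W d2.
  by move=> a; apply: smoothB; [exact: cimage_open | exact: smW | exact: smW].
have oV : open V.
  by apply: open_coef => // q Wq; exact: smooth_fun_continuous oW sd1 Wq.
have sub f : smooth_fun W f -> smooth_fun V f.
  by move=> sf a; apply: smooth_sub (sf a); exact: cimage_sub.
have spsi : smooth_fun V psi.
  move=> a; have oa := @cimage_open a _ oV.
  apply: smoothD => //; first exact: smooth_cst.
  apply: smooth_atan => //; apply: smoothM => //; first exact: sub.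
  apply: smoothV => // [x Vx|]; last exact: sub.
  by have [_ dx] := cimage_cinv Vx; rewrite gt_eqF.
have srho : smooth_fun V rho.
  move=> a; have oa := @cimage_open a _ oV.
  apply: smoothD => //; apply: smoothM => //; try by apply: sub; exact: smooth_coef.
    by apply: smooth_cos => //; exact: spsi.
  by apply: smooth_sin => //; exact: spsi.
exists V, phi, psi; split=> //.
  split=> // a; have oa := @cimage_open a _ oV.
  apply: smooth_atan => //; apply: smoothM => //.
    by apply: sub; exact: smooth_coef.
  apply: smoothV => // x Vx.
  by have [rx _ _ _] := ang _ (cimage_cinv Vx); rewrite gt_eqF.
by apply: spherical_coef => // q /ang[].
Qed.

Lemma spherical_pole p :
  interior (pole_locus W (kaehler_form g I) s) p ->
  exists (V : set M) (phi psi : M -> R),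
    [/\ open V /\ V p, V `<=` W, smooth_fun V phi /\ smooth_fun V psi &
        spherical_form V (kaehler_form g I) s phi psi].
Proof.
set L := pole_locus _ _ _ => Lp.
have LW : interior L `<=` W by move=> q /interior_subset[].
have [p0 p1 p2] := coef_pole (interior_subset Lp).
have oL : open (interior L) by exact: open_interior.
have build (e th : R) : coef k2 p = e -> e * e = 1 -> cos th = 0 -> sin th = e ->
  exists (V : set M) (phi psi : M -> R),
    [/\ open V /\ V p, V `<=` W, smooth_fun V phi /\ smooth_fun V psi &
        spherical_form V (kaehler_form g I) s phi psi].
  move=> pe ee cth sth.
  (* On the pole locus the third coefficient is 1 or -1; the open condition selects one sign, so phi
     can be constant and psi chosen as 0. *)
  pose V := [set q | interior L q /\ 0 < e * coef k2 q].
  have VW : V `<=` W by move=> q [/LW].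
  have sf : smooth_fun W (fun q => e * coef k2 q).
    move=> a; apply: smoothM; first exact: cimage_open.
      exact: smooth_cst.
    exact: smooth_coef.
  exists V, (fun=> th), (fun=> 0); split=> //.
  - split; last by split=> //; rewrite pe ee ltr01.
    apply: open_coef => // q /LW Wq; exact: smooth_fun_continuous oW sf Wq.
  - by split=> a; exact: smooth_cst.
  apply: spherical_coef => // q [/interior_subset Lq e2].
  have [q0 q1 q2] := coef_pole Lq; rewrite cth sth !mul0r q0 q1; split=> //.
  by case: q2 e2 => ->; nra.
case: p2 => p2.
  by apply: (build 1 (pi / 2)); rewrite ?cos_pihalf ?sin_pihalf ?mulr1.
apply: (build (-1) (- (pi / 2))); rewrite ?cosN ?sinN ?cos_pihalf ?sin_pihalf //.
by rewrite mulrNN mulr1.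
Qed.

End ParallelFrame.
End Hermitian.
End Manifold.

Theorem theorem5p1 (R : realType) (M : manifold4 R) (g I : field2 M)
    (o : chart M -> 'rV[R]_4 -> R)
    (hgI : almost_hermitian g I)
    (ho : orientation o)
    (hsd : selfdual g o setT (kaehler_form g I))
    (hflat : forall a : chart M,
       flat_on (cimage a setT) (canonical_hermitian (g a) (I a))) :
  (forall a : chart M, flat_on (cimage a setT) (levi_civita (g a)))
  /\
  (forall (W : set M) (s : 'I_3 -> field2 M),
     open W -> parallel_selfdual_frame g o W s ->
     (forall p : M, W p ->
        (pole_locus W (kaehler_form g I) s p ->
         interior (pole_locus W (kaehler_form g I) s) p) ->
        exists (V : set M) (phi psi : M -> R),
          [/\ open V /\ V p, V `<=` W,
              smooth_fun V phi /\ smooth_fun V psi,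
              spherical_form V (kaehler_form g I) s phi psi &
              wedge_d_eq0 V psi phi])
     /\
     (forall (V : set M) (phi psi : M -> R),
        open V -> V `<=` W -> smooth_fun V phi -> smooth_fun V psi ->
        spherical_form V (kaehler_form g I) s phi psi ->
        wedge_d_eq0 V psi phi)).
Proof.
split=> [a|W s oW hs]; first exact: (hermitian_flat hgI hflat).
have wedge (V : set M) (phi psi : M -> R) : open V -> V `<=` W ->
    smooth_fun V phi -> smooth_fun V psi ->
    spherical_form V (kaehler_form g I) s phi psi -> wedge_d_eq0 V psi phi.
  by move=> *; apply: (spherical_wedge hgI hflat hs).
split=> // p Wp pole.
suff [V [phi [psi [[oV Vp] VW [sphi spsi] sph]]]] :
  exists (V : set M) (phi psi : M -> R),
    [/\ open V /\ V p, V `<=` W, smooth_fun V phi /\ smooth_fun V psi &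
        spherical_form V (kaehler_form g I) s phi psi].
  by exists V, phi, psi; split=> //; exact: wedge.
have [c0|c0] := eqVneq (coef g I s (inord 0) p) 0; last first.
  by apply: (spherical_off_pole hgI hsd oW hs Wp); left.
have [c1|c1] := eqVneq (coef g I s (inord 1) p) 0; last first.
  by apply: (spherical_off_pole hgI hsd oW hs Wp); right.
(* Both horizontal coefficients vanish, so [p] is a pole, and the hypothesis on [p] makes it an
   interior one. *)
apply: (spherical_pole hgI hsd oW hs); apply: pole.
exact: (pole_coef hgI hsd hs Wp c0 c1).
Qed.
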